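(* Let $T>0$ be fixed, $h_n=T/n$. Suppose that: (i) there is $C>0$ with $|b_{k,0}(x)-b_{k,0}(y)|\le C|x-y|$ for all $x,y\in\mathbb{R}^k$; $\sup_{t}\mathbb{E}[|f_{k,t}|^\ell]<\infty$ for all $\ell\ge 0$; and $b_{k,0}\in C^4_\uparrow(\mathbb{R}^k)$; (ii) there is $C>0$ with $|B_{i,0}(x)-B_{i,0}(y)|\le C|x-y|$ for all $x,y\in\mathbb{R}$ and $i=1,\dots,p$; $\sup_{t}\mathbb{E}[|e_t|^\ell]<\infty$ for all $\ell\ge0$; and $B_{i,0}\in C^4_\uparrow(\mathbb{R})$ for $i=1,\dots,p$; (iii) $\sigma_i>0$ ($i=1,\dots,p$) for every $\theta_k\in\Theta_k$; (iv) for $\theta_k\in\Theta_k$, $\Sigma_k(\theta_k)=\Sigma_k(\theta_{k,0})$ implies $\theta_k=\theta_{k,0}$; (v) $\mathrm{rank}\,\Delta_k=q_k$. Then, as $h_n\to0$ (equivalently $n\to\infty$), $$\hat\theta_{k,n}\to\theta_{k,0}\quad\text{in probability}$$ and $$\sqrt n(\hat\theta_{k,n}-\theta_{k,0})\to N_{q_k}\big(0,(\Delta_k^\top W_k^{-1}(\theta_{k,0})\Delta_k)^{-1}\big)\quad\text{in distribution.}$$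
   Context: Fix integers $1\le k<p$ and $r\ge1$. Parameter: $\theta_k=(\mathrm{vec}(A_k)^\top,\mathrm{vech}(\Sigma_{ff,k})^\top,\sigma_1^2,\dots,\sigma_p^2)^\top\in\Theta_k\subset\mathbb{R}^{q_k}$, where $A_k\in\mathbb{R}^{(p-k)\times k}$, $\Sigma_{ff,k}=S_kS_k^\top$ with $S_k\in\mathbb{R}^{k\times r}$, $q_k=(p-k)k+\frac{k(k+1)}2+p$, and $\Theta_k$ is convex and compact. $\Lambda_k\in\mathbb{R}^{p\times k}$ has top block $I_k$ and bottom block $A_k$, and $\Sigma_k(\theta_k)=\Lambda_k\Sigma_{ff,k}\Lambda_k^\top+\mathrm{diag}(\sigma_1^2,\dots,\sigma_p^2)$. The true parameter is $\theta_{k,0}\in\mathrm{Int}(\Theta_k)$, with components $A_{k,0},\Sigma_{ff,k,0}=S_{k,0}S_{k,0}^\top,\sigma_{i,0}^2$ and loading matrix $\Lambda_{k,0}$. The observed process is $X_t=\Lambda_{k,0}f_{k,t}+e_t$, $t\in[0,T]$, with $df_{k,t}=b_{k,0}(f_{k,t})dt+S_{k,0}dW_t$, $f_{k,0}=c_1\in\mathbb{R}^k$, and $de^{(i)}_t=B_{i,0}(e^{(i)}_t)dt+\sigma_{i,0}dB^{(i)}_t$ ($i=1,\dots,p$), $e_0=c_2\in\mathbb{R}^p$; $W$ is an $r$-dimensional standard Wiener process, $B^{(1)},\dots,B^{(p)}$ are independent one-dimensional standard Wiener processes independent of $W$; $b_{k,0}:\mathbb{R}^k\to\mathbb{R}^k$,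 $B_{i,0}:\mathbb{R}\to\mathbb{R}$; initial values are deterministic. Suprema over $t$ are over $[0,T]$. No ergodicity is assumed. Observations are $X_{t_i^n}$, $t_i^n=ih_n$, $0\le i\le n$, $T=nh_n$, and $Q_{XX}=\frac1T\sum_{i=1}^n(X_{t_i^n}-X_{t_{i-1}^n})(X_{t_i^n}-X_{t_{i-1}^n})^\top$. $\bar p=p(p+1)/2$; vec and vech are vectorization and half-vectorization; $D_p$ is the $p^2\times\bar p$ duplication matrix ($\mathrm{vec}A=D_p\mathrm{vech}A$ for symmetric $A$), $D_p^+=(D_p^\top D_p)^{-1}D_p^\top$, $W_k(\theta_k)=2D_p^+(\Sigma_k(\theta_k)\otimes\Sigma_k(\theta_k))D_p^{+\top}$. $\Delta_k$ is the $\bar p\times q_k$ Jacobian of $\theta_k\mapsto\mathrm{vech}(\Sigma_k(\theta_k))$ at $\theta_{k,0}$. The contrast function is $F_{k,n}(Q_{XX},\Sigma_k(\theta_k))=(\mathrm{vech}(Q_{XX})-\mathrm{vech}(\Sigma_k(\theta_k)))^\top W_k^{-1}(\theta_k)(\mathrm{vech}(Q_{XX})-\mathrm{vech}(\Sigma_k(\theta_k)))$, and the estimator $\hat\theta_{k,n}$ is a minimizer of $\theta_k\mapsto F_{k,n}(Q_{XX},\Sigma_k(\theta_k))$ over $\Theta_k$. $C^4_\uparrow(\mathbb{R}^d)$ is the set of functions that are four times continuously differentiable and that, together with all derivatives up to order 4, have polynomial growth, i.e. are bounded in absolute value by $C(1+|x|)^C$ for some $C>0$ (componentwise for vector-valued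 functions). *)

(* Defs.v *)
From HB Require Import structures.
From mathcomp Require Import all_boot all_order all_algebra.
From mathcomp Require Import mxtens zify.
From mathcomp Require Import all_classical all_reals all_analysis.

Set Implicit Arguments.
Unset Strict Implicit.
Unset Printing Implicit Defensive.

Import Order.TTheory GRing.Theory Num.Theory.
Import numFieldNormedType.Exports.

Local Open Scope classical_set_scope.
Local Open Scope ring_scope.

(* Column stacking: entry (i, j) of an m x n matrix goes to position j * m + i. *)
Definition vec (R : Type) (m n : nat) (A : 'M[R]_(m, n)) : 'cV[R]_(n * m) :=
  \col_l A (mxtens_unindex l).2 (mxtens_unindex l).1.

Definition unvec (R : Type) (m n : nat) (v : 'cV[R]_(n * m)) : 'M[R]_(m, n) :=
  \matrix_(i, j) v (mxtens_index (j, i)) 0.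

Lemma vecK (R : Type) (m n : nat) : cancel (@vec R m n) (@unvec R m n).
Proof. by move=> A; apply/matrixP => i j; rewrite !mxE mxtens_indexK. Qed.

Definition hdim (n : nat) : nat := (n * n.+1)./2.

(* The positions (i, j), j <= i, of the lower triangle, column after column. *)
Definition lower_seq (n : nat) : seq ('I_n * 'I_n) :=
  [seq (i, j) | j : 'I_n <- enum 'I_n,
                  i : 'I_n <- [seq i : 'I_n <- enum 'I_n | (j <= i)%N]].

Lemma size_lower_seq (n : nat) : size (lower_seq n) == hdim n.
Proof.
have count_geq (j : nat) : (j <= n)%N -> count (leq j) (iota 0 n) = (n - j)%N.
  move=> jn; rewrite -[in LHS](subnKC jn) iotaD add0n count_cat.
  rewrite (_ : count _ (iota 0 j) = 0%N) ?add0n; last first.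
    apply/eqP; rewrite -leqn0 leqNgt -has_count; apply/hasPn => m.
    by rewrite mem_iota /= add0n -ltnNge.
  rewrite -[RHS](size_iota j); apply/eqP; rewrite -all_count.
  by apply/allP => m; rewrite mem_iota => /andP[].
rewrite /lower_seq size_allpairs_dep sumnE big_map big_enum /=.
rewrite (eq_bigr (fun j : 'I_n => (n - j)%N)); last first.
  move=> j _; rewrite size_filter -(count_map val (leq j)) val_enum_ord.
  exact/count_geq/ltnW.
rewrite (reindex_inj rev_ord_inj) /= (eq_bigr (fun j : 'I_n => j.+1)); last first.
  by move=> j _; rewrite subKn.
have -> : (\sum_(j < n) j.+1 = \sum_(0 <= j < n.+1) j)%N.
  by rewrite big_ltn// add0n big_add1 /= big_mkord.
by rewrite bin2_sum bin2 /hdim mulnC.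
Qed.

Definition lower_pos (n : nat) : (hdim n).-tuple ('I_n * 'I_n) :=
  Tuple (size_lower_seq n).

Definition vech (R : Type) (n : nat) (A : 'M[R]_n) : 'cV[R]_(hdim n) :=
  \col_l A (tnth (lower_pos n) l).1 (tnth (lower_pos n) l).2.

(* Row j * n + i has its only nonzero entry in the column of the position
   (i, j) or (j, i), whichever is in the lower triangle; see [dupl_vech]. *)
Definition dupl (R : pzRingType) (n : nat) : 'M[R]_(n * n, hdim n) :=
  \matrix_(a, l) (let: (j, i) := mxtens_unindex a in
    (tnth (lower_pos n) l == (i, j)) || (tnth (lower_pos n) l == (j, i)))%:R.

Lemma lower_seqP (n : nat) (x : 'I_n * 'I_n) :
  (x \in lower_seq n) = (x.2 <= x.1)%N.
Proof.
case: x => i j /=; apply/allpairsPdep/idP => [[y [x [_]]]|ij].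
  by rewrite mem_filter => /andP[yx _] [-> ->].
by exists j, i; split; rewrite ?mem_enum // mem_filter ij mem_enum.
Qed.

Lemma lower_seq_uniq (n : nat) : uniq (lower_seq n).
Proof.
apply: allpairs_uniq_dep => [|j _|]; first exact: enum_uniq.
  exact/filter_uniq/enum_uniq.
by move=> [? ?] [? ?] /= _ _ [-> ->].
Qed.

Lemma dupl_vech (R : pzRingType) (n : nat) (A : 'M[R]_n) :
  A^T = A -> vec A = dupl R n *m vech A.
Proof.
move=> As; apply/colP => a; rewrite !mxE.
case: (mxtens_indexP a) => j i; rewrite mxtens_indexK /=.
pose x := if (j <= i)%N then (i, j) else (j, i).
have /tnthP[l xE] : x \in lower_pos n.
  rewrite /= lower_seqP /x; case: ifP => //= /negbT; rewrite -ltnNge; exact: ltnW.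
have lowE m : (tnth (lower_pos n) m == (i, j)) || (tnth (lower_pos n) m == (j, i))
              = (m == l).
  have um : uniq (lower_pos n) by exact: lower_seq_uniq.
  rewrite -(inj_eq (tuple_uniqP _ um)) -xE /x.
  have := mem_tnth m (lower_pos n); rewrite /= lower_seqP.
  case: (tnth _ m) => u v /= vu; rewrite !xpair_eqE -!val_eqE /=.
  by case: ifP => ji; rewrite xpair_eqE -!val_eqE /=; lia.
rewrite (bigD1 l) //= big1 ?addr0 => [|m ml]; rewrite !mxE mxtens_indexK lowE.
  rewrite eqxx mul1r -xE /x; case: ifP => _ //=.
  by rewrite -{1}As mxE.
by rewrite (negbTE ml) mul0r.
Qed.

(* The Moore-Penrose inverse (D^T D)^-1 D^T. *)
Definition dupl_pinv (R : fieldType) (n : nat) : 'M[R]_(hdim n, n * n) :=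
  invmx ((dupl R n)^T *m dupl R n) *m (dupl R n)^T.

(* The symmetric matrix with given half-vectorization. *)
Definition unvech (R : pzRingType) (n : nat) (v : 'cV[R]_(hdim n)) : 'M[R]_n :=
  unvec (dupl R n *m v).

Lemma vechK (R : pzRingType) (n : nat) (A : 'M[R]_n) :
  A^T = A -> unvech (vech A) = A.
Proof. by move=> As; rewrite /unvech -dupl_vech // vecK. Qed.

(* theta = (vec A, vech Sigma_ff, sigma_1^2, ..., sigma_p^2). *)
Definition qdim (p k : nat) : nat := (k * (p - k) + hdim k + p)%N.

Definition par_A (R : realType) (p k : nat) (theta : 'cV[R]_(qdim p k)) :
    'M[R]_(p - k, k) :=
  unvec (@usubmx R (k * (p - k)) (hdim k) 1
          (@usubmx R (k * (p - k) + hdim k) p 1 theta)).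

Definition par_Sff (R : realType) (p k : nat) (theta : 'cV[R]_(qdim p k)) :
    'M[R]_k :=
  unvech (@dsubmx R (k * (p - k)) (hdim k) 1
           (@usubmx R (k * (p - k) + hdim k) p 1 theta)).

Definition par_sigma2 (R : realType) (p k : nat) (theta : 'cV[R]_(qdim p k)) :
    'cV[R]_p :=
  @dsubmx R (k * (p - k) + hdim k) p 1 theta.

(* The coordinate of theta is the variance; sigma_i is its square root, which is
   positive if and only if the coordinate is. *)
Definition par_sigma (R : realType) (p k : nat) (theta : 'cV[R]_(qdim p k))
    (i : 'I_p) : R :=
  Num.sqrt (par_sigma2 theta i 0).

Definition loading (R : realType) (p k : nat) (hkp : (k <= p)%N)
    (theta : 'cV[R]_(qdim p k)) : 'M[R]_(p, k) :=
  castmx (subnKC hkp, erefl k) (col_mx 1%:M (par_A theta)).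

Definition Sigma (R : realType) (p k : nat) (hkp : (k <= p)%N)
    (theta : 'cV[R]_(qdim p k)) : 'M[R]_p :=
  loading hkp theta *m par_Sff theta *m (loading hkp theta)^T
  + diag_mx (par_sigma2 theta)^T.

Definition Wmat (R : realType) (p k : nat) (hkp : (k <= p)%N)
    (theta : 'cV[R]_(qdim p k)) : 'M[R]_(hdim p) :=
  2%:R *: (dupl_pinv R p *m tensmx (Sigma hkp theta) (Sigma hkp theta)
           *m (dupl_pinv R p)^T).

Definition contrast (R : realType) (p k : nat) (hkp : (k <= p)%N)
    (Q : 'M[R]_p) (theta : 'cV[R]_(qdim p k)) : R :=
  let u := vech Q - vech (Sigma hkp theta) in
  (u^T *m invmx (Wmat hkp theta) *m u) 0 0.

Definition Delta (R : realType) (p k : nat) (hkp : (k <= p)%N)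
    (theta : 'cV[R]_(qdim p k)) : 'M[R]_(hdim p, qdim p k) :=
  \matrix_(i, j) 'D_(delta_mx j 0) (fun t => vech (Sigma hkp t) i 0) theta.

Definition enorm (R : realType) (n : nat) (x : 'cV[R]_n) : R :=
  Num.sqrt (\sum_i x i 0 ^+ 2).

Definition poly_growth (R : realType) (V : Type) (nrm : V -> R) (g : V -> R) :=
  exists2 C : R, 0 < C & forall x, `|g x| <= C * (1 + nrm x) `^ C.

Definition pderiv (R : realType) (n : nat) (s : seq 'I_n)
    (g : 'cV[R]_n -> R) : 'cV[R]_n -> R :=
  foldr (fun i (u : 'cV[R]_n -> R) x => 'D_(delta_mx i 0) u x) g s.

Definition C4up (R : realType) (n : nat) (g : 'cV[R]_n -> R) : Prop :=
  (forall (s : seq 'I_n) (i : 'I_n) x, (size s < 4)%N ->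
     derivable (pderiv s g) x (delta_mx i 0)) /\
  (forall s : seq 'I_n, (size s <= 4)%N ->
     continuous (pderiv s g) /\ poly_growth (@enorm R n) (pderiv s g)).

Definition C4up1 (R : realType) (g : R -> R) : Prop :=
  (forall (m : nat) x, (m < 4)%N -> derivable (derive1n m g) x 1) /\
  (forall m : nat, (m <= 4)%N ->
     continuous (derive1n m g) /\
     poly_growth (fun x : R => `|x|) (derive1n m g)).

Definition mutual_indep d (Omega : measurableType d) (R : realType)
    (P : probability Omega R) (I : finType) (G : I -> set (set Omega)) : Prop :=
  forall (J : {set I}) (A : I -> set Omega),
    (forall i, i \in J -> G i (A i)) ->
    P (\big[setI/setT]_(i in J) A i) = (\prod_(i in J) fine (P (A i)))%:E.

(* The sigma-algebra generated by the real random variables [X i], [i] in [D]. *)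
Definition sigma_of (Omega : Type) (R : realType) (I : Type) (D : set I)
    (X : I -> Omega -> R) : set (set Omega) :=
  <<s [set A | exists2 i, D i &
         exists2 U : set R, measurable U & A = X i @^-1` U] >>.

Definition wiener1 d (Omega : measurableType d) (R : realType)
    (P : probability Omega R) (T : R) (B : R -> Omega -> R) : Prop :=
  [/\ forall t, 0 <= t <= T -> measurable_fun setT (B t),
      {ae P, forall w, B 0 w = 0},
      {ae P, forall w, {within `[0, T], continuous (fun t => B t w)}} &
      forall s t, 0 <= s -> s < t -> t <= T ->
        let dB : Omega -> R := fun w => B t w - B s w in
        (forall U : set R, measurable U ->
           P (dB @^-1` U) = normal_prob 0 (Num.sqrt (t - s)) U) /\
        (forall (U : set R) (A : set Omega), measurable U ->
           sigma_of `[0, s] B A ->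
           P ((dB @^-1` U) `&` A) = (P (dB @^-1` U) * P A)%E)].

Definition sigma_of_vec (Omega : Type) (R : realType) (n : nat) (T : R)
    (W : R -> Omega -> 'cV[R]_n) : set (set Omega) :=
  sigma_of (`[0, T] `*` [set: 'I_n]) (fun tj w => W tj.1 w tj.2 0).

Definition wiener d (Omega : measurableType d) (R : realType)
    (P : probability Omega R) (T : R) (n : nat)
    (W : R -> Omega -> 'cV[R]_n) : Prop :=
  (forall j, wiener1 P T (fun t w => W t w j 0)) /\
  mutual_indep P (fun j : 'I_n => sigma_of `[0, T] (fun t w => W t w j 0)).

Definition wiener_indep d (Omega : measurableType d) (R : realType)
    (P : probability Omega R) (T : R) (r p : nat)
    (W : R -> Omega -> 'cV[R]_r) (B : 'I_p -> R -> Omega -> R) : Prop :=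
  mutual_indep P (fun o : option 'I_p =>
    if o is Some i then sigma_of `[0, T] (B i) else sigma_of_vec T W).

(* dx = drift dt + dN on [0, T] with x_0 = x0.  The diffusion coefficients of the
   model are constant, so its stochastic integrals are constant linear
   combinations N of Wiener processes and the equation makes sense pathwise. *)
Definition solves_sde d (Omega : measurableType d) (R : realType)
    (P : probability Omega R) (T x0 : R) (drift N x : R -> Omega -> R) : Prop :=
  (forall t, 0 <= t <= T -> measurable_fun setT (x t)) /\
  {ae P, forall w,
    {within `[0, T], continuous (fun t => x t w)} /\
    forall t, 0 <= t <= T ->
      x t w = x0 + \int[lebesgue_measure]_(s in `[0, t]) drift s w + N t w}.

Definition bounded_moments d (Omega : measurableType d) (R : realType)
    (P : probability Omega R) (T : R) (n : nat)
    (x : R -> Omega -> 'cV[R]_n) : Prop :=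
  forall l : R, 0 <= l ->
    (ereal_sup [set 'E_P[fun w => (enorm (x t w) `^ l)%R] | t in `[0%R, T]]
     < +oo)%E.

Definition random_vector d (Omega : measurableType d) (R : realType) (n : nat)
    (X : Omega -> 'cV[R]_n) : Prop :=
  forall i, measurable_fun setT (fun w => X w i 0).

Definition cvg_in_prob d (Omega : measurableType d) (R : realType)
    (P : probability Omega R) (n : nat)
    (X : nat -> Omega -> 'cV[R]_n) (x : 'cV[R]_n) : Prop :=
  forall eps : R, 0 < eps ->
    (fun m => P [set w | eps < enorm (X m w - x)]) @ \oo --> 0%E.

(* N(m, v), including the degenerate case v = 0, for which the library's
   [normal_prob m 0] is not a point mass. *)
Definition normal1 (R : realType) (m v : R) (U : set R) : \bar R :=
  if v == 0 then \d_m U else normal_prob m (Num.sqrt v) U.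

Definition multinormal d (Omega : measurableType d) (R : realType)
    (P : probability Omega R) (n : nat)
    (m : 'cV[R]_n) (V : 'M[R]_n) (Z : Omega -> 'cV[R]_n) : Prop :=
  random_vector Z /\
  forall (a : 'cV[R]_n) (U : set R), measurable U ->
    P [set w | U ((a^T *m Z w) 0 0)]
    = normal1 ((a^T *m m) 0 0) ((a^T *m V *m a) 0 0) U.

(* Convergence in distribution to N_n(m, V): weak convergence to the law of some
   (equivalently, any) random vector with that distribution. *)
Definition cvg_in_dist_normal d (Omega : measurableType d) (R : realType)
    (P : probability Omega R) (n : nat)
    (X : nat -> Omega -> 'cV[R]_n) (m : 'cV[R]_n) (V : 'M[R]_n) : Prop :=
  exists d' (Omega' : measurableType d') (P' : probability Omega' R)
         (Z : Omega' -> 'cV[R]_n),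
    multinormal P' m V Z /\
    forall g : 'cV[R]_n -> R, continuous g ->
      (exists M : R, forall x, `|g x| <= M) ->
      ('E_P[fun w => g (X j w)] @[j --> \oo] --> 'E_P'[fun w => g (Z w)])%E.

Definition QXX (R : realType) (p : nat) (T : R) (n : nat) (X : R -> 'cV[R]_p) :
    'M[R]_p :=
  let h := T / n%:R in
  T^-1 *: \sum_(1 <= i < n.+1)
    ((X (i%:R * h) - X (i.-1%:R * h)) *m (X (i%:R * h) - X (i.-1%:R * h))^T).

(* Main.v *)
Require Import Defs.
From HB Require Import structures.
From mathcomp Require Import all_boot all_order all_algebra.
From mathcomp Require Import mxtens ring lra zify.
From mathcomp Require Import all_classical all_reals all_analysis.
From mathcomp Require Import measurable_realfun.

(* The idea.  X is the sum of a path D with continuous derivative and of a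
   constant linear combination N of Wiener processes, dN = G dZ with
   G G^T = Sigma_0.  Pathwise, D changes the realized covariation only by
   o(n^(-1/2)): for the cross terms, replace the derivative of D by a Lipschitz
   function, at a cost controlled by Cauchy-Schwarz, and sum by parts.  What
   remains is a mean of n independent quadratic forms in the Gaussian increments
   of N.  Their covariance is W by Isserlis' formula, and the characteristic
   function of the normalised sum is computed by recursion on n.  On the
   deterministic side, the contrast minimised at vech Sigma_0 + v is compared at
   th and at theta_0 + L v, where L = (Delta^T W^-1 Delta)^-1 Delta^T W^-1; this
   gives th - theta_0 = L v + o(v) with only one derivative of Sigma, and
   L W L^T = (Delta^T W^-1 Delta)^-1.  Finally, convergence of characteristic
   functions and tightness give weak convergence. *)

Set Implicit Arguments.
Unset Strict Implicit.
Unset Printing Implicit Defensive.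

Import Order.TTheory GRing.Theory Num.Theory.
Import numFieldNormedType.Exports.

Local Open Scope classical_set_scope.
Local Open Scope ring_scope.

(** * Elementary bounds, independence and normal variables *)

(** Cauchy-Schwarz alone bounds the cross terms of drift and noise by O(n^(-1/2)), the very order of
    the fluctuations; the Lipschitz substitute for the drift density gains the missing o(1). The
    thresholds so obtained depend on the path, and Egorov's theorem turns them into statements in
    probability. Several Gaussian facts are drawn from the given Wiener processes: sums of
    independent normal variables are compared with sums of increments, the normal characteristic
    function comes out of the recursion that proves the central limit theorem, and the limit vector
    is a linear image of increments. A characteristic function is handled as a pair of real means,
    of a cosine and of a sine. The comparison of contrasts is a deterministic statement, valid for
    every minimiser and all small v. It localises the minimiser by compactness and identifiability
    before it linearises, so consistency is not an input but a consequence of the tightness of sqrt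
    n (th - theta_0). Stochastic orders are expressed by exceptional events, to which such pathwise
    implications transfer directly. *)

Section trig_bounds.
Context {R : realType}.
Implicit Types x y u : R.

Lemma sin_mean_value x : exists c, sin x = x * cos c.
Proof.
have key (y : R) : 0 < y -> exists c, sin y = y * cos c.
  move=> y0; have [|c _] := @MVT R sin cos 0 y y0 (fun c _ => is_derive_sin c).
    exact/continuous_subspaceT/continuous_sin.
  by rewrite sin0 !subr0 => ->; exists c; rewrite mulrC.
have [->|x0] := eqVneq x 0; first by exists 0; rewrite sin0 mul0r.
have [/key//|xle0] := ltP 0 x.
have /key[c] : 0 < - x by rewrite oppr_gt0 lt_neqAle x0.
by rewrite sinN mulNr => /oppr_inj ->; exists c.
Qed.

Lemma normr_sin_le x : `|sin x| <= `|x|.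
Proof.
have [c ->] := sin_mean_value x.
by rewrite normrM ler_piMr// cos_max.
Qed.

Lemma onem_cos u : 1 - cos u = 2 * sin (u / 2) ^+ 2.
Proof.
rewrite [in LHS](_ : u = u / 2 + u / 2); last by rewrite -splitr.
by rewrite cosD -!expr2; have := cos2Dsin2 (u / 2); lra.
Qed.

(** By the mean value theorem sin y - y = y (cos c - 1) with 0 < c < y, and 1 - cos c = 2 sin^2
    (c/2) <= c^2 / 2. *)
Lemma sin_sub_id_le x : `|sin x - x| <= `|x| ^+ 3.
Proof.
have xle (y : R) : 0 < y -> `|sin y - y| <= `|y| ^+ 3.
  move=> y0; have [|c] := @MVT R sin cos 0 y y0 (fun c _ => is_derive_sin c).
    exact/continuous_subspaceT/continuous_sin.
  rewrite in_itv/= sin0 !subr0 => /andP[c0 cy] ->.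
  rewrite -{2}(mul1r y) -mulrBl normrM distrC onem_cos.
  rewrite normrM normrX (exprSr _ 2) ler_wpM2r//.
  have s : `|sin (c / 2)| ^+ 2 <= (c / 2) ^+ 2.
    rewrite -(real_normK (num_real (c / 2))).
    by rewrite lerXn2r ?nnegrE ?normr_sin_le.
  have cy2 : c ^+ 2 <= `|y| ^+ 2.
    by rewrite (gtr0_norm y0) lerXn2r ?nnegrE ?ltW.
  by rewrite normr_nat; move: s; rewrite expr_div_n; nra.
have [->|x0] := eqVneq x 0; first by rewrite sin0 subr0 normr0 expr0n.
have [/xle//|xle0] := ltP 0 x.
have /xle : 0 < - x by rewrite oppr_gt0 lt_neqAle x0.
by rewrite sinN -opprD !normrN.
Qed.

(** The remainder factors as 2 (u/2 - sin (u/2)) (u/2 + sin (u/2)), a cubic times a linear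
    quantity. *)
Lemma cos_taylor2_le u : `|cos u - 1 + u ^+ 2 / 2| <= u ^+ 4.
Proof.
have -> : cos u - 1 + u ^+ 2 / 2 =
    2 * ((u / 2 - sin (u / 2)) * (u / 2 + sin (u / 2))).
  by rewrite -(opprB 1) onem_cos; field.
rewrite !normrM normr_nat.
have h1 := sin_sub_id_le (u / 2); have h2 := normr_sin_le (u / 2).
have h3 : `|u / 2 + sin (u / 2)| <= 2 * `|u / 2|.
  by rewrite (le_trans (ler_normD _ _))// mulr2n mulrDl !mul1r lerD2l.
rewrite distrC in h1.
apply: (@le_trans _ _ (2 * (`|u / 2| ^+ 3 * (2 * `|u / 2|)))).
  by rewrite ler_wpM2l// ler_pM.
have -> : 2 * (`|u / 2| ^+ 3 * (2 * `|u / 2|)) = 4 * `|u / 2| ^+ 4 by ring.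
rewrite -normrX ger0_norm ?exprn_even_ge0//.
have : 0 <= u ^+ 4 by rewrite exprn_even_ge0.
by rewrite expr_div_n; lra.
Qed.

Lemma cos_lipschitz x y : `|cos x - cos y| <= `|x - y|.
Proof.
have -> : cos x - cos y = - 2 * (sin ((x + y) / 2) * sin ((x - y) / 2)).
  set a := (x + y) / 2; set b := (x - y) / 2.
  have -> : x = a + b by rewrite /a /b; field.
  have -> : y = a - b by rewrite /a /b; field.
  by rewrite cosD cosB; ring.
rewrite normrM normrN normr_nat normrM mulrCA.
rewrite (le_trans (ler_piMl _ (sin_max _)))// ?mulr_ge0//.
rewrite (le_trans (ler_wpM2l _ (normr_sin_le _)))//.
by rewrite normrM (@ger0_norm _ 2^-1)// mulrCA mulfV// mulr1.
Qed.

Lemma sin_lipschitz x y : `|sin x - sin y| <= `|x - y|.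
Proof.
rewrite -!cosBpihalf (le_trans (cos_lipschitz _ _))//.
by rewrite (_ : x - pi / 2 - (y - pi / 2) = x - y)//; ring.
Qed.

(** One has e^(-x) (1 + x) <= 1 <= 1 + x^3 = (1 - x + x^2) (1 + x), and 1 + x cancels. *)
Lemma expRN_taylor1_le x : 0 <= x -> `|expR (- x) - 1 + x| <= x ^+ 2.
Proof.
move=> x0; rewrite ger0_norm; last first.
  by have := expR_ge1Dx (- x); lra.
have e1 : expR (- x) * (1 + x) <= 1.
  rewrite -[leRHS](expRxMexpNx_1 x) mulrC ler_wpM2r ?expR_ge0//.
  exact: expR_ge1Dx.
have e0 := expR_ge0 (- x).
have : 1 <= (1 - x + x ^+ 2) * (1 + x).
  have -> : (1 - x + x ^+ 2) * (1 + x) = 1 + x ^+ 3 by ring.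
  by rewrite lerDl exprn_ge0.
move=> /(le_trans e1); rewrite ler_pM2r; last by rewrite ltr_wpDr.
lra.
Qed.

End trig_bounds.

Definition to_mfun d d' (T : measurableType d) (T' : measurableType d')
    (f : T -> T') (mf : measurable_fun setT f) : {mfun T >-> T'} :=
  MeasurableFun.Pack (MeasurableFun.Class (isMeasurableFun.Build _ _ _ _ _ mf)).

Lemma EFin_Rintegral d (T : measurableType d) (R : realType)
    (mu : {measure set T -> \bar R}) (D : set T) (f : T -> R) :
  measurable D -> mu.-integrable D (EFin \o f) ->
  (\int[mu]_(x in D) f x)%:E = (\int[mu]_(x in D) (f x)%:E)%E.
Proof. by move=> mD fi; rewrite fineK//; exact: integrable_fin_num. Qed.

(** * Independence of pairs and of blocks of random variables *)

Section independence.
Context d (Omega : measurableType d) (R : realType) (P : probability Omega R).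

Definition indep2 (X Y : Omega -> R) := forall U V,
  measurable U -> measurable V ->
  P (X @^-1` U `&` Y @^-1` V) = (P (X @^-1` U) * P (Y @^-1` V))%E.

Lemma indep2_comp (X Y : Omega -> R) (f g : R -> R) :
  measurable_fun setT f -> measurable_fun setT g ->
  indep2 X Y -> indep2 (f \o X) (g \o Y).
Proof.
move=> mf mg XY U V mU mV; apply: (XY (f @^-1` U) (g @^-1` V)).
- by rewrite -[X in measurable X]setTI; exact: mf.
- by rewrite -[X in measurable X]setTI; exact: mg.
Qed.

(** For fixed [B], the probability of the intersection with [B] and P B times P are two finite
    measures; they agree on the pi-system [G], hence on the sigma-algebra it generates. *)
Lemma pi_system_indep_half (G : set (set Omega)) (B : set Omega) :
  G `<=` measurable -> setI_closed G -> G setT -> measurable B ->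
  (forall A, G A -> P (A `&` B) = (P A * P B)%E) ->
  forall A, <<s G >> A -> P (A `&` B) = (P A * P B)%E.
Proof.
move=> Gm GI GT mB GB A sA.
have PB : P B = (fine (P B))%:E by rewrite fineK// fin_num_measure.
have fB0 : 0 <= fine (P B) by apply: fine_ge0.
rewrite muleC PB -/(mscale (NngNum fB0) P A) -/(mrestr P mB A).
apply: (@g_sigma_algebra_measure_unique _ _ _ G Gm (fun=> setT)) => //.
- by rewrite bigcup_const//; exists 0%N.
- by move=> C GC; rewrite /= /mscale/= /mrestr GB// [X in (_ * X)%E]PB muleC.
- by move=> _; rewrite ltey_eq fin_num_measure.
Qed.

Lemma pi_system_indep (G H : set (set Omega)) :
  G `<=` measurable -> setI_closed G -> G setT ->
  H `<=` measurable -> setI_closed H -> H setT ->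
  (forall A B, G A -> H B -> P (A `&` B) = (P A * P B)%E) ->
  forall A B, <<s G >> A -> <<s H >> B -> P (A `&` B) = (P A * P B)%E.
Proof.
move=> Gm GI GT Hm HI HT GH A B sA sB.
have mB : measurable B.
  exact: (smallest_sub (@sigma_algebra_measurable _ Omega) Hm).
apply: (pi_system_indep_half Gm) => // C GC.
rewrite setIC muleC; apply: (pi_system_indep_half Hm) => //; first exact: Gm.
by move=> D HD; rewrite setIC muleC; exact: GH.
Qed.

Section pair_law.
Variables (X Y : Omega -> R).
Hypotheses (mX : measurable_fun setT X) (mY : measurable_fun setT Y).
Hypothesis XY : indep2 X Y.

Let mXY : measurable_fun setT (fun w => (X w, Y w)).
Proof. exact: measurable_fun_pair. Qed.

Lemma indep2_pair_law (A : set (R * R)) : measurable A ->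
  P ((fun w => (X w, Y w)) @^-1` A) =
  (distribution P (to_mfun mX) \x distribution P (to_mfun mY))%E A.
Proof.
by move=> mA; rewrite (@product_measure_unique _ _ _ _ _ _ _ (distribution P (to_mfun mXY)))//.
Qed.

(** The law of the pair is the product of the two laws, so integrability is Tonelli's theorem and
    the product formula is Fubini's. *)
Lemma indep2_integral :
  P.-integrable setT (EFin \o X) -> P.-integrable setT (EFin \o Y) ->
  P.-integrable setT (EFin \o (X \* Y)) /\
  \int[P]_w (X w * Y w) = (\int[P]_w X w) * (\int[P]_w Y w).
Proof.
move=> iX iY.
set pX := distribution P (to_mfun mX); set pY := distribution P (to_mfun mY).
pose f (z : R * R) := (z.1 * z.2)%:E.
have mf : measurable_fun setT f.
  apply/measurable_EFinP/measurable_funM; first exact: measurable_fst.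
  exact: measurable_snd.
have iX' : pX.-integrable setT EFin.
  by apply: integrable_pushforward => //; rewrite preimage_setT.
have iY' : pY.-integrable setT EFin.
  by apply: integrable_pushforward => //; rewrite preimage_setT.
have if1 : (pX \x pY)%E.-integrable setT f.
  apply/integrable12ltyP => //=.
  under eq_integral => x _.
    under eq_integral do rewrite /f/= normrM EFinM.
    rewrite ge0_integralZl//; last by apply/measurable_EFinP; exact: normr_measurable.
    over.
  have [_ X1] := integrableP _ _ _ iX'; have [_ Y1] := integrableP _ _ _ iY'.
  rewrite ge0_integralZr//; last 2 first.
  - by apply/measurable_EFinP; exact: normr_measurable.
  - exact: integral_ge0.
  by rewrite lte_mul_pinfty// ?integral_ge0// ge0_fin_numE// integral_ge0.
have if2 : (distribution P (to_mfun mXY)).-integrable setT f.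
  apply/integrableP; split => //.
  have [_] := integrableP _ _ _ if1; apply: le_lt_trans.
  rewrite le_eqVlt; apply/orP; left; apply/eqP.
  by apply: eq_measure_integral => A mA _; exact: indep2_pair_law.
have if3 : P.-integrable setT (EFin \o (X \* Y)).
  apply/integrableP; split.
    exact/measurable_EFinP/measurable_funM.
  have [_] := integrableP _ _ _ if2.
  by rewrite ge0_integral_distribution//; exact: measurableT_comp.
split => //.
have E1 : (\int[P]_w (X w * Y w)%:E =
    (\int[P]_w X w)%:E * (\int[P]_w Y w)%:E)%E.
  rewrite !EFin_Rintegral//.
  rewrite -[LHS](@integral_distribution _ _ _ _ _ P (to_mfun mXY) f)//.
  transitivity (\int[(pX \x pY)%E]_z f z)%E.
    by apply: eq_measure_integral => A mA _; exact: indep2_pair_law.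
  rewrite -integral12_prod_meas1//.
  transitivity (\int[pX]_x (x%:E * \int[pY]_y y%:E))%E.
    apply: eq_integral => x _; rewrite /fubini_F /f/=.
    by rewrite -integralZl//; apply: eq_integral => y _; rewrite EFinM.
  rewrite -[X in (_ * X)%E](@integral_distribution _ _ _ _ _ P (to_mfun mY) EFin)//.
  rewrite -[X in (X * _)%E](@integral_distribution _ _ _ _ _ P (to_mfun mX) EFin)//.
  have -> : (\int[pY]_y y%:E = (\int[pY]_y y)%:E)%E.
    by rewrite EFin_Rintegral.
  by rewrite integralZr.
by rewrite /Rintegral E1.
Qed.

End pair_law.

Section family.
Variables (I : finType) (xi : I -> Omega -> R).

(** Only the full index set occurs: with [U i = setT] outside a subset, the product formula for that
    subset follows. *)
Definition indep_family := forall U : I -> set R,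
  (forall i, measurable (U i)) ->
  P (\big[setI/setT]_i (xi i @^-1` U i)) =
  (\prod_i fine (P (xi i @^-1` U i)))%:E.

(** A pi-system that generates the sigma-algebra of the variables indexed by [A]; measurability with
    respect to a block of variables is stated through it. *)
Definition rectangles (A : pred I) : set (set Omega) :=
  [set E | exists2 U : I -> set R, (forall i, measurable (U i)) &
     E = \big[setI/setT]_(i | A i) (xi i @^-1` U i)].

Hypothesis mxi : forall i, measurable_fun setT (xi i).
Hypothesis hxi : indep_family.

Let rect_mkcond (A : pred I) (U : I -> set R) :
  \big[setI/setT]_(i | A i) (xi i @^-1` U i) =
  \big[setI/setT]_i (xi i @^-1` (if A i then U i else setT)).
Proof. by rewrite big_mkcond; apply: eq_bigr => i _; case: ifP. Qed.

Let indep_family_sub (A : pred I) (U : I -> set R) :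
  (forall i, measurable (U i)) ->
  P (\big[setI/setT]_(i | A i) (xi i @^-1` U i)) =
  (\prod_(i | A i) fine (P (xi i @^-1` U i)))%:E.
Proof.
move=> mU; rewrite rect_mkcond hxi; last by move=> i; case: ifP.
congr _%:E; rewrite [RHS]big_mkcond; apply: eq_bigr => i _.
by case: ifP => // _; rewrite preimage_setT probability_setT.
Qed.

Let rectangles_measurable A : rectangles A `<=` measurable.
Proof.
move=> _ [U mU ->]; apply: bigsetI_measurable => i _.
by rewrite -[X in measurable X]setTI; exact: mxi.
Qed.

Let rectangles_setI A : setI_closed (rectangles A).
Proof.
move=> _ _ [U mU ->] [V mV ->]; exists (fun i => U i `&` V i).
  by move=> i; exact: measurableI.
by rewrite -big_split/=; apply: eq_bigr => i _; rewrite preimage_setI.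
Qed.

Let rectangles_setT A : rectangles A setT.
Proof. by exists (fun=> setT) => //; rewrite big1. Qed.

Lemma rectangles_measurable_fun (A : pred I) i : A i ->
  measurable_fun (setT : set (g_sigma_algebraType (rectangles A))) (xi i).
Proof.
move=> Ai _ V mV; rewrite setTI; apply: sub_sigma_algebra.
exists (fun j => if j == i then V else setT); first by move=> j; case: ifP.
rewrite (bigD1 i)//= eqxx big1 ?setIT// => j /andP[_ /negbTE ->].
by rewrite preimage_setT.
Qed.

Lemma indep_family_indep2 (A B : pred I) (X Y : Omega -> R) :
  (forall i, A i -> ~~ B i) ->
  measurable_fun (setT : set (g_sigma_algebraType (rectangles A))) X ->
  measurable_fun (setT : set (g_sigma_algebraType (rectangles B))) Y ->
  indep2 X Y.
Proof.
move=> AB mX mY U V mU mV.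
apply: (@pi_system_indep (rectangles A) (rectangles B)) => //; last 2 first.
- by have := mX measurableT _ mU; rewrite setTI.
- by have := mY measurableT _ mV; rewrite setTI.
move=> _ _ [U1 mU1 ->] [V1 mV1 ->]; rewrite !indep_family_sub// -EFinM.
(* As [A] and [B] are disjoint, one family [W] cuts out both rectangles, and their intersection is
   the rectangle over the union of the two blocks. *)
pose W i := if A i then U1 i else V1 i.
have BA i : B i -> A i = false.
  by move=> Bi; apply/negbTE/negP => /AB; rewrite Bi.
have UW : \big[setI/setT]_(i | A i) (xi i @^-1` U1 i) =
    \big[setI/setT]_(i | A i) (xi i @^-1` W i).
  by apply: eq_bigr => i Ai; rewrite /W Ai.
have VW : \big[setI/setT]_(i | B i) (xi i @^-1` V1 i) =
    \big[setI/setT]_(i | B i) (xi i @^-1` W i).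
  by apply: eq_bigr => i /BA Ai; rewrite /W Ai.
have mW i : measurable (W i) by rewrite /W; case: ifP.
have split_big S (idx : S) (op : Monoid.com_law idx) (F : I -> S) :
    op (\big[op/idx]_(i | A i) F i) (\big[op/idx]_(i | B i) F i) =
    \big[op/idx]_(i | A i || B i) F i.
  rewrite [RHS](bigID A)/=; congr (op _ _).
    by apply: eq_bigl => i; case: (A i) => //; rewrite andbF.
  apply: eq_bigl => i; case: (boolP (B i)) => [/BA ->//|_].
  by rewrite orbF andbN.
rewrite UW VW split_big indep_family_sub//; congr _%:E.
rewrite -(split_big _ _ _ (fun i => fine (P (xi i @^-1` W i)))); congr (_ * _).
- by apply: eq_bigr => i Ai; rewrite /W Ai.
- by apply: eq_bigr => i /BA Ai; rewrite /W Ai.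
Qed.

End family.
End independence.

Lemma indep2_add_law d1 (O1 : measurableType d1) d2 (O2 : measurableType d2)
    (R : realType) (P1 : probability O1 R) (P2 : probability O2 R)
    (X1 Y1 : O1 -> R) (X2 Y2 : O2 -> R) :
  measurable_fun setT X1 -> measurable_fun setT Y1 ->
  measurable_fun setT X2 -> measurable_fun setT Y2 ->
  indep2 P1 X1 Y1 -> indep2 P2 X2 Y2 ->
  (forall U, measurable U -> P1 (X1 @^-1` U) = P2 (X2 @^-1` U)) ->
  (forall U, measurable U -> P1 (Y1 @^-1` U) = P2 (Y2 @^-1` U)) ->
  forall U, measurable U ->
    P1 ((X1 \+ Y1) @^-1` U) = P2 ((X2 \+ Y2) @^-1` U).
Proof.
move=> mX1 mY1 mX2 mY2 h1 h2 hX hY U mU.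
pose A : set (R * R) := (fun z => z.1 + z.2) @^-1` U.
have mA : measurable A.
  rewrite -[A]setTI.
  by apply: (measurable_funD measurable_fst measurable_snd).
have := indep2_pair_law mX1 mY1 h1 mA; have := indep2_pair_law mX2 mY2 h2 mA.
move=> H2 H1.
have -> : P1 ((X1 \+ Y1) @^-1` U) = P1 ((fun w => (X1 w, Y1 w)) @^-1` A) by [].
rewrite H1.
have -> : P2 ((X2 \+ Y2) @^-1` U) = P2 ((fun w => (X2 w, Y2 w)) @^-1` A) by [].
rewrite H2; apply: product_measure_unique => // V W mV mW.
apply: (etrans (product_measure1E _ _ mV mW)); congr (_ * _)%E.
- exact/esym/hX.
- exact/esym/hY.
Qed.

(** * Moments and scaling of the normal law *)

Section normal_law.
Context {R : realType}.
Local Notation mu := (@lebesgue_measure R).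

Lemma ge0_integral_normal_prob (m s : R) (f : R -> \bar R) :
  (forall x, 0 <= f x)%E -> measurable_fun setT f ->
  (\int[normal_prob m s]_x f x = \int[mu]_x (f x * (normal_pdf m s x)%:E))%E.
Proof.
move=> f0 mf.
have numu := normal_prob_dominates m s.
rewrite -(Radon_Nikodym_SigmaFinite.change_of_variables numu)//.
have mp : measurable_fun setT (EFin \o normal_pdf m s).
  by apply/measurable_EFinP; exact: measurable_normal_pdf.
apply: ae_eq_integral => //.
- apply: emeasurable_funM => //.
  exact: measurable_int (Radon_Nikodym_SigmaFinite.f_integrable numu).
- exact: emeasurable_funM.
- apply: ae_eqe_mul2l; apply: integral_ae_eq => //.
    exact: Radon_Nikodym_SigmaFinite.f_integrable.
  by move=> E _ mE; rewrite -Radon_Nikodym_SigmaFinite.f_integral.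
Qed.

Lemma is_derive_pow (n : nat) (x : R) :
  is_derive x 1 (fun y : R => y ^+ n) (n%:R * x ^+ n.-1).
Proof.
apply: DeriveDef; first exact: exprn_derivable.
by rewrite exp_derive /GRing.scale/= mulr1.
Qed.

Section moments.
Variables (s : R) (k : nat).
Hypothesis s0 : 0 < s.
Let ph := normal_pdf 0 s.

Let phE x : ph x = normal_peak s * expR (- (x ^+ 2 / (s ^+ 2 *+ 2))).
Proof. by rewrite /ph normal_pdfE ?gt_eqF// /normal_fun subr0 mulNr. Qed.

Let is_derive_ph (x : R) : is_derive x 1 ph (- (x / s ^+ 2) * ph x).
Proof.
pose c := - (s ^+ 2 *+ 2)^-1.
have dg : is_derive x 1 (c *: (fun y : R => y ^+ 2)) (c *: (2%:R * x ^+ 1)).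
  exact/is_deriveZ/is_derive_pow.
have -> : ph = normal_peak s *: (expR \o (c *: (fun y : R => y ^+ 2))).
  apply/funext => y; rewrite phE; congr (_ * expR _).
  by rewrite -[RHS]/(c * y ^+ 2) /c mulNr mulrC.
apply: is_derive_eq; rewrite /GRing.scale/= /c.
rewrite -mulr_natr; set E := expR _; rewrite -[_ *: E]/(_ * E); field.
by rewrite gt_eqF.
Qed.

Let F (x : R) := - s ^+ 2 *: (x ^+ k.*2.+1 * ph x).
Let g (j : nat) (x : R) := x ^+ j.*2 * ph x.
Let f (x : R) := g k.+1 x - k.*2.+1%:R * s ^+ 2 * g k x.

Let is_derive_F (x : R) : is_derive x 1 F (f x).
Proof.
have := is_derive_ph x.
move=> dp.
have dX := is_derive_pow k.*2.+1 x.
have -> : F = - s ^+ 2 *: ((fun y : R => y ^+ k.*2.+1) * ph) by [].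
apply: is_derive_eq; rewrite /GRing.scale/= /f /g doubleS !exprS.
field.
by rewrite gt_eqF.
Qed.


Let continuous_g j : continuous (g j).
Proof.
move=> x; apply: cvgM; first exact: exprn_continuous.
by apply: continuous_normal_pdf; rewrite gt_eqF.
Qed.

Let continuous_f : continuous f.
Proof.
move=> x; apply: cvgB; first exact: continuous_g.
by apply: cvgMl_tmp; exact: continuous_g.
Qed.

Let g_ge0 j x : 0 <= g j x.
Proof. by rewrite mulr_ge0 ?normal_pdf_ge0// exprn_even_ge0// odd_double. Qed.

Let g_integrable j (a : R) : mu.-integrable `[0, a] (EFin \o g j).
Proof.
apply: continuous_compact_integrable; first exact: segment_compact.
exact/continuous_subspaceT/continuous_g.
Qed.

(** With y = n^2 / (2 s^2), the exponential series gives y^(k+1) e^(-y) <= (k+1)!, so the sequence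
    is at most C / n. *)
Let ph_decay : (n%:R ^+ k.*2.+1 * ph n%:R) @[n --> \oo] --> (0 : R).
Proof.
pose C := normal_peak s * (k.+1`!%:R * (s ^+ 2 *+ 2) ^+ k.+1).
have Cn : C * (n%:R^-1 : R) @[n --> \oo] --> (0 : R).
  rewrite -[X in _ --> X](mulr0 C); apply: cvgMl_tmp.
  by rewrite -cvg_shiftS; exact: cvg_harmonic.
apply: (squeeze_cvgr _ (cvg_cst 0) Cn).
near=> n.
have n0 : (0 : R) < n%:R by rewrite ltr0n; near: n; exists 1%N.
rewrite mulr_ge0 ?normal_pdf_ge0 ?exprn_ge0//=.
set y : R := n%:R ^+ 2 / (s ^+ 2 *+ 2).
have y0 : 0 <= y by rewrite divr_ge0// ?mulrn_wge0 ?sqr_ge0.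
have s20 : s ^+ 2 *+ 2 != 0 by rewrite mulrn_eq0/= sqrf_eq0 gt_eqF.
have ye : y ^+ k.+1 * expR (- y) <= k.+1`!%:R.
  have /(le_trans _) := expR_ge1Dxn k y0.
  move=> /(_ (y ^+ k.+1 / k.+1`!%:R)); rewrite lerDr ler01 => /(_ isT) h.
  rewrite -(@ler_pM2r _ (expR y)) ?expR_gt0// -mulrA expRN mulVf ?mulr1 ?gt_eqF ?expR_gt0//.
  by rewrite -ler_pdivrMl ?ltr0n ?fact_gt0// mulrC.
rewrite phE -/y -ler_pdivrMr ?invr_gt0// invrK.
have -> : n%:R ^+ k.*2.+1 * (normal_peak s * expR (- y)) * n%:R =
    normal_peak s * ((s ^+ 2 *+ 2) ^+ k.+1 * (y ^+ k.+1 * expR (- y))).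
  rewrite mulrCA -mulrA; congr (_ * _); rewrite mulrA -exprMn.
  have -> : (s ^+ 2 *+ 2) * y = n%:R ^+ 2 by rewrite /y mulrC divfK.
  rewrite -exprM.
  by rewrite mulrAC -exprSr -doubleS -mul2n.
rewrite ler_wpM2l ?normal_peak_ge0// mulrC ler_wpM2r//.
by rewrite exprn_ge0// mulrn_wge0// sqr_ge0.
Unshelve. all: by end_near. Qed.

Let parts n : (0 < n)%N ->
  (\int[mu]_(x in `[0%R, n%:R]) (g k.+1 x)%:E =
   (k.*2.+1%:R * s ^+ 2)%:E * \int[mu]_(x in `[0%R, n%:R]) (g k x)%:E +
   (- s ^+ 2 * (n%:R ^+ k.*2.+1 * ph n%:R))%:E)%E.
Proof.
move=> n0.
have n0' : (0 : R) < n%:R by rewrite ltr0n.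
have dF x : derivable F x 1 by have [] := is_derive_F x.
have cF : continuous F.
  by move=> x; apply: differentiable_continuous; exact/derivable1_diffP.
have := @continuous_FTC2 R f F 0 n%:R n0'.
have -> : F 0 = 0 by rewrite /F expr0n mul0r scaler0.
rewrite oppe0 adde0 => /(_ _ _ _)/wrap[].
- exact/continuous_subspaceT/continuous_f.
- split; first by move=> x _; exact: dF.
  + exact/cvg_at_right_filter/cF.
  + exact/cvg_at_left_filter/cF.
- by move=> x _; rewrite derive1E; have [_] := is_derive_F x.
move=> E.
have -> : (- s ^+ 2 * (n%:R ^+ k.*2.+1 * ph n%:R) = F n%:R)%R by [].
rewrite -E -integralZl//; last exact: g_integrable.
rewrite -integralD//; last 2 first.
- exact: (integrableZl _ _ (g_integrable k n%:R)).
- apply: continuous_compact_integrable; first exact: segment_compact.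
  exact/continuous_subspaceT/continuous_f.
by apply: eq_integral => x _; rewrite -EFinM -EFinD; congr EFin; rewrite /f addrC subrK.
Qed.

(** Integration by parts: [f] is the derivative of F x = - s^2 x^(2k+1) ph x. The boundary term on
    [0, n] vanishes in the limit, and evenness reduces the line to the half-line. Both sides are
    extended reals, so finiteness of the moments is an outcome and not a premise. *)
Lemma normal_moment_rec :
  (\int[normal_prob 0 s]_x (x ^+ k.+1.*2)%:E =
   (k.*2.+1%:R * s ^+ 2)%:E * \int[normal_prob 0 s]_x (x ^+ k.*2)%:E)%E.
Proof.
have red j : (\int[normal_prob 0 s]_x (x ^+ j.*2)%:E =
    2%:E * \int[mu]_(x in `[0%R, +oo[) (g j x)%:E)%E.
  rewrite ge0_integral_normal_prob; last 2 first.
  - by move=> x; rewrite lee_fin exprn_even_ge0// odd_double.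
  - by apply/measurable_EFinP; exact: exprn_measurable.
  rewrite set_itvcy -ge0_symfun_integralT//.
  move=> x; rewrite /g/= /ph !normal_pdfE ?gt_eqF// /normal_fun !subr0 sqrrN.
  by rewrite -!mul2n !exprM sqrrN.
rewrite !red muleCA; congr (_ * _)%E.
have mg j : measurable_fun setT (g j) by exact: continuous_measurable_fun.
have c1 := @ge0_cvgn_integral R mu _ (g_ge0 k.+1) (mg k.+1).
have c0 := @ge0_cvgn_integral R mu _ (g_ge0 k) (mg k).
apply: (cvg_unique _ c1) => //.
have c2 : ((k.*2.+1%:R * s ^+ 2)%:E * \int[mu]_(x in `[0%R, n%:R]) (g k x)%:E +
   (- s ^+ 2 * (n%:R ^+ k.*2.+1 * ph n%:R))%:E)%E @[n --> \oo] -->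
   ((k.*2.+1%:R * s ^+ 2)%:E * (\int[mu]_(x in `[0%R, +oo[) (g k x)%:E))%E.
  rewrite -[X in _ --> X]adde0; apply: cvgeD.
  - by rewrite fin_num_adde_defl.
  - exact: cvgeZl.
  - apply: cvg_EFin; first by near=> n.
    by rewrite -[X in _ --> X](mulr0 (- s ^+ 2)); apply: cvgMl_tmp; exact: ph_decay.
apply: cvg_trans c2; apply: near_eq_cvg; near=> n; rewrite -parts//.
by near: n; exists 1%N.
Unshelve. all: by end_near. Qed.

End moments.

Let mulc_measurable (c : R) : measurable_fun (setT : set (measurableTypeR R))
  ((fun x : R => c * x) : measurableTypeR R -> measurableTypeR R).
Proof. exact: (@measurable_funM _ (measurableTypeR R) R setT (cst c) id). Qed.

Let pmu (c : R) :=
  measure_function_pushforward__canonical__measure_function_Measure mu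
    (mulc_measurable c).

(** It suffices to compare the two measures on intervals []a, b]]; for negative [c] the preimage is
    closed on the other side, [[b / c, a / c[]. *)
Lemma lebesgue_measure_mulc (c : R) (A : set R) : c != 0 -> measurable A ->
  mu ((fun x => c * x) @^-1` A) = (`|c|^-1%:E * mu A)%E.
Proof.
move=> c0 mA.
have c0' : 0 <= `|c| by [].
suff -> : mu A = mscale (NngNum c0') (pmu c) A.
  rewrite /mscale/= muleA -EFinM mulVf ?mul1e//.
  by rewrite normr_eq0.
have mp (B : set R) : measurable B -> measurable ((fun x => c * x) @^-1` B).
  by move=> mB; rewrite -[X in measurable X]setTI; exact: mulc_measurable.
refine (@lebesgue_measure_unique R (mscale (NngNum c0') (pmu c)) _ A mA) => X [[a b] _ <-].
rewrite /= /mscale/= /pushforward/=.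
have cl (x : R) : (c * x - a) = c * (x - a / c) by rewrite mulrBr mulrCA divff ?mulr1.
have cr (x : R) : (b - c * x) = c * (b / c - x) by rewrite mulrBr mulrCA divff ?mulr1.
have [cgt|clt] := ltP 0 c.
  have -> : *%R c @^-1` `]a, b]%classic = `]a / c, b / c]%classic.
    apply/seteqP; split=> x /=; rewrite !in_itv/= -(subr_gt0 a) cl -(subr_ge0 _ b) cr;
      by rewrite pmulr_rgt0// pmulr_rge0// subr_gt0 subr_ge0.
  rewrite !lebesgue_measure_itv/= !lte_fin ltr_pM2r ?invr_gt0//.
  case: ifP => _; last by rewrite mule0.
  by rewrite -!EFinB -EFinM gtr0_norm// -mulrBl mulrCA divff ?mulr1.
have {clt}clt : c < 0 by rewrite lt_neqAle c0.
have -> : *%R c @^-1` `]a, b]%classic = `[b / c, a / c[%classic.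
  apply/seteqP; split=> x /=; rewrite !in_itv/= -(subr_gt0 a) cl -(subr_ge0 _ b) cr;
    rewrite nmulr_rgt0// nmulr_rge0// subr_lt0 subr_le0;
    by move=> /andP[-> ->].
rewrite !lebesgue_measure_itv/= !lte_fin ltr_nM2r ?invr_lt0//.
case: ifP => _; last by rewrite mule0.
rewrite -!EFinB -EFinM ltr0_norm// -mulrBl mulNr mulrCA divff// mulr1.
by rewrite opprB.
Qed.

Lemma normal_prob_mulc (s c : R) (U : set R) : 0 < s -> c != 0 -> measurable U ->
  normal_prob 0 s ((fun x => c * x) @^-1` U) = normal_prob 0 (`|c| * s) U.
Proof.
move=> s0 c0 mU; rewrite /normal_prob.
have c0' : 0 <= `|c|^-1 by rewrite invr_ge0.
have nc0 : 0 < `|c| by rewrite normr_gt0.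
have mp : measurable_fun setT (EFin \o normal_pdf 0 (`|c| * s)).
  by apply/measurable_EFinP; exact: measurable_normal_pdf.
transitivity (\int[mscale (NngNum c0') mu]_(x in U) (`|c|%:E *
    (normal_pdf 0 (`|c| * s) x)%:E))%E; last first.
  rewrite ge0_integral_mscale//; last 2 first.
  - by apply: emeasurable_funM => //; exact: measurable_funTS.
  - by move=> x _; rewrite mule_ge0// lee_fin normal_pdf_ge0.
  rewrite ge0_integralZl//=; last 2 first.
  - exact: measurable_funTS.
  - by move=> x _; rewrite lee_fin normal_pdf_ge0.
  by rewrite muleA -EFinM mulVf ?mul1e// gt_eqF.
transitivity (\int[pmu c]_(x in U) (`|c|%:E *
    (normal_pdf 0 (`|c| * s) x)%:E))%E; last first.
  apply: eq_measure_integral => A mA _.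
  have H := lebesgue_measure_mulc c0 mA; first [exact: H | exact: (esym H)].
rewrite ge0_integral_pushforward//=; last 2 first.
- by apply: emeasurable_funM => //; exact: measurable_funTS.
- by move=> x _; rewrite mule_ge0// lee_fin normal_pdf_ge0.
apply: eq_integral => x _; rewrite -EFinM; congr EFin.
rewrite !normal_pdfE ?gt_eqF ?mulr_gt0// /normal_peak /normal_fun !subr0.
rewrite mulrA; congr (_ * expR _); last first.
  rewrite !exprMn real_normK ?num_real//; field.
  by rewrite c0 gt_eqF.
have -> : (`|c| * s) ^+ 2 * pi *+ 2 = c ^+ 2 * (s ^+ 2 * pi *+ 2).
  by rewrite exprMn real_normK ?num_real//; ring.
rewrite sqrtrM ?sqr_ge0// sqrtr_sqr.
by rewrite invfM mulrA divff ?mul1r// gt_eqF.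
Qed.

End normal_law.

Section mean.
Context d (Omega : measurableType d) (R : realType) (P : probability Omega R).
Implicit Types X Y : Omega -> R.

(** Integrability is bundled with the value, since the real integral of a non-integrable function is
    still a number; the calculus below propagates both at once. *)
Definition mean_is X (m : R) :=
  P.-integrable setT (EFin \o X) /\ \int[P]_w X w = m.

Lemma mean_isP X : P.-integrable setT (EFin \o X) ->
  mean_is X (\int[P]_w X w).
Proof. by []. Qed.

Lemma mean_is_measurable X m : mean_is X m -> measurable_fun setT X.
Proof. by move=> [/measurable_int/measurable_EFinP]. Qed.

Lemma mean_is_ext X Y m : X =1 Y -> mean_is X m -> mean_is Y m.
Proof. by move=> /funext ->. Qed.

Lemma mean_is_cst c : mean_is (fun=> c) c.
Proof.
split; first exact: finite_measure_integrable_cst.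
by rewrite /Rintegral integral_cst// [X in (_ * X)%E]probability_setT mule1.
Qed.

Lemma mean_isD X Y a b : mean_is X a -> mean_is Y b ->
  mean_is (fun w => X w + Y w) (a + b).
Proof.
move=> [iX <-] [iY <-]; split; last by rewrite RintegralD.
exact: (integrableD _ iX iY).
Qed.

Lemma mean_isZ c X a : mean_is X a -> mean_is (fun w => c * X w) (c * a).
Proof.
move=> [iX <-]; split; last by rewrite RintegralZl.
exact: (integrableZl _ _ iX).
Qed.

Lemma mean_isN X a : mean_is X a -> mean_is (fun w => - X w) (- a).
Proof.
move=> /(mean_isZ (-1)); rewrite mulN1r; apply: mean_is_ext => w.
by rewrite mulN1r.
Qed.

Lemma mean_isB X Y a b : mean_is X a -> mean_is Y b ->
  mean_is (fun w => X w - Y w) (a - b).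
Proof. by move=> hX /mean_isN; exact: mean_isD. Qed.

Lemma mean_is_sum (I : Type) (s : seq I) (X : I -> Omega -> R) (a : I -> R) :
  (forall i, mean_is (X i) (a i)) ->
  mean_is (fun w => \sum_(i <- s) X i w) (\sum_(i <- s) a i).
Proof.
move=> h; elim: s => [|i s ih].
  rewrite big_nil; apply: mean_is_ext (mean_is_cst 0) => w.
  by rewrite big_nil.
rewrite big_cons; apply: mean_is_ext (mean_isD (h i) ih) => w.
by rewrite big_cons.
Qed.

Lemma mean_is_le X Y a b : (forall w, X w <= Y w) ->
  mean_is X a -> mean_is Y b -> a <= b.
Proof. by move=> XY [iX <-] [iY <-]; apply: le_Rintegral. Qed.

Lemma mean_is_norm_le X Y a b : (forall w, `|X w| <= Y w) ->
  mean_is X a -> mean_is Y b -> `|a| <= b.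
Proof.
move=> XY hX hY; rewrite ler_norml; apply/andP; split.
- by apply: mean_is_le (mean_isN hY) hX => w; have := XY w; rewrite ler_norml => /andP[].
- by apply: mean_is_le hX hY => w; have := XY w; rewrite ler_norml => /andP[].
Qed.

Lemma integrable_dominated X Y : measurable_fun setT X ->
  (forall w, `|X w| <= Y w) -> P.-integrable setT (EFin \o Y) ->
  P.-integrable setT (EFin \o X).
Proof.
move=> mX XY; apply: le_integrable => //; first exact/measurable_EFinP.
move=> w _ /=; rewrite lee_fin (le_trans (XY w))// ler_norm//.
Qed.

Lemma integrable_bounded X M : measurable_fun setT X ->
  (forall w, `|X w| <= M) -> P.-integrable setT (EFin \o X).
Proof.
move=> mX XM; apply: (integrable_dominated mX XM).
exact: finite_measure_integrable_cst.
Qed.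

Lemma mean_is_indep2 X Y a b : indep2 P X Y ->
  mean_is X a -> mean_is Y b -> mean_is (fun w => X w * Y w) (a * b).
Proof.
move=> XY hX hY.
have [i e] := indep2_integral (mean_is_measurable hX) (mean_is_measurable hY)
  XY hX.1 hY.1.
by split => //; rewrite e hX.2 hY.2.
Qed.

Lemma mean_is_fine X m : (forall w, 0 <= X w) -> measurable_fun setT X ->
  (\int[P]_w (X w)%:E = m%:E)%E -> mean_is X m.
Proof.
move=> X0 mX e; split; last by rewrite /Rintegral e.
apply/integrableP; split; first exact/measurable_EFinP.
under eq_integral do rewrite /= ger0_norm//.
by rewrite e ltry.
Qed.

End mean.

Section normal_rv.
Context d (Omega : measurableType d) (R : realType) (P : probability Omega R).
Implicit Types (X Y : Omega -> R) (v : R).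

(** Parametrised by the variance, with the point mass for v = 0, so that all linear combinations of
    Gaussian variables are covered. *)
Definition normal_rv X (v : R) := measurable_fun setT X /\
  forall U, measurable U -> P (X @^-1` U) = normal1 0 v U.

Lemma normal_rv0 : normal_rv (fun=> 0) 0.
Proof.
split=> // U mU; rewrite /normal1 eqxx diracE.
have [U0|U0] := boolP (0 \in U).
- rewrite (_ : _ @^-1` _ = setT) ?probability_setT//.
  by apply/seteqP; split => // w _; exact: set_mem.
- rewrite (_ : _ @^-1` _ = set0) ?measure0//.
  by apply/seteqP; split => // w /= /mem_set; rewrite (negbTE U0).
Qed.

Lemma normal_rv_scale c X v : 0 <= v -> normal_rv X v ->
  normal_rv (fun w => c * X w) (c ^+ 2 * v).
Proof.
move=> v0 [mX hX].
have mc : measurable_fun setT (fun x : R => c * x) by exact: measurable_funM.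
have [->|c0] := eqVneq c 0.
  rewrite expr0n mul0r (_ : (fun _ => _) = fun=> 0); first exact: normal_rv0.
  by apply/funext => w; rewrite mul0r.
split=> [|U mU]; first exact: measurable_funM.
have mcU : measurable ((fun x : R => c * x) @^-1` U).
  by rewrite -[X in measurable X]setTI; exact: mc.
transitivity (normal1 0 v ((fun x : R => c * x) @^-1` U)); first exact: hX.
rewrite /normal1.
rewrite mulf_eq0 sqrf_eq0 (negbTE c0)/=.
have [v00|vN0] := eqVneq v 0.
  rewrite !diracE.
  have -> : (0 \in (fun x : R => c * x) @^-1` U) = (0 \in U) => //.
  by apply/idP/idP => /set_mem h; apply/mem_set; move: h; rewrite /= mulr0.
have sv0 : 0 < Num.sqrt v by rewrite sqrtr_gt0 lt_neqAle eq_sym vN0.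
rewrite (normal_prob_mulc sv0 c0 mU); congr (normal_prob 0 _ U).
by rewrite (sqrtrM _ (sqr_ge0 c)) sqrtr_sqr.
Qed.

Lemma ge0_integral_normal_rv X v (f : R -> R) : 0 <= v -> normal_rv X v ->
  (forall x, 0 <= f x) -> measurable_fun setT f ->
  (\int[P]_w (f (X w))%:E = if (v == 0)%R then (f 0)%:E else
   \int[normal_prob 0 (Num.sqrt v)]_x (f x)%:E)%E.
Proof.
move=> v0 [mX hX] f0 mf.
have mEf : measurable_fun setT (EFin \o f) by exact/measurable_EFinP.
have mX' : measurable_fun setT (X : Omega -> measurableTypeR R) by exact: mX.
rewrite -[LHS](@ge0_integral_distribution _ _ _ (measurableTypeR R) _ P (to_mfun mX') (EFin \o f))//.
case: ifPn => vE.
  rewrite (eq_measure_integral (\d_(0 : measurableTypeR R))) => [|A mA _].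
    by rewrite integral_dirac//= diracT mul1e.
  by have := hX A mA; rewrite /normal1 vE.
rewrite (eq_measure_integral (normal_prob 0 (Num.sqrt v)))// => A mA _.
by have := hX A mA; rewrite /normal1 (negbTE vE).
Qed.

Lemma normal_rv_moment_rec X v k : 0 <= v -> normal_rv X v ->
  (\int[P]_w (X w ^+ k.+1.*2)%:E =
   (k.*2.+1%:R * v)%:E * \int[P]_w (X w ^+ k.*2)%:E)%E.
Proof.
move=> v0 hX.
have E j : (\int[P]_w (X w ^+ j.*2)%:E = if (v == 0)%R then (0 ^+ j.*2)%:E else
   \int[normal_prob 0 (Num.sqrt v)]_x (x ^+ j.*2)%:E)%E.
  apply: (@ge0_integral_normal_rv X v (fun x => x ^+ j.*2)) => //.
  by move=> x; rewrite exprn_even_ge0// odd_double.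
rewrite !E; case: ifPn => vE; first by rewrite (eqP vE) mulr0 mul0e expr0n.
rewrite normal_moment_rec ?sqr_sqrtr//.
by rewrite sqrtr_gt0 lt_neqAle v0 andbT eq_sym.
Qed.

(** The constants are 3 = 1 x 3 and 105 = 1 x 3 x 5 x 7. The eighth moment controls the fourth
    moment of a product of two Gaussian variables. *)
Lemma normal_rv_moments X v : 0 <= v -> normal_rv X v ->
  [/\ mean_is P (fun w => X w ^+ 2) v,
      mean_is P (fun w => X w ^+ 4) (3 * v ^+ 2) &
      mean_is P (fun w => X w ^+ 8) (105 * v ^+ 4)].
Proof.
move=> v0 hX; have mX := hX.1.
have mXn n : measurable_fun setT (fun w => X w ^+ n) by exact: measurable_funX.
have M0 : (\int[P]_w (X w ^+ 0.*2)%:E = 1%:E)%E.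
  under eq_integral do rewrite expr0.
  by rewrite integral_cst// mul1e; exact: probability_setT.
have M2 : (\int[P]_w (X w ^+ 1.*2)%:E = v%:E)%E.
  by rewrite (normal_rv_moment_rec _ v0 hX) M0 -EFinM -[_.*2.+1]/1%N; congr EFin; ring.
have M4 : (\int[P]_w (X w ^+ 2.*2)%:E = (3 * v ^+ 2)%:E)%E.
  by rewrite (normal_rv_moment_rec _ v0 hX) M2 -EFinM -[_.*2.+1]/3%N; congr EFin; ring.
have M6 : (\int[P]_w (X w ^+ 3.*2)%:E = (15 * v ^+ 3)%:E)%E.
  by rewrite (normal_rv_moment_rec _ v0 hX) M4 -EFinM -[_.*2.+1]/5%N; congr EFin; ring.
have M8 : (\int[P]_w (X w ^+ 4.*2)%:E = (105 * v ^+ 4)%:E)%E.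
  by rewrite (normal_rv_moment_rec _ v0 hX) M6 -EFinM -[_.*2.+1]/7%N; congr EFin; ring.
by split; apply: mean_is_fine => // w; rewrite exprn_even_ge0.
Qed.

(** Integrability comes from |x| <= 1 + x^2; the mean vanishes because - X has the same law as X. *)
Lemma normal_rv_mean X v : 0 <= v -> normal_rv X v -> mean_is P X 0.
Proof.
move=> v0 hX; have [mX hX'] := hX.
have [[i2 _] _ _] := normal_rv_moments v0 hX.
have iX : P.-integrable setT (EFin \o X).
  apply: (@integrable_dominated _ _ _ P _ (fun w => 1 + X w ^+ 2)) => //.
    by move=> w; rewrite ler_norml; apply/andP; split; nra.
  by have [] := mean_isD (mean_is_cst P 1) (mean_isP i2).
split => //.
have hN : normal_rv (fun w => - X w) v.
  have := normal_rv_scale (-1) v0 hX.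
  rewrite sqrrN expr1n mul1r; set f := (X in normal_rv X _ -> _).
  by rewrite (_ : f = fun w => - X w)//; apply/funext => w; rewrite /f mulN1r.
have mN := hN.1.
have [iN eN] := mean_isN (mean_isP iX).
have E : (\int[P]_w (X w)%:E = \int[P]_w (- X w)%:E)%E.
  rewrite -[LHS](@integral_distribution _ _ _ _ _ P (to_mfun mX) EFin)//.
  rewrite -[RHS](@integral_distribution _ _ _ _ _ P (to_mfun mN) EFin)//.
  by apply: eq_measure_integral => A mA _; exact: etrans (hX' A mA) (esym (hN.2 A mA)).
have : \int[P]_w X w = - \int[P]_w X w by rewrite -eN /Rintegral E.
by lra.
Qed.

End normal_rv.

(** * Wiener increments and sums of independent normal variables *)

Definition sigma_of_gen (Omega : Type) (R : realType) (I : Type) (D : set I)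
    (X : I -> Omega -> R) : set (set Omega) :=
  [set A | exists2 i, D i & exists2 U : set R, measurable U & A = X i @^-1` U].

Section wiener_increments.
Context d (Omega : measurableType d) (R : realType) (P : probability Omega R).
Context (T : R) (B : R -> Omega -> R).
Hypothesis hB : wiener1 P T B.

Lemma sigma_of_measurable_fun (I : Type) (D : set I) (X : I -> Omega -> R) i :
  D i -> measurable_fun
    (setT : set (g_sigma_algebraType (sigma_of_gen D X))) (X i).
Proof.
move=> Di _ U mU; rewrite setTI; apply: sub_sigma_algebra.
by exists i => //; exists U.
Qed.

Lemma wiener1_increment_normal s t : 0 <= s -> s < t -> t <= T ->
  normal_rv P (fun w => B t w - B s w) (t - s).
Proof.
move=> s0 st tT; have [mB _ _ /(_ s t s0 st tT)[hN _]] := hB.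
split=> [|U mU].
  by apply: measurable_funB; apply: mB; lra.
by rewrite /normal1 subr_eq0 gt_eqF// -hN.
Qed.

Lemma wiener1_increment_indep s t (X : Omega -> R) : 0 <= s -> s < t -> t <= T ->
  measurable_fun
    (setT : set (g_sigma_algebraType (sigma_of_gen `[0, s] B))) X ->
  indep2 P (fun w => B t w - B s w) X.
Proof.
move=> s0 st tT mX U V mU mV; have [_ _ _ /(_ s t s0 st tT)[_ ->]//] := hB.
by have := mX measurableT V mV; rewrite setTI.
Qed.

Hypothesis T0 : 0 < T.

Lemma indep2_cstl (c : R) (X : Omega -> R) : indep2 P (fun=> c) X.
Proof.
move=> U V mU mV; have [Uc|Uc] := pselect (U c).
- have -> : (fun=> c) @^-1` U = [set: Omega] by apply/seteqP; split.
  by rewrite setTI probability_setT mul1e.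
- have -> : (fun=> c) @^-1` U = set0 :> set Omega by apply/seteqP; split.
  by rewrite set0I measure0 mul0e.
Qed.

End wiener_increments.

(* A Wiener process provides, for small variances u and v, independent centred
   normal variables whose sum is again normal; the law of a sum of independent
   variables depends only on the two marginal laws. *)
Section normal_rv_add.
Context d0 (Omega0 : measurableType d0) (R : realType)
  (P0 : probability Omega0 R) (T : R) (B : R -> Omega0 -> R).
Hypotheses (T0 : 0 < T) (hB : wiener1 P0 T B).
Context d (Omega : measurableType d) (P : probability Omega R).
Implicit Types (X Y : Omega -> R) (u v : R).

Let normal_rv_add_small X Y u v : 0 < u -> 0 < v -> u + v <= T ->
  indep2 P X Y -> normal_rv P X u -> normal_rv P Y v ->
  normal_rv P (fun w => X w + Y w) (u + v).
Proof.
move=> u0 v0 uvT XY [mX hX] [mY hY].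
have uT : u <= T by lra.
have mB t : 0 <= t <= T -> measurable_fun setT (B t) by have [+ _ _ _] := hB; exact.
pose X0 w := B u w - B 0 w; pose Y0 w := B (u + v) w - B u w.
have [mX0 hX0] := wiener1_increment_normal hB (lexx 0) u0 uT.
have uuv : u < u + v by lra.
have [mY0 hY0] := wiener1_increment_normal hB (ltW u0) uuv uvT.
have XY0 : indep2 P0 X0 Y0.
  move=> U V mU mV; rewrite setIC muleC.
  apply: (wiener1_increment_indep hB (ltW u0) uuv uvT) => //.
  apply: measurable_funB.
  - by apply: (@sigma_of_measurable_fun _ _ _ _ `[0, u] B u); rewrite /= in_itv/= lexx ltW.
  - by apply: (@sigma_of_measurable_fun _ _ _ _ `[0, u] B 0); rewrite /= in_itv/= lexx ltW.
split=> [|U mU]; first exact: measurable_funD.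
rewrite (@indep2_add_law _ _ _ _ _ P P0 X Y X0 Y0)//; last 2 first.
- by move=> V mV; rewrite (hX V mV) (hX0 V mV) subr0.
- move=> V mV; rewrite (hY V mV) (hY0 V mV).
  by rewrite (_ : u + v - u = v)// addrAC subrr add0r.
have u_uv : 0 < u + v by lra.
have [_ /(_ U mU)] := wiener1_increment_normal hB (lexx 0) u_uv uvT.
rewrite subr0 => <-; congr (P0 (_ @^-1` U)).
by apply/funext => w; rewrite /= /X0 /Y0; ring.
Qed.

Lemma normal_rv_add X Y u v : 0 <= u -> 0 <= v ->
  indep2 P X Y -> normal_rv P X u -> normal_rv P Y v ->
  normal_rv P (fun w => X w + Y w) (u + v).
Proof.
move=> u0 v0 XY hX hY; have [mX hX'] := hX; have [mY hY'] := hY.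
have YX : indep2 P Y X by move=> U V mU mV; rewrite setIC muleC XY.
(* A variable of variance zero is known only through its law, so the sum is compared in law with 0 +
   Z'. *)
have zero Z Z' z : indep2 P Z Z' -> normal_rv P Z 0 -> normal_rv P Z' z ->
    normal_rv P (fun w => Z w + Z' w) z.
  move=> ZZ' [mZ hZ] [mZ' hZ']; split=> [|U mU]; first exact: measurable_funD.
  have [m0 h0] := normal_rv0 P.
  rewrite (@indep2_add_law _ _ _ _ _ P P Z Z' (fun=> 0) Z')//.
  - rewrite -(hZ' U mU); congr (P (_ @^-1` U)).
    by apply/funext => w /=; rewrite add0r.
  - exact: indep2_cstl.
  - by move=> V mV; rewrite (hZ V mV) (h0 V mV).
have [uE|uN0] := eqVneq u 0.
  by rewrite uE in hX *; rewrite add0r; exact: zero XY hX hY.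
have [vE|vN0] := eqVneq v 0.
  rewrite vE addr0 (_ : (fun w => _) = fun w => Y w + X w).
    by rewrite vE in hY; exact: zero YX hY hX.
  by apply/funext => w; rewrite addrC.
have {}u0 : 0 < u by rewrite lt_neqAle eq_sym uN0.
have {}v0 : 0 < v by rewrite lt_neqAle eq_sym vN0.
have uv0 : 0 < u + v by rewrite addr_gt0.
(* Scaling by [c] brings the total variance to exactly [T], where increments on [[0, T]] are
   available; the sum is scaled back afterwards. *)
pose c := Num.sqrt (T / (u + v)).
have c0 : 0 < c by rewrite sqrtr_gt0 divr_gt0.
have c2 : c ^+ 2 = T / (u + v) by rewrite sqr_sqrtr// ltW// divr_gt0.
have c20 : 0 < c ^+ 2 by rewrite exprn_gt0.
have e : c ^+ 2 * u + c ^+ 2 * v = T by rewrite -mulrDr c2 divfK ?gt_eqF.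
have := @normal_rv_add_small (fun w => c * X w) (fun w => c * Y w)
  (c ^+ 2 * u) (c ^+ 2 * v) (mulr_gt0 c20 u0) (mulr_gt0 c20 v0).
rewrite e => /(_ (lexx _)) H.
have {H} : normal_rv P (fun w => c * X w + c * Y w) T.
  apply: H.
  - by apply: (@indep2_comp _ _ _ P X Y (fun x => c * x) (fun x => c * x)) => //;
      exact: measurable_funM.
  - exact: normal_rv_scale (ltW u0) hX.
  - exact: normal_rv_scale (ltW v0) hY.
have e2 : c^-1 ^+ 2 * T = u + v.
  by rewrite exprVn c2 invf_div -mulrA mulVf ?mulr1// gt_eqF.
move=> /(normal_rv_scale c^-1 (ltW T0)); rewrite e2.
congr normal_rv; apply/funext => w.
by rewrite -mulrDr mulKf// gt_eqF.
Qed.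

Lemma indep_family_lincomb_normal (I : finType) (xi : I -> Omega -> R) (a : I -> R) :
  (forall i, normal_rv P (xi i) 1) -> indep_family P xi ->
  normal_rv P (fun w => \sum_i a i * xi i w) (\sum_i a i ^+ 2).
Proof.
move=> hxi ind; elim: (index_enum I) (index_enum_uniq I)
  => [_|i s ih /= /andP[nis us]].
  rewrite big_nil (_ : (fun w => _) = fun=> 0); first exact: normal_rv0.
  by apply/funext => w; rewrite big_nil.
rewrite big_cons (_ : (fun w => _) =
    fun w => a i * xi i w + \sum_(j <- s) a j * xi j w); last first.
  by apply/funext => w; rewrite big_cons.
apply: normal_rv_add => //.
- by rewrite sqr_ge0.
- by apply: sumr_ge0 => j _; rewrite sqr_ge0.
- apply: (@indep_family_indep2 _ _ _ _ _ xi _ ind (pred1 i) (mem s)).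
  + by move=> j; exact: (hxi j).1.
  + by move=> j /eqP ->.
  + apply: measurable_funM => //.
    by apply: rectangles_measurable_fun => /=.
  + rewrite (_ : (fun w => _) =
        fun w => \sum_(j <- s) if j \in s then a j * xi j w else 0); last first.
      by apply/funext => w; rewrite -big_mkcond -big_seq.
    apply: measurable_sum => j.
    case: (boolP (j \in s)) => js; last exact: measurable_cst.
    by apply: measurable_funM => //; exact: rectangles_measurable_fun.
- by rewrite -[X in normal_rv _ _ X]mulr1; exact: normal_rv_scale.
- exact: ih.
Qed.

End normal_rv_add.

(** * A central limit theorem for array sums *)

Section array_clt.
Context d (Omega : measurableType d) (R : realType) (P : probability Omega R).
Variables (n : nat) (U : nat -> Omega -> R) (v C : R).
Hypotheses (n0 : (0 < n)%N) (v0 : 0 <= v) (C0 : 0 <= C).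
Hypothesis U1 : forall i, (i < n)%N -> mean_is P (U i) 0.
Hypothesis U2 : forall i, (i < n)%N -> mean_is P (fun w => U i w ^+ 2) v.
Hypothesis U4 : forall i, (i < n)%N ->
  exists2 m, m <= C & mean_is P (fun w => U i w ^+ 4) m.
Hypothesis Uind : forall i, (i < n)%N ->
  indep2 P (fun w => \sum_(j < i) U j w) (U i).

Let rt := (Num.sqrt (n%:R : R))^-1.
Let K := 2 * C + v + v ^+ 2.
Let rho := expR (- (v * rt ^+ 2 / 2)).

Let rt_gt0 : 0 < rt.
Proof. by rewrite invr_gt0 sqrtr_gt0 ltr0n. Qed.

Let rt_le1 : rt <= 1.
Proof.
rewrite invf_le1 ?sqrtr_gt0 ?ltr0n// -[leLHS]sqrtr1 ler_wsqrtr//.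
by rewrite ler1n.
Qed.

Let rt2 : rt ^+ 2 = n%:R^-1.
Proof. by rewrite exprVn sqr_sqrtr ?ler0n. Qed.

Let rho_n : rho ^+ n = expR (- (v / 2)).
Proof.
rewrite /rho -expRM_natl rt2; congr expR; field.
by rewrite pnatr_eq0 -lt0n.
Qed.

(** One factor a + ib of the characteristic function: the Taylor polynomial is integrated exactly by
    the moments 0 and v, and the remainder is controlled by the second and fourth moments. *)
Let step (i : nat) : (i < n)%N -> exists a b,
  [/\ mean_is P (fun w => cos (rt * U i w)) a,
      mean_is P (fun w => sin (rt * U i w)) b,
      `|a - rho| <= rt ^+ 3 * (C + v ^+ 2) & `|b| <= rt ^+ 3 * (C + v)].
Proof.
move=> iltn.
have mU := mean_is_measurable (U1 iltn).
have mrU : measurable_fun setT (fun w => rt * U i w) by exact: measurable_funM.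
have icos : P.-integrable setT (EFin \o (fun w => cos (rt * U i w))).
  apply: (@integrable_bounded _ _ _ _ _ 1) => [|w]; last exact: cos_max.
  by apply: measurableT_comp => //; apply: continuous_measurable_fun; exact: continuous_cos.
have isin : P.-integrable setT (EFin \o (fun w => sin (rt * U i w))).
  apply: (@integrable_bounded _ _ _ _ _ 1) => [|w]; last exact: sin_max.
  by apply: measurableT_comp => //; apply: continuous_measurable_fun; exact: continuous_sin.
have [m mC hm] := U4 iltn.
exists (\int[P]_w cos (rt * U i w)), (\int[P]_w sin (rt * U i w)).
have rt34 : rt ^+ 4 <= rt ^+ 3 by rewrite exprSr ler_piMr// exprn_ge0// ltW.
have rt40 : 0 <= rt ^+ 4 by rewrite exprn_ge0// ltW.
split => //.
- have h1 : `|\int[P]_w cos (rt * U i w) - 1 + rt ^+ 2 / 2 * v| <= rt ^+ 4 * m.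
    have hl := mean_isD (mean_isB (mean_isP icos) (mean_is_cst P 1))
      (mean_isZ (rt ^+ 2 / 2) (U2 iltn)).
    apply: mean_is_norm_le hl (mean_isZ (rt ^+ 4) hm) => w.
    rewrite -exprMn (_ : rt ^+ 2 / 2 * U i w ^+ 2 = (rt * U i w) ^+ 2 / 2).
      exact: cos_taylor2_le.
    by rewrite exprMn; ring.
  have h2 : `|rho - 1 + v * rt ^+ 2 / 2| <= (v * rt ^+ 2 / 2) ^+ 2.
    apply: expRN_taylor1_le.
    by rewrite !mulr_ge0// ?invr_ge0// exprn_ge0// ltW.
  have h3 : (v * rt ^+ 2 / 2) ^+ 2 <= rt ^+ 4 * v ^+ 2.
    by rewrite (_ : (v * rt ^+ 2 / 2) ^+ 2 = rt ^+ 4 * v ^+ 2 / 4); nra.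
  set c := \int[P]_w _ in h1 *.
  have -> : c - rho = (c - 1 + rt ^+ 2 / 2 * v) - (rho - 1 + v * rt ^+ 2 / 2).
    by field.
  apply: (le_trans (ler_normB _ _)).
  apply: (le_trans (lerD h1 (le_trans h2 h3))).
  rewrite -mulrDr; apply: (@le_trans _ _ (rt ^+ 4 * (C + v ^+ 2))).
    by rewrite ler_wpM2l// lerD2r.
  by rewrite ler_wpM2r// addr_ge0// sqr_ge0.
- have hl := mean_isB (mean_isP isin) (mean_isZ rt (U1 iltn)).
  rewrite mulr0 subr0 in hl.
  (* The third absolute moment is bounded through |u|^3 <= u^2 + u^4. *)
  apply: (@le_trans _ _ (rt ^+ 3 * (v + m))).
    apply: mean_is_norm_le hl (mean_isZ (rt ^+ 3) (mean_isD (U2 iltn) hm)) => w.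
    apply: (le_trans (sin_sub_id_le _)).
    rewrite normrM exprMn (gtr0_norm rt_gt0) ler_wpM2l ?exprn_ge0 ?(ltW rt_gt0)//.
    have -> : U i w ^+ 2 = `|U i w| ^+ 2 by rewrite real_normK ?num_real.
    have -> : U i w ^+ 4 = `|U i w| ^+ 4.
      by rewrite -normrX ger0_norm// exprn_even_ge0.
    by have := normr_ge0 (U i w); set x := `|U i w|; nra.
  rewrite ler_wpM2l ?exprn_ge0 ?(ltW rt_gt0)//.
  by rewrite addrC lerD2r.
Qed.

(** By independence and the addition formulas, c + is is multiplied by a + ib at each step. As |c|,
    |s| and rho are at most 1, the errors of the factors simply add up: n terms of order
    n^(-3/2). *)
Let main (i : nat) : (i <= n)%N -> exists c s,
  [/\ mean_is P (fun w => cos (rt * \sum_(j < i) U j w)) c,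
      mean_is P (fun w => sin (rt * \sum_(j < i) U j w)) s,
      `|c - rho ^+ i| <= i%:R * (rt ^+ 3 * K) &
      `|s| <= i%:R * (rt ^+ 3 * K)].
Proof.
elim: i => [_|i ih iltn].
  exists 1, 0; rewrite expr0 subrr normr0 mul0r; split => //.
  - apply: mean_is_ext (mean_is_cst P 1) => w.
    by rewrite big_ord0 mulr0 cos0.
  - apply: mean_is_ext (mean_is_cst P 0) => w.
    by rewrite big_ord0 mulr0 sin0.
have [c [s [hc hs cE sE]]] := ih (ltnW iltn).
have [a [b [ha hb aE bE]]] := step iltn.
have mt : measurable_fun setT (fun x : R => rt * x) by exact: measurable_funM.
have mcos : measurable_fun setT (fun x : R => cos (rt * x)).
  by apply: measurableT_comp => //; apply: continuous_measurable_fun; exact: continuous_cos.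
have msin : measurable_fun setT (fun x : R => sin (rt * x)).
  by apply: measurableT_comp => //; apply: continuous_measurable_fun; exact: continuous_sin.
have icc := mean_is_indep2 (indep2_comp mcos mcos (Uind iltn)) hc ha.
have iss := mean_is_indep2 (indep2_comp msin msin (Uind iltn)) hs hb.
have isc := mean_is_indep2 (indep2_comp msin mcos (Uind iltn)) hs ha.
have ics := mean_is_indep2 (indep2_comp mcos msin (Uind iltn)) hc hb.
exists (c * a - s * b), (s * a + c * b).
have c1 : `|c| <= 1.
  by apply: mean_is_norm_le hc (mean_is_cst P 1) => w; exact: cos_max.
have s1 : `|s| <= 1.
  by apply: mean_is_norm_le hs (mean_is_cst P 1) => w; exact: sin_max.
have rho0 : 0 <= rho by exact: expR_ge0.
have rho1 : rho <= 1.
  by rewrite -expR0 ler_expR oppr_le0 !mulr_ge0// ?invr_ge0// exprn_ge0// ltW.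
(* [key] serves both recursions: z = rho^i for the cosine, z = 0 for the sine. *)
have key (x y u z : R) : `|x| <= 1 -> `|y| <= 1 ->
    `|x - z| <= i%:R * (rt ^+ 3 * K) -> `|u| = `|y * b| ->
    `|x * a + u - z * rho| <= i.+1%:R * (rt ^+ 3 * K).
  move=> x1 y1 xz uE.
  have -> : x * a + u - z * rho = (x - z) * rho + (x * (a - rho) + u) by ring.
  apply: (le_trans (ler_normD _ _)); rewrite -(natr1 i) [leRHS]mulrDl [1 * (rt ^+ 3 * K)]mul1r.
  apply: lerD.
    by rewrite normrM (ger0_norm rho0) (le_trans _ xz)// ler_piMr.
  apply: (le_trans (ler_normD _ _)).
  have -> : rt ^+ 3 * K = rt ^+ 3 * (C + v ^+ 2) + rt ^+ 3 * (C + v).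
    by rewrite /K; ring.
  apply: lerD.
  - by rewrite normrM (le_trans _ aE)// ler_piMl.
  - by rewrite uE normrM (le_trans _ bE)// ler_piMl.
split.
- apply: mean_is_ext (mean_isB icc iss) => w.
  by rewrite big_ord_recr/= mulrDr cosD.
- apply: mean_is_ext (mean_isD isc ics) => w.
  by rewrite big_ord_recr/= mulrDr sinD.
- by rewrite exprSr; apply: (key c s (- (s * b)) (rho ^+ i)) => //; rewrite normrN.
- rewrite -[X in `|X|]subr0 -(mul0r rho).
  by apply: (key s c (c * b) 0) => //; rewrite subr0.
Qed.

Lemma array_clt : exists c s,
  [/\ mean_is P (fun w => cos ((Num.sqrt n%:R)^-1 * \sum_(j < n) U j w)) c,
      mean_is P (fun w => sin ((Num.sqrt n%:R)^-1 * \sum_(j < n) U j w)) s,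
      `|c - expR (- (v / 2))| <= (Num.sqrt n%:R)^-1 * (2 * C + v + v ^+ 2) &
      `|s| <= (Num.sqrt n%:R)^-1 * (2 * C + v + v ^+ 2)].
Proof.
have [c [s [hc hs cE sE]]] := main (leqnn n).
have e : n%:R * (rt ^+ 3 * K) = (Num.sqrt n%:R)^-1 * (2 * C + v + v ^+ 2).
  rewrite -/rt -/K (exprSr _ 2) rt2 !mulrA mulfV ?mul1r//.
  by rewrite pnatr_eq0 -lt0n.
by exists c, s; split => //; rewrite -?e -?rho_n.
Qed.

End array_clt.

Lemma mean_is_same_law d (O1 : measurableType d) d' (O2 : measurableType d')
    (R : realType) (P1 : probability O1 R) (P2 : probability O2 R)
    (X : O1 -> R) (Y : O2 -> R) (f : R -> R) (m : R) :
  measurable_fun setT X -> measurable_fun setT Y -> measurable_fun setT f ->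
  (forall U, measurable U -> P1 (X @^-1` U) = P2 (Y @^-1` U)) ->
  (exists M, forall x, `|f x| <= M) ->
  mean_is P1 (fun w => f (X w)) m -> mean_is P2 (fun w => f (Y w)) m.
Proof.
move=> mX mY mf XY [M fM] [i1 e1].
have i2 : P2.-integrable setT (EFin \o (fun w => f (Y w))).
  by apply: (@integrable_bounded _ _ _ _ _ M) => //; exact: measurableT_comp.
split => //; rewrite -e1 /Rintegral; congr fine.
have mEf : measurable_fun setT (EFin \o f) by exact/measurable_EFinP.
rewrite -[LHS](@integral_distribution _ _ _ _ _ P2 (to_mfun mY) (EFin \o f))//.
rewrite -[RHS](@integral_distribution _ _ _ _ _ P1 (to_mfun mX) (EFin \o f))//.
by apply: eq_measure_integral => A mA _; exact/esym/XY.
Qed.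

(* A centred normal variable is distributed like a sum of n independent
   normalised Wiener increments, for every n, so that its characteristic
   function is given by [array_clt]. *)
Section characteristic_function.
Context d0 (Omega0 : measurableType d0) (R : realType)
  (P0 : probability Omega0 R) (T : R) (B : R -> Omega0 -> R).
Hypotheses (T0 : 0 < T) (hB : wiener1 P0 T B).
Context d (Omega : measurableType d) (P : probability Omega R).

Let normalised_increments (v : R) (n : nat) : 0 <= v -> (0 < n)%N ->
  exists c s,
  [/\ mean_is P0 (fun w => cos (Num.sqrt (v / T) * (B T w - B 0 w))) c,
      mean_is P0 (fun w => sin (Num.sqrt (v / T) * (B T w - B 0 w))) s,
      `|c - expR (- (v / 2))| <=
        (Num.sqrt n%:R)^-1 * (2 * (3 * v ^+ 2) + v + v ^+ 2) &
      `|s| <= (Num.sqrt n%:R)^-1 * (2 * (3 * v ^+ 2) + v + v ^+ 2)].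
Proof.
move=> v0 n0; pose k := Num.sqrt (v / T).
have k2 : k ^+ 2 = v / T by rewrite sqr_sqrtr// divr_ge0// ltW.
have nr0 : (0 : R) < n%:R by rewrite ltr0n.
pose t (i : nat) : R := i%:R * (T / n%:R).
have h0 : 0 < T / n%:R by rewrite divr_gt0.
have t0 : t 0%N = 0 by rewrite /t mul0r.
have tn : t n = T by rewrite /t mulrCA mulfV ?mulr1// gt_eqF.
have t_ge0 i : 0 <= t i by rewrite /t mulr_ge0// ltW.
have tS i : t i < t i.+1 by rewrite /t ltr_pM2r// ltr_nat.
have tT i : (i < n)%N -> t i.+1 <= T.
  by move=> iltn; rewrite -[leRHS]tn /t ler_pM2r// ler_nat.
(* Each [U i] has variance v, and n^(-1/2) times their sum telescopes to the same variable for every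
   n. *)
pose U (i : nat) w := Num.sqrt n%:R * k * (B (t i.+1) w - B (t i) w).
have sumU i w : \sum_(j < i) U j w = Num.sqrt n%:R * k * (B (t i) w - B 0 w).
  rewrite -mulr_sumr; congr (_ * _).
  rewrite -(big_mkord xpredT (fun j => B (t j.+1) w - B (t j) w)).
  by rewrite telescope_sumr// t0.
have hU i : (i < n)%N -> normal_rv P0 (U i) v.
  move=> iltn.
  have dt : 0 <= t i.+1 - t i by rewrite subr_ge0 ltW.
  have e : (Num.sqrt n%:R * k) ^+ 2 * (t i.+1 - t i) = v.
    rewrite exprMn sqr_sqrtr ?ler0n// k2 /t -mulrBl -natrB// subSnn mul1r.
    by field; rewrite !gt_eqF.
  rewrite -[X in normal_rv _ _ X]e.
  exact: (normal_rv_scale _ dt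
    (wiener1_increment_normal hB (t_ge0 i) (tS i) (tT i iltn))).
have sn : Num.sqrt n%:R != 0 :> R by rewrite gt_eqF// sqrtr_gt0.
have [||||i iltn|c [s [hc hs cE sE]]] := @array_clt _ _ _ P0 n U v (3 * v ^+ 2) n0 v0.
- by rewrite mulr_ge0// sqr_ge0.
- by move=> i iltn; exact: normal_rv_mean v0 (hU i iltn).
- by move=> i iltn; have [] := normal_rv_moments v0 (hU i iltn).
- by move=> i iltn; have [_ h4 _] := normal_rv_moments v0 (hU i iltn); exists (3 * v ^+ 2).
- rewrite (_ : (fun w => _) = fun w => Num.sqrt n%:R * k * (B (t i) w - B 0 w)).
    2: by apply/funext => w; exact: sumU.
  move=> V1 V2 mV1 mV2; rewrite setIC muleC.
  have mk : measurable_fun setT (fun x : R => Num.sqrt n%:R * k * x) by exact: measurable_funM.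
  apply: (indep2_comp (f := fun x => Num.sqrt n%:R * k * x) (g := id)
    (X := fun w => B (t i.+1) w - B (t i) w)) => //.
  apply: (wiener1_increment_indep hB (t_ge0 i) (tS i) (tT i iltn)) => //.
  apply: measurable_funM => //; apply: measurable_funB.
  + by apply: (@sigma_of_measurable_fun _ _ _ _ `[0, t i] B (t i)); rewrite /= in_itv/= lexx t_ge0.
  + by apply: (@sigma_of_measurable_fun _ _ _ _ `[0, t i] B 0); rewrite /= in_itv/= lexx t_ge0.
have e w : (Num.sqrt n%:R)^-1 * \sum_(j < n) U j w = k * (B T w - B 0 w).
  by rewrite sumU tn -!mulrA mulKf.
exists c, s; split => //.
- by apply: mean_is_ext hc => w; rewrite e.
- by apply: mean_is_ext hs => w; rewrite e.
Qed.

Let inv_sqrt_small (x K : R) :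
  (forall n, (0 < n)%N -> `|x| <= (Num.sqrt n%:R)^-1 * K) -> x = 0.
Proof.
move=> h; apply/eqP; rewrite -normr_le0 leNgt; apply/negP => x0.
pose n := (Num.bound ((K / `|x|) ^+ 2)).+1.
have := h n isT; rewrite ler_pdivlMl ?sqrtr_gt0 ?ltr0n// -ler_pdivlMr// => h1.
have : (K / `|x|) ^+ 2 < n%:R.
  by rewrite (lt_le_trans (archi_boundP (sqr_ge0 _)))// ler_nat.
rewrite ltNge => /negP; apply.
rewrite -[leLHS](@sqr_sqrtr _ n%:R) ?ler0n// lerXn2r ?nnegrE ?sqrtr_ge0//.
by rewrite (le_trans _ h1)// sqrtr_ge0.
Qed.

Lemma normal_rv_trig (X : Omega -> R) (v : R) : 0 <= v -> normal_rv P X v ->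
  mean_is P (fun w => cos (X w)) (expR (- (v / 2))) /\
  mean_is P (fun w => sin (X w)) 0.
Proof.
move=> v0 [mX hX].
pose Y w := Num.sqrt (v / T) * (B T w - B 0 w).
have [mY hY] : normal_rv P0 Y v.
  have e : Num.sqrt (v / T) ^+ 2 * (T - 0) = v.
    by rewrite subr0 sqr_sqrtr ?divr_ge0 ?(ltW T0)// divfK// gt_eqF.
  rewrite -[X in normal_rv _ _ X]e.
  have T0' : 0 <= T - 0 by rewrite subr0 ltW.
  exact: (normal_rv_scale _ T0' (wiener1_increment_normal hB (lexx 0) T0 (lexx T))).
have YX V : measurable V -> P0 (Y @^-1` V) = P (X @^-1` V).
  by move=> mV; rewrite (hX V mV) (hY V mV).
have [c [s [hc hs _ _]]] := normalised_increments v0 (ltn0Sn 0).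
(* The mean [c] does not depend on n, while its distance to expR (- (v / 2)) is bounded by K / sqrt
   n for every n. *)
have cE : c = expR (- (v / 2)).
  apply/eqP; rewrite -subr_eq0; apply/eqP/(inv_sqrt_small (K := 2 * (3 * v ^+ 2) + v + v ^+ 2)) => n n0.
  have [c' [s' [hc' _ h _]]] := normalised_increments v0 n0.
  by rewrite -hc.2 hc'.2.
have sE : s = 0.
  apply/(inv_sqrt_small (K := 2 * (3 * v ^+ 2) + v + v ^+ 2)) => n n0.
  have [c' [s' [_ hs' _ h]]] := normalised_increments v0 n0.
  by rewrite -hs.2 hs'.2.
rewrite -cE -sE; split.
- apply: (mean_is_same_law mY mX _ YX _ hc); last by exists 1 => x; exact: cos_max.
  by apply: continuous_measurable_fun; exact: continuous_cos.
- apply: (mean_is_same_law mY mX _ YX _ hs); last by exists 1 => x; exact: sin_max.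
  by apply: continuous_measurable_fun; exact: continuous_sin.
Qed.

End characteristic_function.

Lemma sqr_sum_le (R : realFieldType) (I : Type) (s : seq I) (x : I -> R) :
  (\sum_(i <- s) x i) ^+ 2 <= (size s)%:R * \sum_(i <- s) x i ^+ 2.
Proof.
elim: s => [|i s ih]; first by rewrite !big_nil expr0n mulr0.
rewrite !big_cons /= -natr1; move: ih.
have: 0 <= \sum_(j <- s) x j ^+ 2 by apply: sumr_ge0 => j _; exact: sqr_ge0.
case: (posnP (size s)) => [/size0nil ->|].
  by rewrite !big_nil /= !addr0 add0r mul1r.
rewrite -(ltr0n R); move: (size s)%:R => m.
set S := \sum_(j <- s) x j; set Q := \sum_(j <- s) _ => m0 Q0 SQ.
have : 0 <= m * (Q + m * x i ^+ 2 - 2 * S * x i).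
  have -> : m * (Q + m * x i ^+ 2 - 2 * S * x i) =
    (m * Q - S ^+ 2) + (S - m * x i) ^+ 2 by ring.
  by rewrite addr_ge0 ?subr_ge0 ?sqr_ge0.
rewrite pmulr_rge0//; nra.
Qed.

Lemma pow4_sum_le (R : realFieldType) (I : Type) (s : seq I) (x : I -> R) :
  (\sum_(i <- s) x i) ^+ 4 <= (size s)%:R ^+ 3 * \sum_(i <- s) x i ^+ 4.
Proof.
have h1 := sqr_sum_le s x; have h2 := sqr_sum_le s (fun i => x i ^+ 2).
have -> : (\sum_(i <- s) x i) ^+ 4 = ((\sum_(i <- s) x i) ^+ 2) ^+ 2 by rewrite -exprM.
apply: (@le_trans _ _ (((size s)%:R * \sum_(i <- s) x i ^+ 2) ^+ 2)).
  rewrite lerXn2r ?nnegrE ?sqr_ge0// mulr_ge0// sumr_ge0// => i _.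
  exact: sqr_ge0.
rewrite exprMn (exprSr _ 2) -mulrA ler_wpM2l ?exprn_ge0//.
by under [in leRHS]eq_bigr do rewrite (exprM _ 2 2).
Qed.

(** * Quadratic forms in Gaussian variables *)

Lemma array_variance d (Omega : measurableType d) (R : realType)
    (P : probability Omega R) (n : nat) (U : nat -> Omega -> R) (v : R) :
  (forall i, (i < n)%N -> mean_is P (U i) 0) ->
  (forall i, (i < n)%N -> mean_is P (fun w => U i w ^+ 2) v) ->
  (forall i, (i < n)%N -> indep2 P (fun w => \sum_(j < i) U j w) (U i)) ->
  mean_is P (fun w => (\sum_(j < n) U j w) ^+ 2) (n%:R * v).
Proof.
move=> U1 U2 Ui.
suff : forall i, (i <= n)%N -> mean_is P (fun w => \sum_(j < i) U j w) 0 /\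
    mean_is P (fun w => (\sum_(j < i) U j w) ^+ 2) (i%:R * v).
  by move=> /(_ n (leqnn n))[].
elim=> [_|i ih iltn].
  split; apply: mean_is_ext (mean_is_cst P _) => w; rewrite ?big_ord0//.
  by rewrite mul0r expr0n.
have [h1 h2] := ih (ltnW iltn).
have h3 := mean_is_indep2 (Ui i iltn) h1 (U1 i iltn).
split.
  have := mean_isD h1 (U1 i iltn); rewrite addr0; apply: mean_is_ext => w.
  by rewrite big_ord_recr.
have := mean_isD (mean_isD h2 (mean_isZ 2 h3)) (U2 i iltn).
rewrite !mulr0 addr0 -(natr1 i) mulrDl mul1r; apply: mean_is_ext => w.
by rewrite big_ord_recr/=; ring.
Qed.

Section gaussian_quadratic_forms.
Context d0 (Omega0 : measurableType d0) (R : realType)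
  (P0 : probability Omega0 R) (T : R) (B : R -> Omega0 -> R).
Hypotheses (T0 : 0 < T) (hB : wiener1 P0 T B).
Context d (Omega : measurableType d) (P : probability Omega R).

Section linear_forms.
Variables (I : finType) (xi : I -> Omega -> R).
Hypotheses (hxi : forall i, normal_rv P (xi i) 1) (xi_ind : indep_family P xi).

Definition lin (a : I -> R) (w : Omega) := \sum_i a i * xi i w.
Definition dot (a b : I -> R) := \sum_i a i * b i.

Lemma lin_normal a : normal_rv P (lin a) (dot a a).
Proof.
rewrite /dot (eq_bigr (fun i => a i ^+ 2)); last by move=> i _; rewrite expr2.
by apply: (indep_family_lincomb_normal T0 hB).
Qed.

Lemma dot_ge0 a : 0 <= dot a a.
Proof. by apply: sumr_ge0 => i _; rewrite -expr2 sqr_ge0. Qed.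

Let linDZ a b e w : lin (fun i => a i + e * b i) w = lin a w + e * lin b w.
Proof.
rewrite /lin mulr_sumr -big_split/=; apply: eq_bigr => i _.
by rewrite mulrDl mulrA.
Qed.

Let dotC a b : dot a b = dot b a.
Proof. by apply: eq_bigr => i _; rewrite mulrC. Qed.

Let dotDZl a b e c : dot (fun i => a i + e * b i) c = dot a c + e * dot b c.
Proof.
rewrite /dot mulr_sumr -big_split/=; apply: eq_bigr => i _.
by rewrite mulrDl mulrA.
Qed.

Let dotDZr a b e c : dot c (fun i => a i + e * b i) = dot c a + e * dot c b.
Proof. by rewrite dotC dotDZl !(dotC _ c). Qed.

Lemma mean_lin2 a b : mean_is P (fun w => lin a w * lin b w) (dot a b).
Proof.
have h e : mean_is P (fun w => (lin a w + e * lin b w) ^+ 2)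
    (dot a a + 2 * e * dot a b + e ^+ 2 * dot b b).
  have [h _ _] := normal_rv_moments (dot_ge0 _)
    (lin_normal (fun i => a i + e * b i)).
  rewrite !dotDZl !dotDZr (dotC b a) in h.
  rewrite (_ : _ + _ = dot a a + e * dot a b + e * (dot a b + e * dot b b)).
    by apply: mean_is_ext h => w; rewrite linDZ.
  by ring.
have := mean_isZ (4^-1) (mean_isB (h 1) (h (-1))).
rewrite (_ : 4^-1 * _ = dot a b); last by field.
by apply: mean_is_ext => w; field.
Qed.

(* Polarisation of E (lin a)^4 = 3 (dot a a)^2. *)
Lemma mean_lin4 a b c e :
  mean_is P (fun w => lin a w * lin b w * (lin c w * lin e w))
    (dot a b * dot c e + dot a c * dot b e + dot a e * dot b c).
Proof.
pose q (x y z : R) := dot a a + x ^+ 2 * dot b b + y ^+ 2 * dot c c +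
  z ^+ 2 * dot e e + 2 * (x * dot a b + y * dot a c + z * dot a e +
  x * y * dot b c + x * z * dot b e + y * z * dot c e).
have h x y z : mean_is P
    (fun w => (lin a w + x * lin b w + y * lin c w + z * lin e w) ^+ 4)
    (3 * q x y z ^+ 2).
  have [_ h _] := normal_rv_moments (dot_ge0 _) (lin_normal (fun i =>
    (a i + x * b i) + y * c i + z * e i)).
  rewrite (_ : dot _ _ = q x y z) in h.
    by apply: mean_is_ext h => w; rewrite !linDZ.
  rewrite !dotDZl !dotDZr (dotC b a) (dotC c a) (dotC e a) (dotC c b) (dotC e b).
  by rewrite (dotC e c) /q; ring.
(* The fourth powers are summed over the eight sign patterns, weighted by the product of the signs.
   Only the monomial that contains all four forms survives, with coefficient 8 x 24 = 192. *)
have hs := mean_isZ (192^-1) (mean_isB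
  (mean_isD (mean_isD (h 1 1 1) (h 1 (-1) (-1))) (mean_isD (h (-1) 1 (-1)) (h (-1) (-1) 1)))
  (mean_isD (mean_isD (h (-1) (-1) (-1)) (h (-1) 1 1)) (mean_isD (h 1 (-1) 1) (h 1 1 (-1))))).
rewrite [X in mean_is _ _ X](_ : _ = dot a b * dot c e + dot a c * dot b e +
  dot a e * dot b c) in hs; last by rewrite /q; field.
by apply: mean_is_ext hs => w; field.
Qed.

Lemma mean_lin_norm_pow8 a : mean_is P (fun w => lin a w ^+ 8) (105 * dot a a ^+ 4).
Proof. by have [_ _ h] := normal_rv_moments (dot_ge0 a) (lin_normal a). Qed.

Lemma lin_measurable (A : pred I) a : (forall i, ~~ A i -> a i = 0) ->
  measurable_fun (setT : set (g_sigma_algebraType (rectangles xi A))) (lin a).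
Proof.
move=> aA; apply: measurable_sum => i.
have [Ai|/aA ai0] := boolP (A i).
  by apply: measurable_funM => //; exact: rectangles_measurable_fun.
rewrite (_ : (fun w => _) = fun=> 0); first exact: measurable_cst.
by apply/funext => w; rewrite ai0 mul0r.
Qed.

End linear_forms.

Section quadratic_array.
Variables (n : nat) (C : finType) (xi : 'I_n * C -> Omega -> R).
Hypotheses (hxi : forall i, normal_rv P (xi i) 1) (xi_ind : indep_family P xi).
Variables (L K : finType) (g : L -> C -> R) (pos : K -> L * L) (al : K -> R).
Hypothesis n0 : (0 < n)%N.

Let a (i : nat) (l : L) (jc : 'I_n * C) := (val jc.1 == i)%:R * g l jc.2.
Definition gram (l m : L) := \sum_c g l c * g m c.

Definition row_form (i : nat) (l : L) := lin xi (a i l).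

(** [pos k] names the two linear forms of the k-th product and [gram] is the mean of that product.
    Row i involves only the variables (i, c), whence the independence of the rows. *)
Definition quad_form (i : nat) (w : Omega) := \sum_k al k *
  (row_form i (pos k).1 w * row_form i (pos k).2 w - gram (pos k).1 (pos k).2).

(** Isserlis' formula: the centring removes the pairing inside each product, and the two crossed
    pairings remain. *)
Definition quad_var := \sum_k \sum_k' al k * al k' *
  (gram (pos k).1 (pos k').1 * gram (pos k).2 (pos k').2 +
   gram (pos k).1 (pos k').2 * gram (pos k).2 (pos k').1).

(** Comes from the power mean inequality for #|K| terms, then (u - z)^4 <= 8 (u^4 + z^4) and (x y)^4
    <= x^8 + y^8, with Gaussian eighth moment 105 v^4. *)
Definition quad_bound := #|K|%:R ^+ 3 * \sum_k al k ^+ 4 *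
  (8 * (105 * gram (pos k).1 (pos k).1 ^+ 4 + 105 * gram (pos k).2 (pos k).2 ^+ 4 +
        gram (pos k).1 (pos k).2 ^+ 4)).

Lemma row_formE (i : 'I_n) l w : row_form i l w = \sum_c g l c * xi (i, c) w.
Proof.
transitivity (\sum_j \sum_c a i l (j, c) * xi (j, c) w).
  by rewrite pair_bigA; apply: eq_bigr => -[].
rewrite (bigD1 i)//= [X in _ + X]big1 ?addr0 => [|j ji].
  by apply: eq_bigr => c _; rewrite /a eqxx mul1r.
by rewrite big1// => c _; rewrite /a/= val_eqE (negbTE ji) !mul0r.
Qed.

Let dotE (i : nat) l m : (i < n)%N -> dot (a i l) (a i m) = gram l m.
Proof.
move=> iltn; transitivity (\sum_j \sum_c a i l (j, c) * a i m (j, c)).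
  by rewrite pair_bigA; apply: eq_bigr => -[].
rewrite (bigD1 (Ordinal iltn))//= [X in _ + X]big1 ?addr0 => [|j ji].
  by apply: eq_bigr => c _; rewrite /a eqxx !mul1r.
rewrite big1// => c _; rewrite /a/=.
by rewrite (_ : (j == i :> nat) = false) ?mul0r//; apply: contra_neqF ji => /eqP ji; exact: val_inj.
Qed.

Let quad1 i : (i < n)%N -> mean_is P (quad_form i) 0.
Proof.
move=> iltn.
have := @mean_is_sum _ _ _ P K (index_enum K) (fun k w => al k *
  (row_form i (pos k).1 w * row_form i (pos k).2 w - gram (pos k).1 (pos k).2))
  (fun=> 0).
rewrite big1//; apply => k; rewrite -(mulr0 (al k)); apply: mean_isZ.
have := mean_isB (mean_lin2 hxi xi_ind (a i (pos k).1) (a i (pos k).2))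
  (mean_is_cst P (gram (pos k).1 (pos k).2)).
by rewrite dotE// subrr.
Qed.

Let quad2 i : (i < n)%N -> mean_is P (fun w => quad_form i w ^+ 2) quad_var.
Proof.
move=> iltn.
apply: (@mean_is_ext _ _ _ _ (fun w => \sum_k \sum_k' al k * al k' *
  ((row_form i (pos k).1 w * row_form i (pos k).2 w - gram (pos k).1 (pos k).2) *
   (row_form i (pos k').1 w * row_form i (pos k').2 w - gram (pos k').1 (pos k').2)))).
  move=> w; rewrite expr2 /quad_form mulr_suml; apply: eq_bigr => k _.
  by rewrite mulr_sumr; apply: eq_bigr => k' _; ring.
apply: mean_is_sum => k; apply: mean_is_sum => k'; apply: mean_isZ.
set k1 := (pos k).1; set k2 := (pos k).2; set m1 := (pos k').1; set m2 := (pos k').2.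
have h4 := mean_lin4 hxi xi_ind (a i k1) (a i k2) (a i m1) (a i m2).
have hk := mean_lin2 hxi xi_ind (a i k1) (a i k2).
have hm := mean_lin2 hxi xi_ind (a i m1) (a i m2).
rewrite !dotE// in h4 hk hm.
have := mean_isD (mean_isB (mean_isB h4 (mean_isZ (gram m1 m2) hk))
  (mean_isZ (gram k1 k2) hm)) (mean_is_cst P (gram k1 k2 * gram m1 m2)).
rewrite [X in mean_is _ _ X](_ : _ = gram k1 m1 * gram k2 m2 + gram k1 m2 * gram k2 m1); last by ring.
by apply: mean_is_ext => w; rewrite /row_form; ring.
Qed.

Let quad4 i : (i < n)%N -> exists2 m, m <= quad_bound &
  mean_is P (fun w => quad_form i w ^+ 4) m.
Proof.
move=> iltn.
pose Y k w := al k ^+ 4 * (8 * (row_form i (pos k).1 w ^+ 8 + row_form i (pos k).2 w ^+ 8 +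
   gram (pos k).1 (pos k).2 ^+ 4)).
have hY : mean_is P (fun w => #|K|%:R ^+ 3 * \sum_k Y k w) quad_bound.
  apply: mean_isZ; apply: mean_is_sum => k; apply: mean_isZ; apply: mean_isZ.
  apply: mean_isD; last exact: mean_is_cst.
  have h1 := mean_lin_norm_pow8 hxi xi_ind (a i (pos k).1).
  have h2 := mean_lin_norm_pow8 hxi xi_ind (a i (pos k).2).
  by rewrite !dotE// in h1 h2; exact: mean_isD.
have le w : quad_form i w ^+ 4 <= #|K|%:R ^+ 3 * \sum_k Y k w.
  apply: (le_trans (pow4_sum_le _ _)).
  have sz : size (index_enum K) = #|K| by rewrite -sum1_size sum1_card.
  rewrite sz ler_wpM2l ?exprn_ge0// ler_sum// => k _.
  rewrite exprMn ler_wpM2l ?exprn_even_ge0//.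
  set x := row_form _ _ _; set y := row_form _ _ _; set z := gram _ _.
  have h1 : (x * y - z) ^+ 4 <= 8 * ((x * y) ^+ 4 + z ^+ 4).
    set u := x * y; have -> : (u - z) ^+ 4 = ((u - z) ^+ 2) ^+ 2 by rewrite -exprM.
    have : (u - z) ^+ 2 <= 2 * (u ^+ 2 + z ^+ 2) by have := sqr_ge0 (u + z); nra.
    have : 0 <= (u - z) ^+ 2 by rewrite sqr_ge0.
    have -> : u ^+ 4 = (u ^+ 2) ^+ 2 by rewrite -exprM.
    have -> : z ^+ 4 = (z ^+ 2) ^+ 2 by rewrite -exprM.
    move: (u ^+ 2) (z ^+ 2) ((u - z) ^+ 2) => A B' D D0 DAB.
    have : D ^+ 2 <= (2 * (A + B')) ^+ 2 by rewrite lerXn2r ?nnegrE// (le_trans D0).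
    by have := sqr_ge0 (A - B'); nra.
  apply: (le_trans h1); rewrite ler_wpM2l// lerD2r exprMn.
  have -> : x ^+ 8 = (x ^+ 4) ^+ 2 by rewrite -exprM.
  have -> : y ^+ 8 = (y ^+ 4) ^+ 2 by rewrite -exprM.
  by have := sqr_ge0 (x ^+ 4 - y ^+ 4); have := sqr_ge0 (x ^+ 4 + y ^+ 4); nra.
have mq : measurable_fun setT (quad_form i) := mean_is_measurable (quad1 iltn).
have i4 : P.-integrable setT (EFin \o (fun w => quad_form i w ^+ 4)).
  apply: integrable_dominated hY.1 => [|w]; first exact: measurable_funX.
  by rewrite ger0_norm ?exprn_even_ge0.
exists (\int[P]_w (quad_form i w ^+ 4)) => //.
exact: mean_is_le le (mean_isP i4) hY.
Qed.

Let quad_ind i : (i < n)%N ->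
  indep2 P (fun w => \sum_(j < i) quad_form j w) (quad_form i).
Proof.
move=> iltn.
have mq (A : pred ('I_n * C)) j : (forall jc, val jc.1 = j -> A jc) ->
    measurable_fun (setT : set (g_sigma_algebraType (rectangles xi A))) (quad_form j).
  move=> jA; apply: measurable_sum => k; apply: measurable_funM => //.
  apply: measurable_funB => //; apply: measurable_funM.
  - apply: lin_measurable => jc nA; rewrite /a; case: eqP => [/jA|]; last by rewrite mul0r.
    by rewrite (negbTE nA).
  - apply: lin_measurable => jc nA; rewrite /a; case: eqP => [/jA|]; last by rewrite mul0r.
    by rewrite (negbTE nA).
apply: (@indep_family_indep2 _ _ _ P _ xi _ xi_ind
  (fun jc => (val jc.1 < i)%N) (fun jc => val jc.1 == i)).
- by move=> jc; exact: (hxi jc).1.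
- by move=> jc; rewrite ltn_neqAle => /andP[].
- by apply: measurable_sum => j; apply: mq => jc ->.
- by apply: mq => jc ->.
Qed.

Lemma quad_bound_ge0 : 0 <= quad_bound.
Proof.
rewrite mulr_ge0 ?exprn_ge0// sumr_ge0// => k _.
apply: mulr_ge0; first by rewrite exprn_even_ge0.
apply: mulr_ge0 => //; apply: addr_ge0; last by rewrite exprn_even_ge0.
by apply: addr_ge0; apply: mulr_ge0 => //; rewrite exprn_even_ge0.
Qed.

Lemma quad_var_ge0 : 0 <= quad_var.
Proof.
by apply: mean_is_le (mean_is_cst P 0) (quad2 n0) => w; exact: sqr_ge0.
Qed.

Lemma quad_form_variance :
  mean_is P (fun w => ((Num.sqrt n%:R)^-1 * \sum_(i < n) quad_form i w) ^+ 2) quad_var.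
Proof.
have := mean_isZ (n%:R^-1) (array_variance quad1 quad2 quad_ind).
rewrite mulKf; last by rewrite pnatr_eq0 -lt0n.
apply: mean_is_ext => w.
by rewrite exprMn exprVn sqr_sqrtr ?ler0n.
Qed.

Lemma quad_form_clt : exists c s,
  [/\ mean_is P (fun w => cos ((Num.sqrt n%:R)^-1 * \sum_(i < n) quad_form i w)) c,
      mean_is P (fun w => sin ((Num.sqrt n%:R)^-1 * \sum_(i < n) quad_form i w)) s,
      `|c - expR (- (quad_var / 2))| <=
        (Num.sqrt n%:R)^-1 * (2 * quad_bound + quad_var + quad_var ^+ 2) &
      `|s| <= (Num.sqrt n%:R)^-1 * (2 * quad_bound + quad_var + quad_var ^+ 2)].
Proof.
apply: array_clt n0 quad_var_ge0 quad_bound_ge0 quad1 quad2 quad4 quad_ind.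
Qed.

End quadratic_array.
End gaussian_quadratic_forms.

(** * Weak convergence from characteristic functions *)

Section matrix_continuity.
Context {R : realType}.

Lemma continuous_mx (T : topologicalType) (m n : nat) (f : T -> 'M[R]_(m, n)) (x : T) :
  (forall i j, {for x, continuous (fun t => f t i j)}) -> {for x, continuous f}.
Proof.
move=> h; apply/cvg_ballP => e e0.
have : \forall t \near x, forall ij : 'I_m * 'I_n,
    ball (f x ij.1 ij.2) e (f t ij.1 ij.2).
  apply: filter_forall => -[i j] /=.
  exact: (cvg_ball (h i j)).
by apply: filterS => t ht; split => // i j; exact: (ht (i, j)).
Qed.

Lemma continuous_sumr (T : topologicalType) (I : Type) (r : seq I) (F : I -> T -> R) :
  (forall i, continuous (F i)) -> continuous (fun x => \sum_(i <- r) F i x).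
Proof. by move=> h; apply: (continuous_big (op := +%R)) => //; exact: add_continuous. Qed.

(** The Heine-Cantor argument, with only one of the two points confined to [K]. *)
Lemma compact_uniformly_continuous (V : normedModType R) (G : V -> R) (K : set V) :
  compact K -> continuous G -> forall eps : R, 0 < eps ->
  exists2 delta : R, 0 < delta &
    forall x y, K x -> `|x - y| < delta -> `|G x - G y| < eps.
Proof.
move=> cK cG eps eps0.
pose Q (delta : R) (x : V) := forall y, `|x - y| < delta -> `|G x - G y| < eps.
have /(_ R (0 : R)^'+ Q _) := (compact_near_coveringP K).1 cK.
have near_ok x : K x -> \forall x' \near x & delta \near (0 : R)^'+, Q delta x'.
  move=> _; have e2 : 0 < eps / 2 by rewrite divr_gt0.
  have /cvgrPdist_lt/(_ _ e2) := cG x.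
  move=> /nbhs_ballP[r /= r0 hr].
  have r2 : 0 < r / 2 by rewrite divr_gt0.
  exists (ball x (r / 2), [set d | d < r / 2]) => /=.
    by split; [exact: nbhsx_ballx|exact: nbhs_right_lt].
  move=> [x' d] /= [xx' dr] y x'y; move: xx'; rewrite -ball_normE /= => xx'.
  have h1 : `|G x - G x'| < eps / 2.
    apply: hr; rewrite -ball_normE/= (lt_trans xx')//.
    by rewrite ltr_pdivrMr// ltr_pMr// ltr1n.
  have h2 : `|G x - G y| < eps / 2.
    apply: hr; rewrite -ball_normE/=.
    rewrite (_ : x - y = (x - x') + (x' - y)); last by rewrite addrA subrK.
    rewrite (le_lt_trans (ler_normD _ _))// [ltRHS](splitr r) ltrD//.
    exact: lt_trans x'y dr.
  rewrite (_ : G x' - G y = (G x - G y) - (G x - G x')); last by ring.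
  rewrite (le_lt_trans (ler_normB _ _))// [ltRHS](splitr eps).
  exact: ltrD.
move=> /(_ near_ok) h.
near (0 : R)^'+ => delta; exists delta; first by near: delta; exact: nbhs_right_gt.
move=> x y Kx xy.
suff : K `<=` Q delta by move=> /(_ _ Kx); exact.
by near: delta.
Unshelve. all: by end_near. Qed.

End matrix_continuity.

(** * Bernstein polynomials in several variables *)

Section bernstein.
Context {R : realType}.

(* binw y m i = 'C(m, i) * y ^+ i * (1 - y) ^+ (m - i) *)
Fixpoint binw (y : R) (m i : nat) : R :=
  if m is m'.+1 then
    (if i is i'.+1 then y * binw y m' i' else 0) + (1 - y) * binw y m' i
  else (i == 0)%:R.

Lemma binw_ge0 (y : R) m i : 0 <= y <= 1 -> 0 <= binw y m i.
Proof.
move=> y01; elim: m i => [i|m ih i] /=; first by rewrite ler0n.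
by case: i => [|i]; rewrite addr_ge0// mulr_ge0//; lra.
Qed.

Lemma binw_gt (y : R) m i : (m < i)%N -> binw y m i = 0.
Proof.
elim: m i => [[]//|m ih [//|i]] mi /=.
by rewrite !ih ?mulr0 ?addr0// ltnW.
Qed.

Lemma sum_binwS (y : R) m (phi : nat -> R) :
  \sum_(i < m.+2) binw y m.+1 i * phi i =
  y * (\sum_(i < m.+1) binw y m i * phi i.+1) +
  (1 - y) * \sum_(i < m.+1) binw y m i * phi i.
Proof.
under eq_bigr do rewrite /= mulrDl; rewrite big_split/=; congr (_ + _).
  rewrite big_ord_recl/= mul0r add0r mulr_sumr; apply: eq_bigr => i _.
  by rewrite mulrA.
rewrite big_ord_recr/= binw_gt// mulr0 mul0r addr0 mulr_sumr.
by apply: eq_bigr => i _; rewrite mulrA.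
Qed.

Lemma sum_binw (y : R) m : \sum_(i < m.+1) binw y m i = 1.
Proof.
have -> : \sum_(i < m.+1) binw y m i = \sum_(i < m.+1) binw y m i * 1.
  by apply: eq_bigr => i _; rewrite mulr1.
elim: m => [|m ih]; first by rewrite big_ord1 /= mulr1.
by rewrite (sum_binwS y m (fun=> 1)) ih; ring.
Qed.

Lemma sum_binw_id (y : R) m : \sum_(i < m.+1) binw y m i * i%:R = m%:R * y.
Proof.
elim: m => [|m ih]; first by rewrite big_ord1 /= mulr0 mul0r.
rewrite (sum_binwS y m (fun i => i%:R)) ih.
under eq_bigr do rewrite -natr1 mulrDr mulr1.
by rewrite big_split/= ih sum_binw -natr1; ring.
Qed.

Lemma sum_binw_sqr (y : R) m :
  \sum_(i < m.+1) binw y m i * i%:R ^+ 2 = m%:R * y * (1 - y) + (m%:R * y) ^+ 2.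
Proof.
elim: m => [|m ih]; first by rewrite big_ord1 /= expr0n mulr0 !mul0r expr0n addr0.
rewrite (sum_binwS y m (fun i => i%:R ^+ 2)) ih.
rewrite (eq_bigr (fun i : 'I_m.+1 => binw y m i * i%:R ^+ 2 +
   (2 * (binw y m i * i%:R) + binw y m i))); last first.
  by move=> i _; rewrite -natr1; ring.
rewrite !big_split/= -mulr_sumr ih sum_binw_id sum_binw -(natr1 m); ring.
Qed.

Lemma sum_binw_variance (y : R) m : 0 <= y <= 1 -> (0 < m)%N ->
  \sum_(i < m.+1) binw y m i * (i%:R / m%:R - y) ^+ 2 <= m%:R^-1.
Proof.
move=> y01 m0; have mR : m%:R != 0 :> R by rewrite pnatr_eq0 -lt0n.
rewrite (eq_bigr (fun i : 'I_m.+1 => m%:R^-1 ^+ 2 * (binw y m i * i%:R ^+ 2) +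
   ((- 2 * y / m%:R) * (binw y m i * i%:R) + y ^+ 2 * binw y m i))); last first.
  by move=> i _; field.
rewrite !big_split/= -!mulr_sumr sum_binw_sqr sum_binw_id sum_binw.
rewrite (_ : _ + _ = m%:R^-1 * (y * (1 - y))); last by field.
by rewrite ler_piMr// ?invr_ge0//; nra.
Qed.

Variable q : nat.

(** The tensor Bernstein polynomial: the mean of G (k / m) when the k_j are independent binomial
    variables with parameters m and y_j. *)
Definition bernstein m (G : 'rV[R]_q -> R) (y : 'I_q -> R) : R :=
  \sum_(k : {ffun 'I_q -> 'I_m.+1})
    (\prod_j binw (y j) m (k j)) * G (\row_j ((k j)%:R / m%:R)).

Let prod_binw_ge0 m (y : 'I_q -> R) (k : {ffun 'I_q -> 'I_m.+1}) :
  (forall j, 0 <= y j <= 1) -> 0 <= \prod_j binw (y j) m (k j).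
Proof. by move=> y01; apply: prodr_ge0 => j _; exact: binw_ge0. Qed.

Let sum_prod_binw m (y : 'I_q -> R) :
  \sum_(k : {ffun 'I_q -> 'I_m.+1}) \prod_j binw (y j) m (k j) = 1.
Proof.
rewrite -(bigA_distr_bigA (fun j (i : 'I_m.+1) => binw (y j) m i)) big1// => j _.
exact: sum_binw.
Qed.

Let sum_prod_binw_variance m (y : 'I_q -> R) j0 : (0 < m)%N ->
  (forall j, 0 <= y j <= 1) ->
  \sum_(k : {ffun 'I_q -> 'I_m.+1}) (\prod_j binw (y j) m (k j)) *
    ((k j0)%:R / m%:R - y j0) ^+ 2 <= m%:R^-1.
Proof.
move=> m0 y01.
pose F j (i : 'I_m.+1) := binw (y j) m i *
  (if j == j0 then (i%:R / m%:R - y j0) ^+ 2 else 1).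
have -> : \sum_(k : {ffun 'I_q -> 'I_m.+1}) (\prod_j binw (y j) m (k j)) *
    ((k j0)%:R / m%:R - y j0) ^+ 2 =
    \sum_(k : {ffun 'I_q -> 'I_m.+1}) \prod_j F j (k j).
  apply: eq_bigr => k _; rewrite big_split/=; congr (_ * _).
  by rewrite (bigD1 j0)//= eqxx big1 ?mulr1// => j jj; rewrite (negbTE jj).
rewrite -(bigA_distr_bigA F) (bigD1 j0)//= [X in _ * X]big1 ?mulr1; last first.
  move=> j jj; rewrite /F (negbTE jj); under eq_bigr do rewrite mulr1.
  exact: sum_binw.
by rewrite /F eqxx; exact: sum_binw_variance.
Qed.

Let sum_prod_binwM m (y : 'I_q -> R) (c : R) :
  c = \sum_(k : {ffun 'I_q -> 'I_m.+1}) (\prod_j binw (y j) m (k j)) * c.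
Proof. by rewrite -mulr_suml sum_prod_binw mul1r. Qed.

Lemma bernstein_bounded m (G : 'rV[R]_q -> R) (y : 'I_q -> R) M :
  (forall j, 0 <= y j <= 1) -> (forall x, `|G x| <= M) -> `|bernstein m G y| <= M.
Proof.
move=> y01 GM; apply: (le_trans (ler_norm_sum _ _ _)).
rewrite [leRHS](sum_prod_binwM m y) ler_sum// => k _.
by rewrite normrM ger0_norm ?prod_binw_ge0// ler_wpM2l ?prod_binw_ge0.
Qed.

(** Nodes within [delta] of y cost eps / 2 by uniform continuity on the cube. At the others some
    coordinate is off by at least [delta], so the error 2 M is at most 2 M / delta^2 times the sum
    of the squared deviations, whose mean is at most q / m (Chebyshev). *)
Lemma bernstein_approx (G : 'rV[R]_q -> R) M eps : continuous G ->
  (forall x, `|G x| <= M) -> 0 < eps ->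
  exists m, forall y, (forall j, 0 <= y j <= 1) ->
    `|bernstein m G y - G (\row_j y j)| <= eps.
Proof.
move=> cG GM eps0.
pose cube := [set v : 'rV[R]_q | forall j, `[0, 1]%classic (v 0 j)].
have ccube : compact cube := rV_compact (fun=> @segment_compact R 0 1).
have e2 : 0 < eps / 2 by rewrite divr_gt0.
have [delta delta0 hd] := compact_uniformly_continuous ccube cG e2.
have M0 : 0 <= M by rewrite (le_trans _ (GM 0)).
pose A := 2 * M / delta ^+ 2 * q%:R.
have A0 : 0 <= A by rewrite !mulr_ge0// invr_ge0 exprn_ge0// ltW.
pose m := (Num.bound (A / (eps / 2))).+1.
have m0 : (0 : R) < m%:R by rewrite ltr0n.
have Am : A * m%:R^-1 <= eps / 2.
  rewrite ler_pdivrMr// mulrC -ler_pdivrMr//.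
  apply: (le_trans (ltW (archi_boundP (divr_ge0 A0 (ltW e2))))).
  by rewrite ler_nat.
exists m => y y01.
rewrite [X in _ - X](sum_prod_binwM m y) -sumrB.
apply: (le_trans (ler_norm_sum _ _ _)).
pose w k := \prod_j binw (y j) m ((k : {ffun 'I_q -> 'I_m.+1}) j).
pose c := 2 * M / delta ^+ 2.
have c0 : 0 <= c by rewrite !mulr_ge0// invr_ge0 exprn_ge0// ltW.
apply: (@le_trans _ _ (\sum_k (w k * (eps / 2) +
    \sum_j c * (w k * ((k j)%:R / m%:R - y j) ^+ 2)))).
  apply: ler_sum => k _; have w0 : 0 <= w k := prod_binw_ge0 k y01.
  rewrite -mulrBr normrM (ger0_norm w0).
  set x := \row_j ((k j)%:R / m%:R); set z := \row_j y j.
  have -> : \sum_j c * (w k * ((k j)%:R / m%:R - y j) ^+ 2) =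
      w k * \sum_j c * (x 0 j - z 0 j) ^+ 2.
    by rewrite mulr_sumr; apply: eq_bigr => j _; rewrite !mxE mulrCA.
  rewrite -mulrDr ler_wpM2l//.
  have t0 j : 0 <= c * (x 0 j - z 0 j) ^+ 2 by rewrite mulr_ge0// sqr_ge0.
  have [close|far] := ltP `|z - x| delta.
    have Kz : cube z by move=> j; rewrite /= in_itv/= mxE.
    by rewrite distrC ler_wpDr ?sumr_ge0// ltW//; exact: hd.
  have [ij nE] : exists ij, `|z - x| = `|(z - x) ij.1 ij.2|.
    apply: mx_norm_neq0; apply/eqP => nz; move: far; rewrite leNgt => /negP; apply.
    by rewrite [`|_|]nz.
  rewrite nE ord1 in far.
  apply: ler_wpDl; first exact: ltW.
  rewrite (bigD1 ij.2)//= ler_wpDr ?sumr_ge0//.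
  apply: (@le_trans _ _ (2 * M)).
    by rewrite (le_trans (ler_normB _ _))// mulr2n mulrDl !mul1r lerD.
  rewrite /c -mulrA ler_peMr ?mulr_ge0// mulrC ler_pdivlMr ?exprn_gt0// mul1r.
  rewrite -[leRHS]real_normK ?num_real// lerXn2r ?nnegrE ?(ltW delta0)//.
  by rewrite distrC; move: far; rewrite !mxE.
rewrite big_split/= -mulr_suml sum_prod_binw mul1r [leRHS](splitr eps) lerD2l.
rewrite exchange_big/=; apply: le_trans Am.
apply: (@le_trans _ _ (\sum_(j < q) c * m%:R^-1)).
  apply: ler_sum => j _; rewrite -mulr_sumr ler_wpM2l//.
  exact: sum_prod_binw_variance.
by rewrite sumr_const card_ord -[_ *+ q]mulr_natr mulrAC.
Qed.

End bernstein.

Section trigonometric_polynomials.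
Context {R : realType} {q : nat}.

Definition inner (a x : 'cV[R]_q) : R := (a^T *m x) 0 0.

Lemma innerE a x : inner a x = \sum_j a j 0 * x j 0.
Proof. by rewrite /inner mxE; apply: eq_bigr => j _; rewrite mxE. Qed.

Inductive trig : ('cV[R]_q -> R) -> Prop :=
| trig_cos a : trig (fun x => cos (inner a x))
| trig_sin a : trig (fun x => sin (inner a x))
| trigD f g : trig f -> trig g -> trig (fun x => f x + g x)
| trigZ c f : trig f -> trig (fun x => c * f x).

Lemma trig_ext f g : f =1 g -> trig f -> trig g.
Proof. by move=> /funext ->. Qed.

Lemma trig_cst c : trig (fun=> c).
Proof.
apply: trig_ext (trigZ c (trig_cos 0)) => x.
by rewrite innerE big1 ?cos0 ?mulr1// => j _; rewrite mxE mul0r.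
Qed.

Let innerDl a b x : inner (a + b) x = inner a x + inner b x.
Proof.
rewrite !innerE -big_split/=; apply: eq_bigr => j _.
by rewrite mxE mulrDl.
Qed.

Let innerBl a b x : inner (a - b) x = inner a x - inner b x.
Proof.
rewrite !innerE -sumrB/=; apply: eq_bigr => j _.
by rewrite !mxE mulrDl mulNr.
Qed.

Lemma trigM f g : trig f -> trig g -> trig (fun x => f x * g x).
Proof.
move=> tf tg; elim: tf => {f} [a|a|f1 f2 _ h1 _ h2|c f _ h]; last 2 first.
- by apply: trig_ext (trigD h1 h2) => x; rewrite mulrDl.
- by apply: trig_ext (trigZ c h) => x; rewrite mulrA.
- elim: tg => {g} [b|b|g1 g2 _ h1 _ h2|c g _ h]; last 2 first.
  + by apply: trig_ext (trigD h1 h2) => x; rewrite mulrDr.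
  + by apply: trig_ext (trigZ c h) => x; rewrite mulrCA.
  + apply: trig_ext (trigZ 2^-1 (trigD (trig_cos (a + b)) (trig_cos (a - b)))) => x.
    by rewrite (innerDl a b) (innerBl a b) cosD cosB; field.
  + apply: trig_ext (trigZ 2^-1 (trigD (trig_sin (a + b)) (trigZ (-1) (trig_sin (a - b))))) => x.
    by rewrite (innerDl a b) (innerBl a b) sinD sinB; field.
- elim: tg => {g} [b|b|g1 g2 _ h1 _ h2|c g _ h]; last 2 first.
  + by apply: trig_ext (trigD h1 h2) => x; rewrite mulrDr.
  + by apply: trig_ext (trigZ c h) => x; rewrite mulrCA.
  + apply: trig_ext (trigZ 2^-1 (trigD (trig_sin (a + b)) (trig_sin (a - b)))) => x.
    by rewrite (innerDl a b) (innerBl a b) sinD sinB; field.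
  + apply: trig_ext (trigZ 2^-1 (trigD (trig_cos (a - b)) (trigZ (-1) (trig_cos (a + b))))) => x.
    by rewrite (innerDl a b) (innerBl a b) cosB cosD; field.
Qed.

Lemma trig_sum (I : Type) (s : seq I) (f : I -> 'cV[R]_q -> R) :
  (forall i, trig (f i)) -> trig (fun x => \sum_(i <- s) f i x).
Proof.
move=> h; elim: s => [|i s ih].
  by apply: trig_ext (trig_cst 0) => x; rewrite big_nil.
by apply: trig_ext (trigD (h i) ih) => x; rewrite big_cons.
Qed.

Lemma trig_prod (I : Type) (s : seq I) (f : I -> 'cV[R]_q -> R) :
  (forall i, trig (f i)) -> trig (fun x => \prod_(i <- s) f i x).
Proof.
move=> h; elim: s => [|i s ih].
  by apply: trig_ext (trig_cst 1) => x; rewrite big_nil.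
by apply: trig_ext (trigM (h i) ih) => x; rewrite big_cons.
Qed.

Lemma trig_binw (y : 'cV[R]_q -> R) m i : trig y ->
  trig (fun x => binw (y x) m i).
Proof.
move=> ty; elim: m i => [i|m ih i] /=; first exact: trig_cst.
apply: trigD; first by case: i => [|i]; [exact: trig_cst|exact: trigM].
apply: trigM => //; apply: trig_ext (trigD (trig_cst 1) (trigZ (-1) ty)) => x.
by rewrite mulN1r.
Qed.

(* Bernstein polynomials in the variables y_j = (1 + sin (x_j / 2L)) / 2,
   applied to y |-> g (2L asin (2 y - 1)), where the argument of asin is
   truncated to stay away from -1 and 1; this changes nothing if |x_j| <= L. *)
Lemma trig_approx (g : 'cV[R]_q -> R) (M L eps : R) : continuous g ->
  (forall x, `|g x| <= M) -> 0 < L -> 0 < eps ->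
  exists t, [/\ trig t, forall x, `|t x| <= M &
    forall x : 'cV[R]_q, (forall j, `|x j 0| <= L) -> `|t x - g x| <= eps].
Proof.
move=> cg gM L0 eps0.
(* If |x_j| <= L, then |x_j / (2 L)| <= 1/2 and its sine lies in [[- s, s]]; as s < 1, asin is
   continuous at every clamped argument. *)
pose s : R := sin 2^-1.
have pi2 : 1 <= pi / 2 :> R := pihalf_ge1 R.
have s0 : 0 < s by apply: sin_gt0_pihalf; apply/andP; split; lra.
have L20 : 0 < 2 * L by rewrite mulr_gt0.
have s1 : s < 1.
  by rewrite -(@sin_pihalf R) ltr_sin ?in_itv/=; lra.
pose clamp (u : R) := Num.max (- s) (Num.min s u).
have clamp_bd u : - s <= clamp u <= s.
  rewrite /clamp le_max lexx/= ge_max ge_min lexx/=; lra.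
have clampE u : - s <= u <= s -> clamp u = u.
  by move=> /andP[u1 u2]; rewrite /clamp (min_idPr u2) (max_idPr u1).
have cclamp : continuous clamp.
  move=> u; apply: (@continuous_max _ _ (cst (- s)) (fun u => Num.min s u)).
    exact: cvg_cst.
  by apply: (@continuous_min _ _ (cst s) id); [exact: cvg_cst|exact: cvg_id].
pose G (y : 'rV[R]_q) : R := g (\col_j (2 * L * asin (clamp (2 * y 0 j - 1)))).
have cG : continuous G.
  move=> y; apply: continuous_comp; last exact: cg.
  apply: continuous_mx => i j.
  rewrite (_ : (fun t => _) = fun t : 'rV[R]_q => 2 * L * asin (clamp (2 * t 0 i - 1))); last first.
    by apply/funext => t; rewrite mxE.
  have c1 : continuous (fun t : 'rV[R]_q => 2 * t 0 i - 1).
    move=> z; have h := @coord_continuous R 1 q 0 i z.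
    exact: (cvgB (cvgM (cvg_cst (2 : R)) h) (cvg_cst (1 : R))).
  have c2 : {for clamp (2 * y 0 i - 1), continuous (@asin R)}.
    apply: continuous_asin; have /andP[h1 h2] := clamp_bd (2 * y 0 i - 1).
    by rewrite (lt_le_trans _ h1) ?ltrN2// (le_lt_trans h2).
  have c3 := continuous_comp (c1 y) (cclamp _).
  exact: (cvgM (cvg_cst (2 * L)) (continuous_comp c3 c2)).
have GM y : `|G y| <= M by exact: gM.
have [m hm] := bernstein_approx cG GM eps0.
pose y (x : 'cV[R]_q) j := (1 + sin (x j 0 / (2 * L))) / 2.
have y01 x j : 0 <= y x j <= 1.
  by rewrite /y; have := sin_geN1 (x j 0 / (2 * L)); have := sin_le1 (x j 0 / (2 * L)); lra.
exists (fun x => bernstein m G (y x)); split.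
- rewrite /bernstein; apply: trig_sum => k; apply: trigM; last exact: trig_cst.
  apply: trig_prod => j; apply: trig_binw.
  apply: trig_ext (trigZ 2^-1 (trigD (trig_cst 1) (trig_sin ((2 * L)^-1 *: delta_mx j 0)))) => x.
  rewrite /y mulrC; congr ((1 + sin _) / 2); rewrite innerE (bigD1 j)//= big1 ?addr0.
    by rewrite !mxE !eqxx mulr1 mulrC.
  by move=> i ij; rewrite !mxE (negbTE ij) mulr0 mul0r.
- by move=> x; exact: bernstein_bounded.
- move=> x xL; have := hm (y x) (y01 x).
  rewrite {2}/G (_ : \col_j _ = x)//.
  apply/colP => j; rewrite !mxE.
  have -> : 2 * y x j - 1 = sin (x j 0 / (2 * L)) by rewrite /y; field.
  have xL1 : - 2^-1 <= x j 0 / (2 * L) <= 2^-1.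
    rewrite -ler_norml normrM normfV (gtr0_norm L20) ler_pdivrMr//.
    by rewrite (le_trans (xL j))// mulrA mulVf ?mul1r// pnatr_eq0.
  have mono (u v : R) : - 2^-1 <= u <= 2^-1 -> - 2^-1 <= v <= 2^-1 -> u <= v -> sin u <= sin v.
    move=> u1 v1; rewrite le_eqVlt => /predU1P[->//|uv].
    by apply/ltW; rewrite ltr_sin ?in_itv/=; lra.
  rewrite clampE; last first.
    rewrite /s -sinN; apply/andP; split; apply: mono => //; lra.
  rewrite sinK ?in_itv/=; last lra.
  by rewrite mulrCA mulfV ?mulr1// gt_eqF.
Qed.

End trigonometric_polynomials.

Section weak_convergence.
Context {R : realType} {q : nat}.

Section measurability.
Context d (Omega : measurableType d) (Y : Omega -> 'cV[R]_q).
Hypothesis mY : random_vector Y.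

Lemma inner_measurable a : measurable_fun setT (fun w => inner a (Y w)).
Proof.
rewrite (_ : (fun _ => _) = fun w => \sum_j a j 0 * Y w j 0).
  by apply: measurable_sum => j; exact: measurable_funM.
by apply/funext => w; rewrite innerE.
Qed.

Lemma trig_measurable t : trig t -> measurable_fun setT (fun w => t (Y w)).
Proof.
elim=> [a|a|f g _ mf _ mg|c f _ mf].
- apply: (measurableT_comp _ (inner_measurable a)).
  by apply: continuous_measurable_fun; exact: continuous_cos.
- apply: (measurableT_comp _ (inner_measurable a)).
  by apply: continuous_measurable_fun; exact: continuous_sin.
- exact: measurable_funD.
- exact: measurable_funM.
Qed.

Definition outside (L : R) : set Omega := [set w | exists j, L < `|Y w j 0|].

Lemma measurable_outside L : measurable (outside L).
Proof.
rewrite (_ : outside L = \bigcup_(j in [set: 'I_q]) ((fun w => Y w j 0) @^-1` [set x | L < `|x|])).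
  apply: fin_bigcup_measurable => //
  j _; rewrite -[X in measurable X]setTI; apply: mY => //.
  rewrite (_ : [set x | _] = (fun x : R => `|x|) @^-1` `]L, +oo[%classic).
    by rewrite -[X in measurable X]setTI; exact: normr_measurable.
  by apply/seteqP; split=> x /=; rewrite in_itv/= andbT.
by apply/seteqP; split=> [w [j Lj]|w [j _ Lj]]; exists j.
Qed.

(** Measurability of [Y] is given coordinatewise. On each event where [Y] lies in a cube, g (Y w) is
    a pointwise limit of trigonometric polynomials in [Y], which are measurable by construction, and
    these events exhaust the space. *)
Lemma random_vector_comp_measurable (g : 'cV[R]_q -> R) M : continuous g ->
  (forall x, `|g x| <= M) -> measurable_fun setT (fun w => g (Y w)).
Proof.
move=> cg gM.
have -> : [set: Omega] = \bigcup_n ~` outside n.+1%:R.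
  apply/seteqP; split=> // w _.
  pose n := Num.bound (\sum_j `|Y w j 0|); exists n => // -[j].
  apply/negP; rewrite -leNgt (@le_trans _ _ (\sum_j `|Y w j 0|))//.
    by rewrite (bigD1 j)//= lerDl sumr_ge0.
  rewrite (le_trans (ltW (archi_boundP _))) ?sumr_ge0//.
  by rewrite ler_nat /n ltnW.
apply/measurable_fun_bigcup => n; first exact/measurableC/measurable_outside.
have L0 : (0 : R) < n.+1%:R by [].
have e0 m : (0 : R) < m.+1%:R^-1 by rewrite invr_gt0.
pose t m := projT1 (cid (trig_approx cg gM L0 (e0 m))).
have tP m : [/\ trig (t m), forall x, `|t m x| <= M &
    forall x : 'cV[R]_q, (forall j, `|x j 0| <= n.+1%:R) -> `|t m x - g x| <= m.+1%:R^-1].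
  exact: (projT2 (cid (trig_approx cg gM L0 (e0 m)))).
apply: (@measurable_fun_cvg _ _ _ _ (fun m w => t m (Y w))).
  by move=> m; have [/trig_measurable/measurable_funTS + _ _] := tP m; exact.
move=> w wn; apply/cvgrPdist_le => e ep; near=> m.
have [_ _ h] := tP m; rewrite distrC (le_trans (h (Y w) _))//.
  by move=> j; rewrite leNgt; apply/negP => Lj; apply: wn; exists j.
near: m; have /cvgrPdist_le/(_ _ ep)[N _ hN] := @cvg_harmonic R.
by exists N => // m /hN/=; rewrite sub0r normrN ger0_norm.
Unshelve. all: by end_near. Qed.

End measurability.

Lemma mean_is_indic d (Omega : measurableType d) (P : probability Omega R)
  (A : set Omega) : measurable A -> mean_is P (\1_A : Omega -> R) (fine (P A)).
Proof.
move=> mA; apply: mean_is_fine => //.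
  by rewrite integral_indic// setIT fineK// fin_num_measure.
Qed.

Lemma test_function_error d (Omega : measurableType d) (P : probability Omega R)
    (Y : Omega -> 'cV[R]_q) (g t : 'cV[R]_q -> R) (M L eps : R) :
  random_vector Y -> continuous g -> trig t ->
  (forall x, `|g x| <= M) -> (forall x, `|t x| <= M) ->
  (forall x : 'cV[R]_q, (forall j, `|x j 0| <= L) -> `|t x - g x| <= eps) ->
  0 <= eps ->
  `|\int[P]_w t (Y w) - \int[P]_w g (Y w)| <= eps + 2 * M * fine (P (outside Y L)).
Proof.
move=> mY cg tt gM tM tg eps0.
have hg := mean_isP (integrable_bounded P (random_vector_comp_measurable mY cg gM)
  (fun w => gM (Y w))).
have ht := mean_isP (integrable_bounded P (trig_measurable mY tt) (fun w => tM (Y w))).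
have M0 : 0 <= M by rewrite (le_trans _ (gM 0)).
apply: mean_is_norm_le (mean_isB ht hg) (mean_isD (mean_is_cst P eps)
  (mean_isZ (2 * M) (mean_is_indic P (measurable_outside mY L)))) => w.
have [out|inn] := pselect (outside Y L w).
  rewrite indicE mem_set// mulr1 ler_wpDl//.
  by rewrite (le_trans (ler_normB _ _))// mulr2n mulrDl !mul1r lerD.
rewrite indicE memNset// mulr0 addr0; apply: tg => j.
by rewrite leNgt; apply/negP => Lj; apply: inn; exists j.
Qed.

(* Trigonometric polynomials form an algebra that approximates bounded continuous
   functions uniformly on cubes, so tightness upgrades the convergence of
   characteristic functions to weak convergence. *)
Lemma weak_cvg_trig d (Omega : measurableType d) (P : probability Omega R)
    d' (Omega' : measurableType d') (P' : probability Omega' R)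
    (Y : nat -> Omega -> 'cV[R]_q) (Z : Omega' -> 'cV[R]_q) :
  (forall n, random_vector (Y n)) -> random_vector Z ->
  (forall a, \int[P]_w cos (inner a (Y n w)) @[n --> \oo] -->
    \int[P']_w cos (inner a (Z w))) ->
  (forall a, \int[P]_w sin (inner a (Y n w)) @[n --> \oo] -->
    \int[P']_w sin (inner a (Z w))) ->
  (forall eps : R, 0 < eps -> exists2 L : R, 0 < L &
     (\forall n \near \oo, fine (P (outside (Y n) L)) <= eps) /\
     fine (P' (outside Z L)) <= eps) ->
  forall g : 'cV[R]_q -> R, continuous g -> (exists M, forall x, `|g x| <= M) ->
    ('E_P[fun w => g (Y n w)] @[n --> \oo] --> 'E_P'[fun w => g (Z w)])%E.
Proof.
move=> mY mZ hcos hsin tight g cg [M gM].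
have ig n := integrable_bounded P (random_vector_comp_measurable (mY n) cg gM)
  (fun w => gM (Y n w)).
have igZ := integrable_bounded P' (random_vector_comp_measurable mZ cg gM)
  (fun w => gM (Z w)).
have trig_bd (t : 'cV[R]_q -> R) : trig t -> exists N, forall x, `|t x| <= N.
  elim=> [a|a|f1 f2 _ [N1 h1] _ [N2 h2]|c f1 _ [N1 h1]].
  - by exists 1 => x; exact: cos_max.
  - by exists 1 => x; exact: sin_max.
  - by exists (N1 + N2) => x; rewrite (le_trans (ler_normD _ _))// lerD.
  - by exists (`|c| * N1) => x; rewrite normrM ler_wpM2l.
have trig_cvg (t : 'cV[R]_q -> R) : trig t ->
    \int[P]_w t (Y n w) @[n --> \oo] --> \int[P']_w t (Z w).
  elim=> [a|a|f1 f2 t1 h1 t2 h2|c f1 t1 h1]; [exact: hcos|exact: hsin| |].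
  - have [N1 b1] := trig_bd _ t1; have [N2 b2] := trig_bd _ t2.
    have i1 n := integrable_bounded P (trig_measurable (mY n) t1) (fun w => b1 (Y n w)).
    have i2 n := integrable_bounded P (trig_measurable (mY n) t2) (fun w => b2 (Y n w)).
    have j1 := integrable_bounded P' (trig_measurable mZ t1) (fun w => b1 (Z w)).
    have j2 := integrable_bounded P' (trig_measurable mZ t2) (fun w => b2 (Z w)).
    rewrite RintegralD//; under eq_fun do rewrite RintegralD//.
    exact: cvgD.
  - have [N1 b1] := trig_bd _ t1.
    have i1 n := integrable_bounded P (trig_measurable (mY n) t1) (fun w => b1 (Y n w)).
    have j1 := integrable_bounded P' (trig_measurable mZ t1) (fun w => b1 (Z w)).
    rewrite RintegralZl//; under eq_fun do rewrite RintegralZl//.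
    exact: cvgMl_tmp.
rewrite unlock -[X in _ --> X]EFin_Rintegral//.
under eq_fun do rewrite -EFin_Rintegral//.
apply: cvg_EFin; first by near=> n.
rewrite /comp/=.
apply/cvgrPdist_le => e e0.
have M0 : 0 <= M by rewrite (le_trans _ (gM 0)).
(* Five errors: for each of the two laws, the approximation on the cube and the mass outside it, and
   then the convergence for [t]. The 1 in 2 M + 1 covers M = 0. *)
have e10 : 0 < e / 5 by rewrite divr_gt0.
have M10 : 0 < 2 * M + 1 by lra.
have [L L0 [tY tZ]] := tight (e / 5 / (2 * M + 1)) (divr_gt0 e10 M10).
have [t [tt tM tg]] := trig_approx cg gM L0 e10.
have errle x : 0 <= x -> x <= e / 5 / (2 * M + 1) -> 2 * M * x <= e / 5.
  move=> x0; rewrite ler_pdivlMr// => h; rewrite (le_trans _ h)// mulrC ler_wpM2l//.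
  by rewrite lerDl.
have eZ := test_function_error P' mZ cg tt gM tM tg (ltW e10).
have := errle _ (fine_ge0 (measure_ge0 P' _)) tZ => eZ'.
have /cvgrPdist_le/(_ _ e10) tc := trig_cvg t tt.
near=> n.
have eY := test_function_error P (mY n) cg tt gM tM tg (ltW e10).
have tYn : fine (P (outside (Y n) L)) <= e / 5 / (2 * M + 1) by near: n.
have := errle _ (fine_ge0 (measure_ge0 P _)) tYn => eY'.
have tcn : `|\int[P']_w t (Z w) - \int[P]_w t (Y n w)| <= e / 5 by near: n.
move: eZ eY tcn; rewrite !ler_norml.
set a := \int[P']_w t (Z w); set b := \int[P]_w t (Y n w).
set c := \int[P']_w g (Z w); set d0 := \int[P]_w g (Y n w).
move=> /andP[? ?] /andP[? ?] /andP[? ?].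
by apply/andP; split; lra.
Unshelve. all: by end_near. Qed.

End weak_convergence.

(** * Minimum contrast estimation *)

Section matrix_norm1.
Context {R : realType}.

(** The entrywise l1 norm: it bounds every entry and is submultiplicative for rectangular matrices,
    so products are estimated without dimensional constants. *)
Definition nrm1 (m n : nat) (M : 'M[R]_(m, n)) : R := \sum_i \sum_j `|M i j|.

Lemma nrm1_ge0 m n (M : 'M[R]_(m, n)) : 0 <= nrm1 M.
Proof. by apply: sumr_ge0 => i _; apply: sumr_ge0. Qed.

Lemma nrm1_0 m n : nrm1 (0 : 'M[R]_(m, n)) = 0.
Proof. by rewrite /nrm1 big1// => i _; rewrite big1// => j _; rewrite mxE normr0. Qed.

Lemma nrm1D m n (M N : 'M[R]_(m, n)) : nrm1 (M + N) <= nrm1 M + nrm1 N.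
Proof.
rewrite -big_split ler_sum// => i _; rewrite -big_split ler_sum// => j _.
by rewrite mxE ler_normD.
Qed.

Lemma nrm1N m n (M : 'M[R]_(m, n)) : nrm1 (- M) = nrm1 M.
Proof. by apply: eq_bigr => i _; apply: eq_bigr => j _; rewrite mxE normrN. Qed.

Lemma nrm1B m n (M N : 'M[R]_(m, n)) : nrm1 (M - N) <= nrm1 M + nrm1 N.
Proof. by rewrite (le_trans (nrm1D _ _))// nrm1N. Qed.

Lemma nrm1Z m n (c : R) (M : 'M[R]_(m, n)) : nrm1 (c *: M) = `|c| * nrm1 M.
Proof.
rewrite /nrm1 mulr_sumr; apply: eq_bigr => i _; rewrite mulr_sumr.
by apply: eq_bigr => j _; rewrite mxE normrM.
Qed.

Lemma nrm1_tr m n (M : 'M[R]_(m, n)) : nrm1 M^T = nrm1 M.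
Proof.
rewrite /nrm1 exchange_big; apply: eq_bigr => i _; apply: eq_bigr => j _.
by rewrite mxE.
Qed.

Lemma entry_nrm1_le m n (M : 'M[R]_(m, n)) i j : `|M i j| <= nrm1 M.
Proof.
rewrite /nrm1 (bigD1 i)//= (bigD1 j)//= -addrA lerDl addr_ge0//.
  exact: sumr_ge0.
by apply: sumr_ge0 => ? _; exact: sumr_ge0.
Qed.

Lemma nrm1M m n p (M : 'M[R]_(m, n)) (N : 'M[R]_(n, p)) : nrm1 (M *m N) <= nrm1 M * nrm1 N.
Proof.
rewrite /nrm1 mulr_suml ler_sum// => i _.
apply: (@le_trans _ _ (\sum_j \sum_k `|M i k| * `|N k j|)).
  apply: ler_sum => j _; rewrite mxE (le_trans (ler_norm_sum _ _ _))//.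
  by apply: ler_sum => k _; rewrite normrM.
rewrite exchange_big mulr_suml ler_sum// => k _; rewrite -mulr_sumr ler_wpM2l//.
rewrite (bigD1 k)//= lerDl; apply: sumr_ge0 => ? _; exact: sumr_ge0.
Qed.

Lemma nrm1_eq0 m n (M : 'M[R]_(m, n)) : nrm1 M = 0 -> M = 0.
Proof.
move=> M0; apply/matrixP => i j; rewrite mxE; apply/eqP.
by rewrite -normr_le0 -M0 entry_nrm1_le.
Qed.

Lemma norm_le_nrm1 m n (M : 'M[R]_(m, n)) : `|M| <= nrm1 M.
Proof.
rewrite [leLHS]mx_normrE; apply: bigmax_le; first exact: nrm1_ge0.
by move=> ij _; exact: entry_nrm1_le.
Qed.

Definition quad n (M : 'M[R]_n) (u w : 'cV[R]_n) : R := (u^T *m M *m w) 0 0.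

Lemma quad_le n (M : 'M[R]_n) u w : `|quad M u w| <= nrm1 M * (nrm1 u * nrm1 w).
Proof.
rewrite (le_trans (entry_nrm1_le _ _ _))// (le_trans (nrm1M _ _))//.
rewrite mulrA ler_wpM2r ?nrm1_ge0// (le_trans (nrm1M _ _))//.
by rewrite nrm1_tr mulrC.
Qed.

Lemma quadDl n (M : 'M[R]_n) u v w : quad M (u + v) w = quad M u w + quad M v w.
Proof. by rewrite /quad raddfD !mulmxDl mxE. Qed.
Lemma quadDr n (M : 'M[R]_n) u v w : quad M u (v + w) = quad M u v + quad M u w.
Proof. by rewrite /quad mulmxDr mxE. Qed.
Lemma quadNl n (M : 'M[R]_n) u w : quad M (- u) w = - quad M u w.
Proof. by rewrite /quad raddfN !mulNmx mxE. Qed.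
Lemma quadNr n (M : 'M[R]_n) u w : quad M u (- w) = - quad M u w.
Proof. by rewrite /quad mulmxN mxE. Qed.
Lemma quadZl n (M : 'M[R]_n) c u w : quad M (c *: u) w = c * quad M u w.
Proof. by rewrite /quad linearZ /= -!scalemxAl mxE. Qed.
Lemma quadZr n (M : 'M[R]_n) c u w : quad M u (c *: w) = c * quad M u w.
Proof. by rewrite /quad -scalemxAr mxE. Qed.
Lemma quadB n (M N : 'M[R]_n) u w : quad (M - N) u w = quad M u w - quad N u w.
Proof. by rewrite /quad mulmxBr mulmxBl !mxE. Qed.
Lemma quad_sub n (M : 'M[R]_n) y r : quad M (y - r) (y - r) =
  quad M y y + (quad M r r - quad M y r - quad M r y).
Proof. by rewrite !quadDl !quadDr !quadNl !quadNr; ring. Qed.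
Lemma quad_tr n (M : 'M[R]_n) u w : quad M^T u w = quad M w u.
Proof.
rewrite /quad -[in RHS](trmxK (w^T *m M *m u)) [in RHS]mxE.
by rewrite !trmx_mul trmxK mulmxA.
Qed.

Definition posdef n (M : 'M[R]_n) := M^T = M /\ forall u, u != 0 -> 0 < quad M u u.

Lemma posdef_ge0 n (M : 'M[R]_n) u : posdef M -> 0 <= quad M u u.
Proof.
move=> [_ Mp]; have [->|u0] := eqVneq u 0; last exact/ltW/Mp.
by rewrite /quad mulmx0 mxE.
Qed.

Lemma posdef_unit n (M : 'M[R]_n) : posdef M -> M \in unitmx.
Proof.
move=> [_ Mp]; rewrite -row_free_unit; apply: inj_row_free => v vM.
apply/eqP; rewrite -trmx_eq0; apply: contraT => v0.
by have := Mp _ v0; rewrite /quad trmxK vM mul0mx mxE ltxx.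
Qed.

Lemma posdef_inv n (M : 'M[R]_n) : posdef M -> posdef (invmx M).
Proof.
move=> Mp; have uM := posdef_unit Mp; have [Ms M0] := Mp.
split=> [|u u0]; first by rewrite trmx_inv Ms.
have e : u = M *m (invmx M *m u) by rewrite mulKVmx.
have : invmx M *m u != 0.
  by apply: contra_neq u0 => z; rewrite e z mulmx0.
move=> /M0; rewrite /quad trmx_mul trmx_inv Ms -!mulmxA.
by rewrite (mulmxA M) mulmxV// mul1mx.
Qed.

Lemma cauchy_schwarz n (M : 'M[R]_n) u w : posdef M ->
  quad M u w ^+ 2 <= quad M u u * quad M w w.
Proof.
move=> Mp; have [Ms _] := Mp.
have sym : quad M w u = quad M u w by rewrite -quad_tr Ms.
have [->|w0] := eqVneq w 0.
  by rewrite /quad !mulmx0 !mxE expr0n/= mulr0.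
have ww : 0 < quad M w w by have [_] := Mp; exact.
set a := quad M w w in ww *; set b := quad M u w in sym *.
have := posdef_ge0 (u - (b / a) *: w) Mp.
rewrite quadDl !quadDr !quadNl !quadNr !quadZl !quadZr sym -/a -/b.
have -> : quad M u u + - (b / a * b) + (- (b / a * b) - - (b / a * (b / a * a))) =
    quad M u u - b ^+ 2 / a by field; rewrite gt_eqF.
by rewrite subr_ge0 ler_pdivrMr.
Qed.

Lemma nrm1_sqr_le n (u : 'cV[R]_n) : nrm1 u ^+ 2 <= n%:R * quad 1%:M u u.
Proof.
have -> : nrm1 u = \sum_i `|u i 0|.
  by apply: eq_bigr => i _; rewrite big_ord1.
have -> : quad 1%:M u u = \sum_i `|u i 0| ^+ 2.
  rewrite /quad mulmx1 mxE; apply: eq_bigr => i _.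
  by rewrite mxE -expr2 real_normK ?num_real.
have := sqr_sum_le (index_enum 'I_n) (fun i => `|u i 0|).
have -> : size (index_enum 'I_n) = n.
  by rewrite -sum1_size sum1_card card_ord.
by [].
Qed.

(* (u.u)^2 <= (u.M u) (u.M^-1 u), by Cauchy-Schwarz for M applied to u and M^-1 u. *)
Lemma posdef_lower_bound n (M : 'M[R]_n) u : posdef M ->
  nrm1 u ^+ 2 <= n%:R ^+ 2 * nrm1 (invmx M) * quad M u u.
Proof.
move=> Mp; have uM := posdef_unit Mp; have [Ms _] := Mp.
have [u0|u0] := eqVneq (nrm1 u) 0.
  by rewrite u0 expr0n/= !mulr_ge0 ?nrm1_ge0 ?exprn_ge0 ?posdef_ge0.
have un : 0 < nrm1 u by rewrite lt_neqAle eq_sym u0 nrm1_ge0.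
have e1 : quad M u (invmx M *m u) = quad 1%:M u u.
  by rewrite /quad mulmx1 -mulmxA mulKVmx.
have e2 : quad M (invmx M *m u) (invmx M *m u) = quad (invmx M) u u.
  rewrite /quad trmx_mul trmx_inv Ms -!mulmxA.
  by rewrite (mulmxA M) mulmxV// mul1mx.
have := cauchy_schwarz u (invmx M *m u) Mp; rewrite e1 e2 => cs.
have qi : quad (invmx M) u u <= nrm1 (invmx M) * nrm1 u ^+ 2.
  by rewrite (le_trans (ler_norm _))// (le_trans (quad_le _ _ _))// expr2.
have h : nrm1 u ^+ 2 * nrm1 u ^+ 2 <=
    n%:R ^+ 2 * nrm1 (invmx M) * quad M u u * nrm1 u ^+ 2.
  rewrite -expr2 (@le_trans _ _ ((n%:R * quad 1%:M u u) ^+ 2))//.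
    rewrite lerXn2r ?nnegrE ?sqr_ge0 ?nrm1_sqr_le//.
    by rewrite (le_trans _ (nrm1_sqr_le u))// sqr_ge0.
  have h1 : quad 1%:M u u ^+ 2 <= nrm1 (invmx M) * quad M u u * nrm1 u ^+ 2.
    rewrite (le_trans cs)// (mulrC (nrm1 _)) -mulrA ler_wpM2l//.
    exact: posdef_ge0.
  by rewrite exprMn -2![in leRHS]mulrA ler_wpM2l ?sqr_ge0// mulrA.
by rewrite -(@ler_pM2r _ (nrm1 u ^+ 2)) ?exprn_gt0.
Qed.

End matrix_norm1.

Section minimum_contrast.
Context {R : realType} {q m : nat}.
Variables (Theta : set 'cV[R]_q) (th0 : 'cV[R]_q).
Variables (s : 'cV[R]_q -> 'cV[R]_m) (W : 'cV[R]_q -> 'M[R]_m) (D : 'M[R]_(m, q)).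
Hypothesis cTheta : compact Theta.
Hypothesis th0_int : (Theta°) th0.
Hypothesis s_cont : forall i, continuous (fun t => s t i 0).
Hypothesis W_cont : forall i j, continuous (fun t => W t i j).
Hypothesis s_diff : forall eps : R, 0 < eps -> exists2 delta : R, 0 < delta &
  forall t, nrm1 t < delta -> nrm1 (s (th0 + t) - s th0 - D *m t) <= eps * nrm1 t.
Hypothesis W_posdef : forall t, Theta t -> posdef (W t).
Hypothesis ident : forall t, Theta t -> s t = s th0 -> t = th0.
Hypothesis D_inj : forall t : 'cV[R]_q, D *m t = 0 -> t = 0.

Let Th0 : Theta th0. Proof. exact: interior_subset th0_int. Qed.
Let V t := invmx (W t).
Let V0 := V th0.
Let V0_posdef : posdef V0. Proof. exact/posdef_inv/W_posdef. Qed.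
Let V_posdef t : Theta t -> posdef (V t). Proof. by move=> ?; exact/posdef_inv/W_posdef. Qed.
Let H := D^T *m V0 *m D.

Let quadH t u : quad H t u = quad V0 (D *m t) (D *m u).
Proof. by rewrite /quad /H trmx_mul !mulmxA. Qed.

Lemma gram_posdef : posdef H.
Proof.
split=> [|t t0].
  by have [e _] := V0_posdef; rewrite /H !trmx_mul trmxK e mulmxA.
rewrite quadH; have [_] := V0_posdef; apply.
by apply: contra_neq t0; exact: D_inj.
Qed.

(** Generalised least squares: [mc_lin *m v] minimises the quadratic model t |-> quad V0 (v - D t)
    (v - D t); see [quad_min]. *)
Definition mc_lin := invmx H *m D^T *m V0.

Lemma mc_linK (t : 'cV[R]_q) : mc_lin *m (D *m t) = t.
Proof.
rewrite /mc_lin -!mulmxA (_ : D^T *m (V0 *m (D *m t)) = H *m t).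
  by rewrite mulKmx// posdef_unit//; exact: gram_posdef.
by rewrite /H !mulmxA.
Qed.

Definition mc_contrast (x : 'cV[R]_m) t := quad (V t) (x - s t) (x - s t).

Let near_ball : exists2 rho : R, 0 < rho & forall t, nrm1 t < rho -> Theta (th0 + t).
Proof.
have /nbhs_ballP[rho /= rho0 hrho] := th0_int.
exists rho => // t tr; apply: hrho; rewrite -ball_normE/= opprD addNKr normrN.
exact: le_lt_trans (norm_le_nrm1 _) tr.
Qed.

Let cont_nrm1 n1 n2 (f : 'cV[R]_q -> 'M[R]_(n1, n2)) :
  (forall i j, continuous (fun t => f t i j)) -> continuous (fun t => nrm1 (f t)).
Proof.
move=> cf; apply: continuous_sumr => i; apply: continuous_sumr => j t.
exact: (cvg_norm (cf i j t)).
Qed.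

Let cont_entryB n1 n2 (f : 'cV[R]_q -> 'M[R]_(n1, n2)) c i j :
  continuous (fun t => f t i j) -> continuous (fun t => (f t - c) i j).
Proof.
move=> cf t; rewrite (_ : (fun t => _) = fun t => f t i j - c i j).
  exact: (cvgB (cf t) (cvg_cst _)).
by apply/funext => u; rewrite !mxE.
Qed.

Let W_bounded : exists2 C : R, 0 <= C & forall t, Theta t -> nrm1 (W t) <= C.
Proof.
have ne : Theta !=set0 by exists th0.
have [c _ hc] := compact_EVT_max ne cTheta (continuous_subspaceT (cont_nrm1 W_cont)).
exists (nrm1 (W c)); first exact: nrm1_ge0.
by move=> t /mem_set /hc.
Qed.

(** With d = W (th0 + t) - W th0 and V taken at th0 + t, one has V - V0 = - V0 d V0 - (V - V0) d V0.
    For small d the last term is absorbed on the left. *)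
Let V_cont (eps : R) : 0 < eps -> exists2 delta : R, 0 < delta &
  forall t, nrm1 t < delta -> nrm1 (V (th0 + t) - V0) <= eps.
Proof.
move=> eps0.
have [rho rho0 hrho] := near_ball.
set a := nrm1 V0; have a0 : 0 <= a by exact: nrm1_ge0.
(* The first bound makes a nrm1 d at most 1/2, so absorption costs a factor 2; the second then gives
   2 a^2 nrm1 d <= eps. The added 1 avoids dividing by zero. *)
pose e := Num.min (2^-1 / (a + 1)) (eps / (2 * a ^+ 2 + 1)).
have a1 : 0 < a + 1 by lra.
have a21 : 0 < 2 * a ^+ 2 + 1 by rewrite ltr_wpDl// mulr_ge0// sqr_ge0.
have e0 : 0 < e by rewrite lt_min !divr_gt0.
have cW : continuous (fun t => nrm1 (W t - W th0)).
  by apply: cont_nrm1 => i j; apply: cont_entryB.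
have /cvgrPdist_lt/(_ _ e0)/nbhs_ballP[r /= r0 hr] := cW th0.
exists (Num.min r rho); first by rewrite lt_min r0.
move=> t; rewrite lt_min => /andP[tr trho].
have := hr (th0 + t); rewrite -ball_normE/= opprD addNKr normrN.
move=> /(_ (le_lt_trans (norm_le_nrm1 _) tr)).
rewrite subrr nrm1_0 sub0r normrN ger0_norm ?nrm1_ge0// => /ltW.
set d := W (th0 + t) - W th0 => hd.
have uW := posdef_unit (W_posdef (hrho _ trho)).
have uW0 := posdef_unit (W_posdef Th0).
have e1 : V (th0 + t) - V0 = - (V0 *m d *m V0) - (V (th0 + t) - V0) *m d *m V0.
  have Ve : V (th0 + t) *m d *m V0 = V0 - V (th0 + t).
    by rewrite /d mulmxBr mulmxBl mulVmx// mul1mx -mulmxA mulmxV// mulmx1.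
  rewrite !mulmxBl Ve; move: (V0 *m d *m V0) => A.
  by rewrite opprB opprB addKr.
set x := nrm1 (V (th0 + t) - V0).
have x0 : 0 <= x by exact: nrm1_ge0.
have d0 : 0 <= nrm1 d by exact: nrm1_ge0.
have h1 : x <= a * nrm1 d * a + x * nrm1 d * a.
  rewrite {1}/x e1 (le_trans (nrm1B _ _))// nrm1N lerD//.
  - by rewrite (le_trans (nrm1M _ _))// ler_wpM2r// nrm1M.
  - by rewrite (le_trans (nrm1M _ _))// ler_wpM2r// nrm1M.
have := hd; rewrite le_min => /andP[hd1 hd2].
have da : nrm1 d * a <= 2^-1.
  rewrite ler_pdivlMr// in hd1; nra.
have xa : x <= 2 * (a * nrm1 d * a) by nra.
rewrite (le_trans xa)//; rewrite ler_pdivlMr// in hd2; nra.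
Qed.

(** On the compact set of parameters at distance at least [rho] from [th0], the continuous function
    nrm1 (s t - s th0) attains its minimum, which is positive by identifiability. *)
Let separation (rho : R) : 0 < rho -> exists2 eta : R, 0 < eta &
  forall t, Theta t -> nrm1 (s t - s th0) < eta -> nrm1 (t - th0) < rho.
Proof.
move=> rho0.
have cs : continuous (fun t => nrm1 (s t - s th0)).
  by apply: cont_nrm1 => i j; rewrite ord1; apply: cont_entryB.
have ct : continuous (fun t : 'cV[R]_q => nrm1 (t - th0)).
  apply: cont_nrm1 => i j; apply: (@cont_entryB _ _ id) => t.
  exact: coord_continuous.
pose K := Theta `&` (fun t => nrm1 (t - th0)) @^-1` `[rho, +oo[%classic.
have cK : compact K.
  apply: compact_closedI => //; apply: preimage_closed => //.
  exact: interval_closed.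
have [K0|/set0P K0] := eqVneq K set0.
  exists 1 => // t Tt _; rewrite ltNge; apply/negP => ht.
  have : K t by split => //=; rewrite in_itv/= andbT.
  by rewrite K0.
have [c /set_mem[Tc /=] hc hmin] := compact_EVT_min K0 cK (continuous_subspaceT cs).
rewrite in_itv/= andbT in hc.
exists (nrm1 (s c - s th0)).
  rewrite lt_neqAle nrm1_ge0 andbT eq_sym; apply/eqP => /nrm1_eq0/eqP.
  rewrite subr_eq0 => /eqP/(ident Tc) cE.
  by move: hc; rewrite cE subrr nrm1_0 leNgt rho0.
move=> t Tt; apply: contraTT; rewrite -!leNgt => ht.
by apply: hmin; apply/mem_set; split => //=; rewrite in_itv/= andbT.
Qed.

(** The exact residual is y - r, with y = v - D t and r the Taylor remainder of [s]. Replacing the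
    weight by [V0] and dropping r each cost o(nrm1 v ^+ 2), as long as t is of the order of v. *)
Let approx (C eps : R) : 0 <= C -> 0 < eps -> exists2 rho : R, 0 < rho &
  forall v t, nrm1 t < rho -> nrm1 t <= C * nrm1 v ->
    Theta (th0 + t) /\
    `|mc_contrast (s th0 + v) (th0 + t) - quad V0 (v - D *m t) (v - D *m t)|
      <= eps * nrm1 v ^+ 2.
Proof.
move=> C0 eps0; pose A := nrm1 V0; pose B := 1 + nrm1 D * C.
have A0 : 0 <= A by exact: nrm1_ge0.
have B0 : 0 <= B by rewrite addr_ge0// mulr_ge0// nrm1_ge0.
(* B + C bounds the exact residual relative to v, and its square comes from the change of weight;
   the term with [A] comes from the expansion in r. *)
pose E := (B + C) ^+ 2 + A * (2 * (B * C) + C ^+ 2).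
have E0 : 0 <= E.
  by rewrite addr_ge0 ?sqr_ge0// mulr_ge0// addr_ge0 ?sqr_ge0// !mulr_ge0.
pose e := Num.min 1 (eps / (E + 1)).
have E1 : 0 < E + 1 by lra.
have e0 : 0 < e by rewrite lt_min ltr01 divr_gt0.
have e1 : e <= 1 by rewrite ge_min lexx.
have eE : e * E <= eps.
  have : e <= eps / (E + 1) by rewrite ge_min lexx orbT.
  by rewrite ler_pdivlMr//; nra.
have [r1 r10 h1] := s_diff e0; have [r2 r20 h2] := V_cont e0.
have [r3 r30 h3] := near_ball.
exists (Num.min r1 (Num.min r2 r3)); first by rewrite !lt_min r10 r20.
move=> v t; rewrite !lt_min => /and3P[/h1 rt /h2 Vt /h3 Tt] tv.
split => //.
set r := s (th0 + t) - s th0 - D *m t in rt.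
pose y := v - D *m t; pose u := y - r.
have -> : mc_contrast (s th0 + v) (th0 + t) = quad (V (th0 + t)) u u.
  rewrite /mc_contrast (_ : s th0 + v - s (th0 + t) = u)//.
  rewrite /u /y /r; move: (s (th0 + t)) (s th0) (D *m t) => a b X.
  by apply/colP => i; rewrite !mxE; ring.
have vv := nrm1_ge0 v; have yy := nrm1_ge0 y; have rr := nrm1_ge0 r.
have uu := nrm1_ge0 u; have tt := nrm1_ge0 t.
have rC : nrm1 r <= e * (C * nrm1 v) by rewrite (le_trans rt)// ler_wpM2l// ltW.
have rC1 : nrm1 r <= C * nrm1 v.
  by rewrite (le_trans rC)// ler_piMl// mulr_ge0.
have yB : nrm1 y <= B * nrm1 v.
  rewrite (le_trans (nrm1B _ _))// /B mulrDl mul1r lerD2l.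
  by rewrite (le_trans (nrm1M _ _))// -mulrA ler_wpM2l// nrm1_ge0.
have uB : nrm1 u <= (B + C) * nrm1 v.
  by rewrite (le_trans (nrm1B _ _))// mulrDl lerD.
have uB2 : nrm1 u * nrm1 u <= (B + C) ^+ 2 * nrm1 v ^+ 2.
  by rewrite -exprMn -expr2 lerXn2r ?nnegrE// mulr_ge0// addr_ge0.
rewrite -/y.
have -> : quad (V (th0 + t)) u u - quad V0 y y = quad (V (th0 + t) - V0) u u +
    (quad V0 r r - quad V0 y r - quad V0 r y).
  have us : quad V0 u u = quad V0 y y +
      (quad V0 r r - quad V0 y r - quad V0 r y) by exact: quad_sub.
  by rewrite quadB us; ring.
rewrite (le_trans (ler_normD _ _))//.
have n1 : `|quad (V (th0 + t) - V0) u u| <= e * ((B + C) ^+ 2 * nrm1 v ^+ 2).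
  rewrite (le_trans (quad_le _ _ _))// ler_pM ?nrm1_ge0//.
  by rewrite mulr_ge0.
have yr : nrm1 y * nrm1 r <= e * (B * C) * nrm1 v ^+ 2.
  rewrite (_ : e * (B * C) * nrm1 v ^+ 2 = (B * nrm1 v) * (e * (C * nrm1 v))); last by ring.
  by rewrite ler_pM.
have r2' : nrm1 r * nrm1 r <= e * C ^+ 2 * nrm1 v ^+ 2.
  rewrite (_ : e * C ^+ 2 * nrm1 v ^+ 2 = (C * nrm1 v) * (e * (C * nrm1 v))); last by ring.
  by rewrite ler_pM.
have n2 : `|quad V0 r r - quad V0 y r - quad V0 r y| <=
    e * (A * (2 * (B * C) + C ^+ 2)) * nrm1 v ^+ 2.
  have q1 : `|quad V0 r r| <= A * (nrm1 r * nrm1 r) := quad_le _ _ _.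
  have q2 : `|quad V0 y r| <= A * (nrm1 y * nrm1 r) := quad_le _ _ _.
  have q3 : `|quad V0 r y| <= A * (nrm1 y * nrm1 r).
    by rewrite (mulrC (nrm1 y)); exact: quad_le.
  apply: (le_trans (ler_normB _ _)).
  apply: (le_trans (lerD (le_trans (ler_normB _ _) (lerD q1 q2)) q3)).
  rewrite (_ : e * _ * _ = A * (e * C ^+ 2 * nrm1 v ^+ 2) +
    A * (e * (B * C) * nrm1 v ^+ 2) + A * (e * (B * C) * nrm1 v ^+ 2)); last by ring.
  by apply: lerD; [apply: lerD|]; rewrite ler_wpM2l.
rewrite (le_trans (lerD n1 n2))//.
rewrite [leLHS](_ : _ = e * E * nrm1 v ^+ 2); last by rewrite /E; ring.
by rewrite ler_wpM2r ?sqr_ge0.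
Qed.

(** Pythagoras: the residual of the least squares solution is orthogonal for [V0] to the range of
    [D]. *)
Let quad_min v t : quad V0 (v - D *m t) (v - D *m t) =
  quad V0 (v - D *m (mc_lin *m v)) (v - D *m (mc_lin *m v)) +
  quad H (t - mc_lin *m v) (t - mc_lin *m v).
Proof.
set w := v - D *m (mc_lin *m v); set z := t - mc_lin *m v.
have -> : v - D *m t = w - D *m z.
  by rewrite /w /z mulmxBr opprB addrA subrK.
have [Vs _] := V0_posdef.
have w0 : D^T *m V0 *m w = 0.
  have e : D^T *m V0 *m (D *m (mc_lin *m v)) = D^T *m V0 *m v.
    transitivity (H *m (mc_lin *m v)); first by rewrite /H [RHS]mulmxA !mulmxA.
    have -> : mc_lin *m v = invmx H *m (D^T *m V0 *m v).
      by rewrite /mc_lin -!mulmxA.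
    by rewrite mulKVmx// posdef_unit//; exact: gram_posdef.
  by rewrite /w mulmxBr e subrr.
have o1 : quad V0 (D *m z) w = 0.
  by rewrite /quad trmx_mul -!mulmxA (mulmxA D^T) w0 mulmx0 mxE.
have o2 : quad V0 w (D *m z) = 0 by rewrite -quad_tr Vs.
by rewrite quadH quad_sub o1 o2 !subr0.
Qed.

(** Comparison with [th0] bounds the residual at [th], hence s th - s th0, by O(v); [separation] and
    the injectivity of [D] turn this into th - th0 = O(v). Only then is the quadratic model valid at
    both competitors, and by [quad_min] the excess at [th] is quad H z z with z = th - th0 - L v. *)
Lemma minimum_contrast_linear (eps : R) : 0 < eps -> exists2 delta : R, 0 < delta &
  forall v th, nrm1 v <= delta -> Theta th ->
    (forall t, Theta t -> mc_contrast (s th0 + v) th <= mc_contrast (s th0 + v) t) ->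
    nrm1 (th - th0 - mc_lin *m v) <= eps * nrm1 v.
Proof.
move=> eps0.
have [CW CW0 hCW] := W_bounded.
pose A := nrm1 V0; pose Ld := nrm1 mc_lin; pose c1 := m%:R ^+ 2 * CW.
have A0 : 0 <= A := nrm1_ge0 _; have Ld0 : 0 <= Ld := nrm1_ge0 _.
have c10 : 0 <= c1 by rewrite mulr_ge0// sqr_ge0.
(* The squared residual is at most c1 A n^2, hence at most (K n)^2, since x <= (x + 1)^2 for x >=
   0. *)
pose K := c1 * A + 1; have cA0 : 0 <= c1 * A by rewrite mulr_ge0.
have K1 : 1 <= K by rewrite lerDr.
(* From t = L D t follows nrm1 t <= Ld ((K + 1) n + nrm1 t / (2 (Ld + 1))); the last contribution is
   at most nrm1 t / 2 and is absorbed, which doubles the constant. *)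
pose C := 2 * Ld * (K + 1).
have K10 : 0 < K + 1 by lra.
have C0 : 0 <= C by rewrite !mulr_ge0// ltW.
have LC : Ld <= C by rewrite /C; nra.
pose hH := q%:R ^+ 2 * nrm1 (invmx H).
have hH0 : 0 <= hH by rewrite mulr_ge0 ?sqr_ge0// nrm1_ge0.
(* [approx] is used at two points, so quad H z z <= 2 e n^2, and 2 hH e <= eps^2. *)
pose e := eps ^+ 2 / (2 * hH + 1).
have hH1 : 0 < 2 * hH + 1 by lra.
have e0 : 0 < e by rewrite divr_gt0// exprn_gt0.
have Ld1 : 0 < 2 * (Ld + 1) by lra.
have e10 : 0 < (2 * (Ld + 1))^-1 by rewrite invr_gt0.
have [r1 r10 h1] := s_diff e10.
have [eta eta0 heta] := separation r10.
have [rho rho0 hrho] := approx C0 e0.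
have C10 : 0 < C + 1 by lra.
pose delta := Num.min (eta / (K + 2)) (rho / (C + 1)).
have K20 : 0 < K + 2 by lra.
exists delta; first by rewrite lt_min !divr_gt0.
move=> v th; rewrite le_min => /andP[v1 v2] Tth thmin.
set n := nrm1 v in v1 v2 *; have n0 : 0 <= n := nrm1_ge0 _.
(* The localisation uses strict inequalities, hence n > 0. For v = 0 the contrast vanishes at [th0],
   so it vanishes at [th] as well, and identifiability gives th = th0. *)
have [nE|nN0] := eqVneq n 0.
  have v0 : v = 0 by exact: nrm1_eq0.
  have F0 : mc_contrast (s th0) th0 = 0.
    by rewrite /mc_contrast subrr /quad mulmx0 mxE.
  have pos : s th != s th0 -> 0 < mc_contrast (s th0) th.
    by move=> h; have [_ Vp] := V_posdef Tth; apply: Vp; rewrite subr_eq0 eq_sym.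
  have := thmin th0 Th0; rewrite v0 addr0 F0 => Fle.
  have : s th = s th0.
    by apply/eqP; apply: contraT => /pos; rewrite ltNge Fle.
  by move=> /(ident Tth) ->; rewrite subrr mulmx0 subr0 nrm1_0 nE mulr0.
have {nN0} npos : 0 < n by rewrite lt_neqAle eq_sym nN0.
pose u := s th0 + v - s th.
have uK : nrm1 u <= K * n.
  have lb := posdef_lower_bound u (V_posdef Tth).
  rewrite {1}/V invmxK in lb.
  have h2 : nrm1 u ^+ 2 <= c1 * quad (V th) u u.
    by rewrite (le_trans lb)// ler_wpM2r ?posdef_ge0 ?ler_wpM2l ?sqr_ge0 ?hCW//; exact: V_posdef.
  have h3 : quad (V th) u u <= A * n ^+ 2.
    have := thmin th0 Th0; rewrite /mc_contrast -/u addrAC subrr add0r => h.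
    by rewrite (le_trans h)// (le_trans (ler_norm _))// (le_trans (quad_le _ _ _))// expr2.
  have h4 : nrm1 u ^+ 2 <= (K * n) ^+ 2.
    rewrite (le_trans h2)// exprMn (@le_trans _ _ (c1 * (A * n ^+ 2)))//.
      by rewrite ler_wpM2l.
    by rewrite mulrA ler_wpM2r ?sqr_ge0// /K; nra.
  by move: h4; rewrite ler_sqr ?nnegrE ?nrm1_ge0// mulr_ge0//; lra.
pose t := th - th0.
have thE : th = th0 + t by rewrite /t addrC subrK.
have sK : nrm1 (s th - s th0) <= (K + 1) * n.
  rewrite (_ : s th - s th0 = v - u); last first.
    by rewrite /u; apply/colP => i; rewrite !mxE; ring.
  rewrite (le_trans (nrm1B _ _))// mulrDl mul1r addrC lerD2r//.
have tr1 : nrm1 t < r1.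
  apply: heta => //; rewrite (le_lt_trans sK)//.
  rewrite ler_pdivlMr// in v1.
  by rewrite (lt_le_trans _ v1)// mulrC ltr_pM2l//; lra.
have tC : nrm1 t <= C * n.
  have ht := h1 _ tr1; rewrite -thE in ht.
  have tt := nrm1_ge0 t.
  have Dt : nrm1 (D *m t) <= (K + 1) * n + (2 * (Ld + 1))^-1 * nrm1 t.
    rewrite (_ : D *m t = (s th - s th0) - (s th - s th0 - D *m t)); last by rewrite subKr.
    by rewrite (le_trans (nrm1B _ _))// lerD.
  have : nrm1 t <= Ld * ((K + 1) * n + (2 * (Ld + 1))^-1 * nrm1 t).
    by rewrite -{1}(mc_linK t) (le_trans (nrm1M _ _))// ler_wpM2l.
  have : Ld * ((2 * (Ld + 1))^-1 * nrm1 t) <= nrm1 t / 2.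
    rewrite mulrA mulrC ler_wpM2l// ler_pdivrMr//; lra.
  by rewrite /C mulrDr; nra.
have Crho x : x <= C * n -> x < rho.
  move=> /le_lt_trans; apply; rewrite ler_pdivlMr// in v2.
  by rewrite (lt_le_trans _ v2)// mulrC ltr_pM2l//; lra.
have [_ a1] := hrho v t (Crho _ tC) tC.
have t2C : nrm1 (mc_lin *m v) <= C * n.
  by rewrite (le_trans (nrm1M _ _))// ler_wpM2r.
have [T2 a2] := hrho v (mc_lin *m v) (Crho _ t2C) t2C.
have := thmin _ T2; rewrite {1}thE => le12.
rewrite -/t; set z := t - mc_lin *m v.
have qz : quad H z z <= 2 * (e * n ^+ 2).
  move: a1 a2; rewrite (quad_min v t) -/z -/n !ler_norml.
  by move=> /andP[a1 _] /andP[_ a2]; lra.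
have := posdef_lower_bound z gram_posdef; rewrite -/hH => lb.
have z2 : nrm1 z ^+ 2 <= (eps * n) ^+ 2.
  rewrite (le_trans lb)// (@le_trans _ _ (hH * (2 * (e * n ^+ 2))))//.
    by rewrite ler_wpM2l.
  have he : 2 * hH * e <= eps ^+ 2.
    by rewrite mulrA ler_pdivrMr//; have := sqr_ge0 eps; nra.
  rewrite (_ : hH * (2 * (e * n ^+ 2)) = 2 * hH * e * n ^+ 2); last by ring.
  by rewrite exprMn ler_wpM2r ?sqr_ge0.
by move: z2; rewrite ler_sqr ?nnegrE ?nrm1_ge0// mulr_ge0// ltW.
Qed.

End minimum_contrast.

(** * Realized covariation and smooth drifts *)

Section pathwise.
Context {R : realType}.
Variable T : R.
Hypothesis T0 : 0 < T.
Local Notation mu := (@lebesgue_measure R).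

Lemma within_uniformly_continuous (f : R -> R) : {within `[0, T], continuous f} ->
  forall eps : R, 0 < eps -> exists2 delta : R, 0 < delta &
    forall s t, 0 <= s <= T -> 0 <= t <= T -> `|s - t| < delta -> `|f s - f t| <= eps.
Proof.
move=> /subspace_continuousP cf eps eps0.
pose Q (delta s : R) := forall t, 0 <= t <= T -> `|s - t| < delta -> `|f s - f t| <= eps.
have cov := (near_covering_withinP `[0, T]%classic).2
  ((compact_near_coveringP _).1 (@segment_compact R 0 T)) R (0 : R)^'+ Q.
have near_ok x : `[0, T]%classic x ->
    \forall x' \near x & delta \near (0 : R)^'+, `[0, T]%classic x' -> Q delta x'.
  move=> Tx; have e2 : 0 < eps / 2 by rewrite divr_gt0.
  have /cvgrPdist_lt/(_ _ e2)/nbhs_ballP[r /= r0 hr] := cf x Tx.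
  have r2 : 0 < r / 2 by rewrite divr_gt0.
  exists (ball x (r / 2), [set d | d < r / 2]) => /=.
    by split; [exact: nbhsx_ballx|exact: nbhs_right_lt].
  move=> [x' d] /= [xx' dr] Tx' t Tt x't; move: xx'; rewrite -ball_normE /= => xx'.
  have h1 : `|f x - f x'| < eps / 2.
    apply: hr => //; rewrite -ball_normE/= (lt_trans xx')//.
    by rewrite ltr_pdivrMr// ltr_pMr// ltr1n.
  have h2 : `|f x - f t| < eps / 2.
    apply: hr; last by rewrite /= in_itv.
    rewrite -ball_normE/= (_ : x - t = (x - x') + (x' - t)); last by rewrite addrA subrK.
    rewrite (le_lt_trans (ler_normD _ _))// [ltRHS](splitr r) ltrD//.
    exact: lt_trans x't dr.
  rewrite (_ : f x' - f t = (f x - f t) - (f x - f x')); last by ring.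
  by rewrite (le_trans (ler_normB _ _))// [leRHS](splitr eps) lerD// ltW.
have h := cov _ near_ok.
near (0 : R)^'+ => delta; exists delta; first by near: delta; exact: nbhs_right_gt.
move=> s t sT tT st.
suff : `[0, T]%classic `<=` Q delta by apply; rewrite /= ?in_itv.
by near: delta; exact: h.
Unshelve. all: by end_near. Qed.

Lemma within_bounded (f : R -> R) : {within `[0, T], continuous f} ->
  exists2 K : R, 0 <= K & forall t, 0 <= t <= T -> `|f t| <= K.
Proof.
move=> cf.
have cnf : {within `[0, T], continuous (fun t => `|f t|)}.
  by move=> t; apply: (continuous_comp (cf t)); exact: norm_continuous.
have ne : `[0, T]%classic !=set0 by exists 0; rewrite /= in_itv/= lexx ltW.
have [c _ hc] := compact_EVT_max ne (@segment_compact R 0 T) cnf.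
by exists `|f c| => // t tT; apply: hc; rewrite mem_setE in_itv.
Qed.

Section primitive.
Variables (D a : R -> R) (x0 : R).
Hypothesis ca : {within `[0, T], continuous a}.
Hypothesis DE : forall t, 0 <= t <= T -> D t = x0 + \int[mu]_(s in `[0, t]) a s.

Lemma primitive_increment s t (c e : R) : 0 <= s -> s < t -> t <= T ->
  (forall u, s <= u <= t -> `|a u - c| <= e) ->
  `|D t - D s - (t - s) * c| <= (t - s) * e.
Proof.
move=> s0 st tT ae.
have t0 : 0 <= t by lra.
have int0 v : v <= T -> mu.-integrable `[0, v] (EFin \o a).
  move=> vT; apply: continuous_compact_integrable; first exact: segment_compact.
  apply: continuous_subspaceW ca => u /=; rewrite !in_itv/= => /andP[-> uv].
  by rewrite (le_trans uv).
have ist : mu.-integrable `]s, t] (EFin \o a).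
  apply: integrableS (int0 t tT) => // u /=; rewrite !in_itv/= => /andP[su ->].
  by rewrite (le_trans s0 (ltW su)).
have fin : (mu `]s, t]%classic < +oo)%E.
  by rewrite lebesgue_measure_itv/= lte_fin st -EFinB ltry.
have ic (k : R) : mu.-integrable `]s, t] (EFin \o cst k).
  apply: measurable_bounded_integrable => //.
  exact: bounded_cst.
have mst : fine (mu `]s, t]%classic) = t - s.
  by rewrite lebesgue_measure_itv/= lte_fin st.
have rc (k : R) : \int[mu]_(u in `]s, t]) k = k * (t - s).
  by have := @Rintegral_cst _ _ _ mu `]s, t]%classic (measurable_itv _) k; rewrite mst.
have -> : D t - D s - (t - s) * c = \int[mu]_(u in `]s, t]) (a u - c).
  rewrite !DE ?s0 ?t0//=; last by rewrite (le_trans (ltW st)).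
  rewrite RintegralB// //; last exact: ic.
  rewrite rc (mulrC c); congr (_ - _); rewrite opprD addrACA subrr add0r.
  apply: Rintegral_itvB; [exact: int0| |]; by rewrite bnd_simp// ltW.
have i1 : mu.-integrable `]s, t] (EFin \o (fun u => a u - c)).
  by have := integrableB _ ist (ic c); apply.
rewrite (le_trans (le_normr_Rintegral _ i1))//.
rewrite [leRHS](_ : _ = \int[mu]_(u in `]s, t]) e); last first.
  by rewrite rc mulrC.
apply: le_Rintegral => //; [|exact: (ic e)|].
- by have := integrable_norm i1; apply.
- by move=> u /=; rewrite in_itv/= => /andP[su ut]; apply: ae; rewrite ut ltW.
Qed.

End primitive.

Lemma abel_summation (A z : nat -> R) n :
  \sum_(i < n) A i * (z i.+1 - z i) =
  A n * z n - A 0%N * z 0%N - \sum_(i < n) z i.+1 * (A i.+1 - A i).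
Proof.
elim: n => [|n ih]; first by rewrite !big_ord0 subr0 subrr.
by rewrite !big_ord_recr/= ih; ring.
Qed.

Definition grid (n i : nat) : R := i%:R * (T / n%:R).

Lemma gridP n i : (0 < n)%N -> (i <= n)%N -> 0 <= grid n i <= T.
Proof.
move=> n0 iltn; have nR : (0 : R) < n%:R by rewrite ltr0n.
rewrite /grid mulr_ge0 ?divr_ge0 ?(ltW T0)//=.
by rewrite mulrA ler_pdivrMr// mulrC ler_pM2l// ler_nat.
Qed.

Lemma gridS n i : grid n i.+1 - grid n i = T / n%:R.
Proof. by rewrite /grid -mulrBl -natrB// subSnn mul1r. Qed.

Definition incr (x : R -> R) (n i : nat) : R := x (grid n i.+1) - x (grid n i).

Let eventually_ge (M : R) : exists N, forall n, (N <= n)%N -> (0 < n)%N /\ M < n%:R.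
Proof.
exists (Num.bound `|M|).+1 => n Nn; split; first exact: leq_trans Nn.
rewrite (le_lt_trans (ler_norm M))// (lt_le_trans (archi_boundP (normr_ge0 M)))//.
by rewrite ler_nat (leq_trans _ Nn).
Qed.

Section cross_variation.
Variables (D a : R -> R) (x0 : R).
Hypothesis ca : {within `[0, T], continuous a}.
Hypothesis DE : forall t, 0 <= t <= T -> D t = x0 + \int[mu]_(s in `[0, t]) a s.

Let lipschitz : exists2 K : R, 0 <= K & forall s t, 0 <= s <= T -> 0 <= t <= T ->
  `|D t - D s| <= K * `|t - s|.
Proof.
have [K K0 hK] := within_bounded ca; exists K => //.
have half s t : 0 <= s -> s < t -> t <= T -> `|D t - D s| <= K * `|t - s|.
  move=> s0 st tT; have := primitive_increment (c := 0) (e := K) ca DE s0 st tT.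
  rewrite mulr0 subr0 mulrC (@gtr0_norm _ (t - s)) ?subr_gt0//; apply => u /andP[su ut].
  by rewrite subr0 hK// (le_trans s0 su) (le_trans ut).
move=> s t /andP[s0 sT] /andP[t0 tT]; have [st|ts|->] := ltgtP s t.
- exact: half.
- by rewrite distrC (distrC t); exact: half.
- by rewrite !subrr normr0 mulr0.
Qed.

(** Both factors are Lipschitz, so the sum is O(1 / n). *)
Lemma drift_product (D' : R -> R) (K : R) :
  (forall s t, 0 <= s <= T -> 0 <= t <= T -> `|D' t - D' s| <= K * `|t - s|) ->
  forall eps : R, 0 < eps -> exists N, forall n, (N <= n)%N ->
    Num.sqrt n%:R * `|\sum_(i < n) incr D n i * incr D' n i| <= eps.
Proof.
move=> hK' eps eps0; have [K1 K10 hK] := lipschitz.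
pose C := `|K1 * K * T ^+ 2|.
have [N hN] := eventually_ge ((C / eps) ^+ 2); exists N => n /hN[n0 Cn].
have nR : (0 : R) < n%:R by rewrite ltr0n.
have h0 : 0 < T / n%:R by rewrite divr_gt0.
have S : `|\sum_(i < n) incr D n i * incr D' n i| <= n%:R * (K1 * K * (T / n%:R) ^+ 2).
  rewrite (le_trans (ler_norm_sum _ _ _))//.
  rewrite [leRHS](_ : _ = \sum_(i < n) (K1 * K * (T / n%:R) ^+ 2)); last first.
    by rewrite sumr_const card_ord mulr_natl.
  apply: ler_sum => i _.
  have g0 := gridP n0 (ltnW (ltn_ord i)); have g1 := gridP n0 (ltn_ord i).
  have := hK _ _ g0 g1; have := hK' _ _ g0 g1; rewrite gridS (gtr0_norm h0) => b b'.
  rewrite normrM (_ : K1 * K * (T / n%:R) ^+ 2 = (K1 * (T / n%:R)) * (K * (T / n%:R))).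
    exact: ler_pM.
  by ring.
have sn : 0 < Num.sqrt (n%:R : R) by rewrite sqrtr_gt0.
have sn2 : Num.sqrt (n%:R : R) ^+ 2 = n%:R by rewrite sqr_sqrtr// ltW.
apply: (@le_trans _ _ (Num.sqrt n%:R * (n%:R * (K1 * K * (T / n%:R) ^+ 2)))).
  by rewrite ler_wpM2l// ltW.
have -> : Num.sqrt n%:R * (n%:R * (K1 * K * (T / n%:R) ^+ 2)) = K1 * K * T ^+ 2 / Num.sqrt n%:R.
  by move: sn sn2; set q := Num.sqrt _ => q0 q2; rewrite -q2; field; rewrite gt_eqF.
rewrite ler_pdivrMr// (le_trans (ler_norm _))// -/C mulrC -ler_pdivrMr//.
rewrite ltW// -(@ltr_pXn2r _ 2)// ?nnegrE ?divr_ge0 ?(ltW eps0) ?(ltW sn) ?normr_ge0//.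
by rewrite sn2.
Qed.

Lemma drift_lipschitz : exists K : R, forall s t, 0 <= s <= T -> 0 <= t <= T ->
  `|D t - D s| <= K * `|t - s|.
Proof. by have [K _ hK] := lipschitz; exists K. Qed.

(* The drift density a is replaced by the Lipschitz function
   A s = (D (s + eta) - D s) / eta, for which Abel summation applies. *)
Lemma drift_noise_product (z : R -> R) (Kz : R) :
  (forall t, 0 <= t <= T -> `|z t| <= Kz) ->
  forall eps : R, 0 < eps -> exists N, forall n, (N <= n)%N ->
    Num.sqrt n%:R * `|\sum_(i < n) incr D n i * incr z n i| <=
      eps * (1 + Num.sqrt (\sum_(i < n) incr z n i ^+ 2)).
Proof.
move=> hz eps eps0; have [K K0 hK] := lipschitz.
have Kz0 : 0 <= Kz by rewrite (le_trans _ (hz 0 _))// lexx ltW.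
(* The replacement of the density contributes at most 2 e T sqrt V = eps sqrt V, where V is the sum
   of the squared increments of z. *)
pose e := eps / (2 * T).
have e0 : 0 < e by rewrite divr_gt0// mulr_gt0.
have [delta delta0 hd] := within_uniformly_continuous ca e0.
pose eta := Num.min (delta / 2) T.
have eta0 : 0 < eta by rewrite lt_min divr_gt0.
have etaT : eta <= T by rewrite ge_min lexx orbT.
have etad : eta < delta.
  by rewrite (@le_lt_trans _ _ (delta / 2)) ?ge_min ?lexx// ltr_pdivrMr// ltr_pMr// ltr1n.
(* Near [T] the averaging window [s, s + eta] is shifted to the left: it stays inside [0, T] and
   still contains s. *)
pose cl (s : R) := Num.min s (T - eta).
have clP s : 0 <= s <= T -> [/\ 0 <= cl s, cl s + eta <= T, cl s <= s & s <= cl s + eta].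
  by move=> /andP[s0 sT]; rewrite /cl; case: (leP s (T - eta)) => h; split; lra.
pose A s := (D (cl s + eta) - D (cl s)) / eta.
have cl_lip s t : `|cl s - cl t| <= `|s - t|.
  by rewrite /cl; case: (leP s (T - eta)) => h1; case: (leP t (T - eta)) => h2;
    rewrite ?subrr ?normr0//; have := ler_norm (s - t); have := ler_norm (t - s);
    rewrite (distrC t); rewrite ler_norml; lra.
have A_bd s : 0 <= s <= T -> `|A s| <= K.
  move=> /clP[c0 cT _ _]; rewrite normrM normfV (gtr0_norm eta0) ler_pdivrMr//.
  have := hK (cl s) (cl s + eta); rewrite addrAC subrr add0r (gtr0_norm eta0).
  by apply; lra.
have A_lip s t : 0 <= s <= T -> 0 <= t <= T -> `|A s - A t| <= 2 * K / eta * `|s - t|.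
  move=> sT tT; have [s1 s2 _ _] := clP _ sT; have [t1 t2 _ _] := clP _ tT.
  rewrite -mulrBl normrM normfV (gtr0_norm eta0) mulrAC ler_wpM2r ?invr_ge0 ?(ltW eta0)//.
  rewrite (_ : _ - _ = (D (cl s + eta) - D (cl t + eta)) - (D (cl s) - D (cl t))); last by ring.
  rewrite (le_trans (ler_normB _ _))// -mulrA mulrDl !mul1r; apply: lerD.
  - rewrite (le_trans (hK _ _ _ _))//; [lra|lra|].
    by rewrite opprD addrACA subrr addr0 ler_wpM2l.
  - by rewrite (le_trans (hK _ _ _ _))//; [lra|lra|rewrite ler_wpM2l].
have A_close s : 0 <= s <= T -> `|A s - a s| <= e.
  move=> sT; have [c0 cT cs sc] := clP _ sT.
  have clt : cl s < cl s + eta by rewrite ltrDl.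
  have := primitive_increment (c := a s) (e := e) ca DE c0 clt cT.
  rewrite (_ : cl s + eta - cl s = eta) => [H|]; last by rewrite addrAC subrr add0r.
  rewrite -(@ler_pM2l _ eta)// -[X in X * `|_|](gtr0_norm eta0) -normrM mulrBr.
  rewrite (_ : eta * A s = D (cl s + eta) - D (cl s)); last first.
    by rewrite /A mulrC divfK// gt_eqF.
  apply: H => u /andP[u1 u2]; apply: hd; [lra|lra|].
  by rewrite (le_lt_trans _ etad)// ler_norml; lra.
(* The Abel sum, multiplied by T / n and by sqrt n, is at most C / sqrt n: 2 K Kz bounds its
   boundary terms, and the n increments of the Lipschitz function [A] give the other term, in which
   the window [eta] is fixed. *)
pose C := T * (2 * K * Kz + 2 * K * Kz * T / eta).
have C0 : 0 <= C.
  have q0 : 0 <= 2 * K * Kz by rewrite !mulr_ge0.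
  by rewrite mulr_ge0 ?(ltW T0)// addr_ge0// !mulr_ge0 ?invr_ge0// ltW.
have [N1 hN1] := eventually_ge (T / delta).
have [N2 hN2] := eventually_ge ((C / eps) ^+ 2).
exists (maxn N1 N2) => n; rewrite geq_max => /andP[/hN1[n0 nd] /hN2[_ nC]].
have nR : (0 : R) < n%:R by rewrite ltr0n.
pose h := T / n%:R; have h0 : 0 < h by rewrite divr_gt0.
have hdelta : h < delta by rewrite ltr_pdivrMr// mulrC -ltr_pdivrMr.
have sn : 0 < Num.sqrt (n%:R : R) by rewrite sqrtr_gt0.
have sn2 : Num.sqrt (n%:R : R) ^+ 2 = n%:R by rewrite sqr_sqrtr// ltW.
pose A' i := A (grid n i); pose z' i := z (grid n i).
set V := \sum_(i < n) _ ^+ 2.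
have V0 : 0 <= V by apply: sumr_ge0 => i _; rewrite sqr_ge0.
have dD (i : 'I_n) : `|incr D n i - h * A' i| <= 2 * e * h.
  have g0 := gridP n0 (ltnW (ltn_ord i)); have g1 := gridP n0 (ltn_ord i).
  have gi : grid n i < grid n i.+1 by rewrite -subr_gt0 gridS.
  have [/andP[g00 _] /andP[_ g1T]] := (g0, g1).
  have := primitive_increment (c := a (grid n i)) (e := e) ca DE g00 gi g1T.
  rewrite gridS -/h => H.
  rewrite (_ : incr D n i - h * A' i = (incr D n i - h * a (grid n i)) -
    h * (A (grid n i) - a (grid n i))); last by rewrite /A'; ring.
  rewrite (le_trans (ler_normB _ _))// (_ : 2 * e * h = h * e + h * e); last by ring.
  apply: lerD.
    apply: H => u /andP[u1 u2]; apply: hd; [lra|lra|].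
    rewrite (le_lt_trans _ hdelta)// ger0_norm ?subr_ge0//.
    by have := gridS n i; rewrite -/h; lra.
  by rewrite normrM (gtr0_norm h0) ler_wpM2l ?(ltW h0) ?A_close.
have main1 : `|\sum_(i < n) A' i * (z' i.+1 - z' i)| <= 2 * K * Kz + 2 * K * Kz * T / eta.
  have zb i : (i <= n)%N -> `|z' i| <= Kz by move=> iln; apply: hz; exact: gridP.
  have Ab i : (i <= n)%N -> `|A' i| <= K by move=> iln; apply: A_bd; exact: gridP.
  rewrite abel_summation (le_trans (ler_normB _ _))//; apply: lerD.
    have AzK i : (i <= n)%N -> `|A' i * z' i| <= K * Kz.
      by move=> iln; rewrite (normrM (A' i)); apply: ler_pM => //; [exact: Ab|exact: zb].
    rewrite (le_trans (ler_normB _ _))// (_ : 2 * K * Kz = K * Kz + K * Kz); last by ring.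
    by apply: lerD; exact: AzK.
  rewrite (le_trans (ler_norm_sum _ _ _))//.
  apply: (@le_trans _ _ (\sum_(i < n) Kz * (2 * K / eta * h))).
    apply: ler_sum => i _; rewrite normrM ler_pM// ?zb// (le_trans (A_lip _ _ _ _))//.
    - exact: gridP.
    - by apply: gridP => //; exact: ltnW.
    - by rewrite gridS -/h (gtr0_norm h0).
  rewrite sumr_const card_ord -[_ *+ n]mulr_natr /h le_eqVlt; apply/orP; left; apply/eqP.
  by field; rewrite !gt_eqF.
have eh0 : 0 <= 2 * e * h by rewrite mulr_ge0 ?(ltW h0)// mulr_ge0 ?(ltW e0).
have main2 : `|\sum_(i < n) (incr D n i - h * A' i) * incr z n i| <=
    2 * e * h * (Num.sqrt n%:R * Num.sqrt V).
  rewrite (le_trans (ler_norm_sum _ _ _))//.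
  apply: (@le_trans _ _ (\sum_(i < n) 2 * e * h * `|incr z n i|)).
    by apply: ler_sum => i _; rewrite (normrM _ (incr z n i)) (ler_wpM2r (normr_ge0 _) (dD i)).
  rewrite -mulr_sumr ler_wpM2l//.
  rewrite -sqrtrM ?(ltW nR)// -[leLHS]ger0_norm ?sumr_ge0// -sqrtr_sqr ler_wsqrtr//.
  have := sqr_sum_le (index_enum 'I_n) (fun i => `|incr z n i|).
  have -> : size (index_enum 'I_n) = n by rewrite -sum1_size sum1_card card_ord.
  rewrite (_ : V = \sum_(i < n) `|incr z n i| ^+ 2)//.
  by apply: eq_bigr => i _; rewrite real_normK ?num_real.
have -> : \sum_(i < n) incr D n i * incr z n i =
    h * (\sum_(i < n) A' i * (z' i.+1 - z' i)) +
    \sum_(i < n) (incr D n i - h * A' i) * incr z n i.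
  rewrite mulr_sumr -big_split/=; apply: eq_bigr => i _.
  by rewrite /incr -/(z' i.+1) -/(z' i); ring.
apply: (@le_trans _ _ (Num.sqrt n%:R * (h * (2 * K * Kz + 2 * K * Kz * T / eta) +
   2 * e * h * (Num.sqrt n%:R * Num.sqrt V)))).
  rewrite ler_wpM2l ?(ltW sn)// (le_trans (ler_normD _ _))// lerD//.
  by rewrite normrM (gtr0_norm h0) ler_wpM2l// ltW.
have -> : Num.sqrt n%:R * (h * (2 * K * Kz + 2 * K * Kz * T / eta) +
   2 * e * h * (Num.sqrt n%:R * Num.sqrt V)) = C / Num.sqrt n%:R + eps * Num.sqrt V.
  rewrite /C /h /e; move: sn sn2; set q := Num.sqrt n%:R => q0 q2; rewrite -q2; field.
  by rewrite !gt_eqF.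
rewrite mulrDr mulr1 lerD2r ler_pdivrMr// mulrC -ler_pdivrMr//.
rewrite ltW// -(@ltr_pXn2r _ 2)// ?nnegrE ?divr_ge0 ?(ltW eps0) ?(ltW sn)//.
by rewrite sn2.
Qed.

End cross_variation.
End pathwise.

(** * The matrix W_k and the derivative of Sigma_k *)

Section duplication.
Context {R : realType} {n : nat}.
Local Notation pos := (tnth (lower_pos n)).

(** The Moore-Penrose inverse of [dupl] in closed form: it averages the entries (i, j) and (j, i).
    On the diagonal the two halves coincide and add up to 1. *)
Definition half_sel : 'M[R]_(hdim n, n * n) := \matrix_(l, a)
  (2^-1 * ((a == mxtens_index ((pos l).2, (pos l).1))%:R + (a == mxtens_index (pos l))%:R)).

Lemma sum_half_sel (F : 'I_(n * n) -> R) l : \sum_a half_sel l a * F a =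
  2^-1 * (F (mxtens_index ((pos l).2, (pos l).1)) + F (mxtens_index (pos l))).
Proof.
have d b : \sum_a (a == b)%:R * F a = F b.
  by rewrite (bigD1 b)//= eqxx mul1r big1 ?addr0// => a /negbTE->; rewrite mul0r.
rewrite -!d -big_split mulr_sumr; apply: eq_bigr => a _ /=.
by rewrite mxE; ring.
Qed.

Let lowE l m : (pos m == pos l) || (pos m == ((pos l).2, (pos l).1)) = (m == l).
Proof.
have um : uniq (lower_pos n) by exact: lower_seq_uniq.
rewrite -(inj_eq (tuple_uniqP _ um)).
have := mem_tnth m (lower_pos n); have := mem_tnth l (lower_pos n); rewrite /= !lower_seqP.
case: (pos m) => u v; case: (pos l) => i j /= ji vu; rewrite !xpair_eqE -!val_eqE /=; lia.
Qed.

Lemma half_sel_dupl : half_sel *m dupl R n = 1%:M.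
Proof.
apply/matrixP => l m; rewrite !mxE sum_half_sel !mxE !mxtens_indexK.
have := lowE l m; case: (pos l) => i j /= h.
by rewrite h (orbC (_ == (j, i))) h eq_sym; case: (l == m) => /=; lra.
Qed.

(** The columns of D = [dupl] have disjoint supports of 1 or 2 entries. Thus D^T is the diagonal
    matrix of these sizes times [half_sel], and [half_sel] D = 1 shows that D^T D is that diagonal
    matrix. *)
Lemma dupl_pinvE : dupl_pinv R n = half_sel.
Proof.
pose dl : 'rV[R]_(hdim n) := \row_l (if (pos l).1 == (pos l).2 then 1 else 2).
have trE : (dupl R n)^T = diag_mx dl *m half_sel.
  apply/matrixP => l a; rewrite mul_diag_mx !mxE.
  case: (mxtens_indexP a) => j i; rewrite mxtens_indexK.
  have inj := can_inj (@mxtens_indexK n n).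
  rewrite (inj_eq inj) (inj_eq inj); case: (pos l) => u v; rewrite !xpair_eqE /=.
  rewrite (eq_sym i u) (eq_sym j v) (eq_sym i v) (eq_sym j u).
  have [->|uv] := eqVneq u v.
    by rewrite andbC; case: (_ && _) => /=; lra.
  have : ~~ ((u == i) && (v == j) && ((u == j) && (v == i))).
    by apply: contra uv => /andP[/andP[/eqP-> _] /andP[_ /eqP->]].
  rewrite (andbC (v == j)).
  by case: ((u == i) && _); case: ((u == j) && _) => //= _; lra.
have dlu : diag_mx dl \in unitmx.
  rewrite unitmxE det_diag unitfE; apply/prodf_neq0 => l _; rewrite mxE.
  by case: ifP => _; rewrite ?oner_neq0// pnatr_eq0.
by rewrite /dupl_pinv trE -(mulmxA (diag_mx dl)) half_sel_dupl mulmx1 mulKmx.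
Qed.

End duplication.

Section asymptotic_variance.
Context {R : realType} {n : nat}.
Local Notation pos := (tnth (lower_pos n)).

Definition avar (S : 'M[R]_n) : 'M[R]_(hdim n) :=
  2%:R *: (dupl_pinv R n *m tensmx S S *m (dupl_pinv R n)^T).

(** The covariance that Isserlis' formula assigns to the products of coordinates of a Gaussian
    vector with covariance [S]; in this form it is matched with [quad_var]. *)
Lemma avarE (S : 'M[R]_n) l m : avar S l m =
  S (pos l).1 (pos m).1 * S (pos l).2 (pos m).2 +
  S (pos l).1 (pos m).2 * S (pos l).2 (pos m).1.
Proof.
rewrite mxE dupl_pinvE -mulmxA [X in _ * X]mxE sum_half_sel.
have E a : (tensmx S S *m (half_sel (R := R))^T) a m = 2^-1 *
    (tensmx S S a (mxtens_index ((pos m).2, (pos m).1)) + tensmx S S a (mxtens_index (pos m))).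
  rewrite mxE -sum_half_sel; apply: eq_bigr => b _.
  by rewrite [in LHS]mulrC; congr (_ * _); rewrite mxE.
rewrite !E; case: (pos l) => l1 l2; case: (pos m) => m1 m2; rewrite !tensmxE/=.
by field.
Qed.

Lemma avar_sqr (c : nat) (G : 'M[R]_(n, c)) : avar (G *m G^T) =
  2 *: (half_sel *m tensmx G G *m (half_sel *m tensmx G G)^T).
Proof. by rewrite /avar dupl_pinvE -tensmx_mul -trmx_tens trmx_mul !mulmxA. Qed.

(** [avar] is 2 K K^T with K the product of [half_sel] and [tensmx G G]; the product of [tensmx H H]
    and [dupl] is a right inverse of K, so K^T is injective. *)
Lemma avar_posdef (c : nat) (G : 'M[R]_(n, c)) (H : 'M[R]_(c, n)) :
  G *m H = 1%:M -> posdef (avar (G *m G^T)).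
Proof.
move=> GH; rewrite avar_sqr; set K := half_sel *m _.
split=> [|u u0]; first by rewrite linearZ/= trmx_mul trmxK.
have KH : K *m (tensmx H H *m dupl R n) = 1%:M.
  rewrite /K -mulmxA (mulmxA (tensmx G G)) tensmx_mul GH.
  have -> : @tensmx R n n n n 1%:M 1%:M = 1%:M.
    apply/matrixP => i j; case: (mxtens_indexP i) => i1 i2; case: (mxtens_indexP j) => j1 j2.
    rewrite tensmxE !mxE (inj_eq (can_inj (@mxtens_indexK n n))) xpair_eqE.
    by rewrite -natrM mulnb.
  by rewrite mul1mx half_sel_dupl.
have -> : quad (2 *: (K *m K^T)) u u = 2 * \sum_i (K^T *m u) i 0 ^+ 2.
  rewrite /quad -scalemxAr -scalemxAl mxE; congr (_ * _).
  rewrite mulmxA -(mulmxA _ K^T) -{1}(trmxK K) -trmx_mul mxE; apply: eq_bigr => i _.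
  by rewrite mxE expr2.
rewrite mulr_gt0// lt_neqAle sumr_ge0 ?andbT => [|i _]; last exact: sqr_ge0.
apply: contra u0; rewrite eq_sym psumr_eq0 => [/allP h|i _]; last exact: sqr_ge0.
have Ku : K^T *m u = 0.
  apply/colP => i; rewrite [RHS]mxE; apply/eqP; rewrite -sqrf_eq0.
  exact: (h i (mem_index_enum i)).
apply/eqP; rewrite -(mul1mx u) -(trmx1 _ (hdim n)) -KH trmx_mul -mulmxA Ku.
by rewrite mulmx0.
Qed.

End asymptotic_variance.

Section factor_model.
Context {R : realType} {p k : nat} (hkp : (k <= p)%N).

Lemma WmatE (theta : 'cV[R]_(qdim p k)) : Wmat hkp theta = avar (Sigma hkp theta).
Proof. by []. Qed.

(** The diffusion coefficients of the observed process with respect to the r + p driving Wiener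
    processes, those of [W] first. *)
Definition noise_mx (r : nat) (S : 'M[R]_(k, r)) (theta : 'cV[R]_(qdim p k)) :=
  row_mx (loading hkp theta *m S) (diag_mx (\row_i par_sigma theta i)).

Lemma noise_mx_sqr (r : nat) (S : 'M[R]_(k, r)) theta : par_Sff theta = S *m S^T ->
  (forall i, 0 < par_sigma theta i) ->
  noise_mx S theta *m (noise_mx S theta)^T = Sigma hkp theta.
Proof.
move=> hS s0; rewrite /noise_mx tr_row_mx mul_row_col /Sigma hS trmx_mul !mulmxA.
congr (_ + _); rewrite tr_diag_mx mulmx_diag; congr diag_mx; apply/rowP => i.
rewrite !mxE -expr2 sqr_sqrtr ?mxE//.
case: leP => // h; have := s0 i; rewrite /par_sigma mxE ler0_sqrtr ?ltxx//.
exact: ltW.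
Qed.

(** The block of the idiosyncratic noises is invertible by itself. *)
Lemma noise_mx_rinv (r : nat) (S : 'M[R]_(k, r)) theta :
  (forall i, 0 < par_sigma theta i) ->
  noise_mx S theta *m col_mx 0 (diag_mx (\row_i (par_sigma theta i)^-1)) = 1%:M.
Proof.
move=> s0; rewrite mul_row_col mulmx0 add0r mulmx_diag.
by apply/matrixP => i j; rewrite !mxE divff// gt_eqF.
Qed.

Lemma Wmat_posdef (r : nat) (S : 'M[R]_(k, r)) theta : par_Sff theta = S *m S^T ->
  (forall i, 0 < par_sigma theta i) -> posdef (Wmat hkp theta).
Proof.
move=> hS s0; rewrite WmatE -(noise_mx_sqr hS s0).
exact: avar_posdef (noise_mx_rinv S s0).
Qed.

Lemma Sigma_sym theta : (exists r (S : 'M[R]_(k, r)), par_Sff theta = S *m S^T) ->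
  (Sigma hkp theta)^T = Sigma hkp theta.
Proof.
move=> [r [S hS]]; rewrite /Sigma hS linearD/= tr_diag_mx; congr (_ + _).
by rewrite !trmx_mul !trmxK !mulmxA.
Qed.

Local Notation V := 'cV[R]_(qdim p k).

Let diff (g : V -> R) := forall x, differentiable (g : V -> R^o) x.

Let diff_cst (c : R) : diff (fun=> c).
Proof. by move=> x; exact: differentiable_cst. Qed.

Let diff_coord i : diff (fun t : V => t i 0).
Proof.
move=> x; have lin_i : linear (fun t : V => t i 0 : R^o).
  by move=> c u v; rewrite !mxE.
pose L := GRing.isLinear.Build _ _ _ _ _ lin_i.
pose f : {linear V -> R^o} := HB.pack (fun t : V => t i 0 : R^o) L.
have -> : (fun t : V => t i 0 : R^o) = f by [].
apply: linear_differentiable => y.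
exact: coord_continuous.
Qed.

Let diffD g h : diff g -> diff h -> diff (fun t => g t + h t).
Proof. by move=> dg dh x; exact: differentiableD. Qed.

Let diffM g h : diff g -> diff h -> diff (fun t => g t * h t).
Proof. by move=> dg dh x; exact: differentiableM. Qed.

Let diff_sum (I : Type) (s : seq I) (g : I -> V -> R) :
  (forall i, diff (g i)) -> diff (fun t => \sum_(i <- s) g i t).
Proof.
move=> dg; elim: s => [|i s ih] x.
  rewrite (_ : (fun t : V => _) = fun=> 0); first exact: diff_cst.
  by apply/funext => t; rewrite big_nil.
rewrite (_ : (fun t : V => _) = fun t => g i t + \sum_(j <- s) g j t).
  exact: (diffD (dg i) ih).
by apply/funext => t; rewrite big_cons.
Qed.

Let diff_ext (g h : V -> R) : (forall t, g t = h t) -> diff g -> diff h.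
Proof. by move=> /funext->. Qed.

Let diff_A i j : diff (fun t => par_A t i j).
Proof.
apply: diff_ext (diff_coord (lshift p (lshift (hdim k) (mxtens_index (j, i))))) => t.
by rewrite !mxE.
Qed.

Let diff_Sff i j : diff (fun t => par_Sff t i j).
Proof.
pose F (t : V) := \sum_l dupl R k (mxtens_index (j, i)) l * t (lshift p (rshift (k * (p - k)) l)) 0.
apply: (@diff_ext F) => [t|].
  by rewrite !mxE; apply: eq_bigr => l _; congr (_ * _); rewrite !mxE.
by apply: diff_sum => l; apply: diffM; [exact: diff_cst|exact: diff_coord].
Qed.

Let diff_loading i j : diff (fun t => loading hkp t i j).
Proof.
rewrite /loading; set i' := cast_ord (esym (subnKC hkp)) i.
apply: (@diff_ext (fun t => col_mx 1%:M (par_A t) i' j)) => [t|].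
  by rewrite castmxE; congr (col_mx _ _ _ _); apply: val_inj.
case: (split_ordP i') => a ->.
  by apply: diff_ext (diff_cst _) => t; rewrite col_mxEu.
by apply: diff_ext (diff_A a j) => t; rewrite col_mxEd.
Qed.

Lemma differentiable_Sigma i j : diff (fun t => Sigma hkp t i j).
Proof.
apply: (@diff_ext (fun t => \sum_b (\sum_a loading hkp t i a * par_Sff t a b) *
    loading hkp t j b + t (rshift (k * (p - k) + hdim k) i) 0 *+ (i == j))) => [t|].
  rewrite [RHS]mxE; congr (_ + _); last by rewrite !mxE.
  by rewrite mxE; apply: eq_bigr => b _; rewrite !mxE.
apply: diffD.
  apply: diff_sum => b; apply: diffM; last exact: diff_loading.
  by apply: diff_sum => a; apply: diffM; [exact: diff_loading|exact: diff_Sff].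
by case: (i == j); [exact: diff_coord|exact: diff_cst].
Qed.

Lemma continuous_Sigma i j : continuous (fun t : V => Sigma hkp t i j).
Proof. by move=> x; exact: differentiable_continuous (differentiable_Sigma i j x). Qed.

Lemma continuous_Wmat i j : continuous (fun t : V => Wmat hkp t i j).
Proof.
move=> x; apply: (@differentiable_continuous _ _ _ _ (fun t : V => Wmat hkp t i j : R^o)).
apply: diff_ext x => [t|]; first by rewrite WmatE avarE.
by apply: diffD; apply: diffM; exact: differentiable_Sigma.
Qed.

(** [Delta] collects partial derivatives, whereas the minimum contrast argument works with a total
    derivative at [th0]. The entries of [Sigma] are differentiable, and a differential is determined
    by its values on the basis vectors. *)
Lemma Delta_expansion (th0 : V) (eps : R) : 0 < eps -> exists2 delta : R, 0 < delta &
  forall t, nrm1 t < delta ->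
    nrm1 (vech (Sigma hkp (th0 + t)) - vech (Sigma hkp th0) - Delta hkp th0 *m t) <=
    eps * nrm1 t.
Proof.
move=> eps0.
pose s l (t : V) : R^o := vech (Sigma hkp t) l 0.
have ds l x : differentiable (s l) x.
  rewrite (_ : s l = fun t => Sigma hkp t (tnth (lower_pos p) l).1 (tnth (lower_pos p) l).2).
    exact: differentiable_Sigma.
  by apply/funext => t; rewrite /s mxE.
have DE l t : (Delta hkp th0 *m t) l 0 = 'd (s l) th0 t.
  rewrite [in RHS](_ : t = \sum_j t j 0 *: delta_mx j 0).
    rewrite linear_sum mxE; apply: eq_bigr => j _.
    by rewrite linearZ/= -deriveE// mxE mulrC.
  by rewrite {1}[t]matrix_sum_delta; apply: eq_bigr => j _; rewrite big_ord1.
(* The [hdim p] coordinate errors are added up; the successor avoids dividing by zero. *)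
pose c : R := eps / (hdim p).+1%:R.
have c0 : 0 < c by rewrite divr_gt0.
pose Q l : set V := [set t | `|s l (th0 + t) - s l th0 - 'd (s l) th0 t| <= c * `|t|].
have near_l : \forall t \near (0 : V), forall l, Q l t.
  apply: (@filter_forall V _ Q (nbhs (0 : V)) (nbhs_filter _)) => l.
  have /eqaddoP h := diff_locally (ds l th0).
  apply: filterS (h _ c0) => t.
  rewrite -[X in X -> _]/(is_true (`|s l (t + th0) - (s l th0 + 'd (s l) th0 t)| <= c * `|t|)).
  by rewrite /Q/= opprD addrA (addrC t).
have /nbhs_ballP[delta /= delta0 hd] := near_l.
exists delta => // t td.
have := hd t; rewrite -ball_normE/= sub0r normrN => /(_ (le_lt_trans (norm_le_nrm1 t) td)) ht.
have n0 : 0 <= nrm1 t := nrm1_ge0 t.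
apply: (@le_trans _ _ (\sum_(l < hdim p) c * nrm1 t)).
  rewrite /nrm1; apply: ler_sum => l _; rewrite big_ord1.
  have := ht l; rewrite /Q/= -DE /s => h.
  apply: (@le_trans _ _ (c * `|t|)); last by rewrite ler_wpM2l ?norm_le_nrm1 ?(ltW c0).
  by apply: le_trans h; rewrite [in leRHS]/= !mxE.
rewrite sumr_const card_ord -mulrnAl ler_wpM2r// -mulr_natr /c mulrAC ler_pdivrMr//.
by rewrite ler_pM2l// ler_nat.
Qed.

Lemma Delta_inj (th0 : V) : \rank (Delta hkp th0) = qdim p k ->
  forall t : V, Delta hkp th0 *m t = 0 -> t = 0.
Proof.
move=> rk t Dt; have rf : row_free (Delta hkp th0)^T by rewrite /row_free mxrank_tr rk.
apply: trmx_inj; rewrite trmx0; apply: (row_free_inj rf).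
by rewrite mul0mx -trmx_mul Dt trmx0.
Qed.

End factor_model.

(** * Wiener increments *)

Lemma big_option (V : Type) (idx : V) (op : Monoid.com_law idx) (I : finType)
    (F : option I -> V) :
  \big[op/idx]_o F o = op (F None) (\big[op/idx]_i F (Some i)).
Proof.
rewrite (bigD1 None)//=; congr (op _ _).
rewrite (reindex_omap Some id) => [|[i|]]//.
by apply: eq_bigl => i; rewrite eqxx.
Qed.

Section wiener_partition.
Context d (Omega : measurableType d) (R : realType) (P : probability Omega R).
Variable T : R.

Lemma sigma_of_bigsetI (I J : Type) (D : set I) (X : I -> Omega -> R) (s : seq J)
    (A : J -> set Omega) :
  (forall j, sigma_of D X (A j)) -> sigma_of D X (\big[setI/setT]_(j <- s) A j).
Proof.
move=> h; apply: (@bigsetI_measurable _ (g_sigma_algebraType (sigma_of_gen D X))) => j _.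
exact: h.
Qed.

Lemma sigma_of_increment (B : R -> Omega -> R) s t u (U : set R) :
  0 <= s -> s <= t -> t <= u -> measurable U ->
  sigma_of `[0, u] B ((fun w => B t w - B s w) @^-1` U).
Proof.
move=> s0 st tu mU.
suff : measurable_fun (setT : set (g_sigma_algebraType (sigma_of_gen `[0, u] B)))
    (fun w => B t w - B s w) by move=> /(_ measurableT U mU); rewrite setTI.
apply: measurable_funB.
- by apply: (@sigma_of_measurable_fun _ _ _ _ `[0, u] B t); rewrite /= in_itv/=; lra.
- by apply: (@sigma_of_measurable_fun _ _ _ _ `[0, u] B s); rewrite /= in_itv/=; lra.
Qed.

Lemma wiener1_partition_indep (B : R -> Omega -> R) (t : nat -> R) n (U : nat -> set R) :
  wiener1 P T B -> 0 <= t 0%N -> (forall i, t i < t i.+1) -> t n <= T ->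
  (forall i, measurable (U i)) ->
  P (\big[setI/setT]_(i < n) ((fun w => B (t i.+1) w - B (t i) w) @^-1` U i)) =
  (\prod_(i < n) fine (P ((fun w => B (t i.+1) w - B (t i) w) @^-1` U i)))%:E.
Proof.
move=> hB t0 tS tT mU.
have t_mono : {homo t : i j / (i <= j)%N >-> i <= j}.
  by apply: homo_leq => [//|y x z|i]; [exact: le_trans|exact: ltW].
have t_ge0 i : 0 <= t i by rewrite (le_trans t0)// t_mono.
elim: n tT => [|n ih] tT; first by rewrite !big_ord0 probability_setT.
have tnT : t n <= T by rewrite (le_trans _ tT)// ltW.
rewrite !big_ord_recr/= setIC EFinM muleC -ih//.
have [mB _ _ /(_ _ _ (t_ge0 n) (tS n) tT)[_ hi]] := hB.
rewrite hi//; last first.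
  apply: sigma_of_bigsetI => i; apply: sigma_of_increment => //; first exact: ltW.
  exact: t_mono.
congr (_ * _)%E; rewrite fineK// fin_num_measure//.
rewrite -[X in measurable X]setTI.
suff : measurable_fun setT (fun w => B (t n.+1) w - B (t n) w) by apply.
apply: measurable_funB; apply: mB; rewrite t_ge0//=.
Qed.

Definition indep_sigma (C : finType) (Z : C -> R -> Omega -> R) :=
  forall E : C -> set Omega, (forall c, sigma_of `[0, T] (Z c) (E c)) ->
    P (\big[setI/setT]_c E c) = (\prod_c fine (P (E c)))%:E.

(** [W] enters [wiener_indep] as one block. Its event is an intersection of coordinate events, whose
    probability splits again by the independence of the coordinates. *)
Lemma wiener_indep_sigma (r p : nat) (W : R -> Omega -> 'cV[R]_r) (B : 'I_p -> R -> Omega -> R) :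
  wiener P T W -> wiener_indep P T W B ->
  indep_sigma (fun c : 'I_r + 'I_p =>
    match c with inl j => fun t w => W t w j 0 | inr i => B i end).
Proof.
move=> [_ hW] hWB E hE; rewrite !big_sumType/=.
have h1 := hW (finset.setTfor 'I_r) (fun j => E (inl j)) (fun j _ => hE (inl j)).
pose A (o : option 'I_p) := if o is Some i then E (inr i) else \big[setI/setT]_j E (inl j).
have h2 := hWB (finset.setTfor (option 'I_p)) A.
have allT (V : Type) (idx : V) (op : V -> V -> V) (I : finType) (F : I -> V) :
    \big[op/idx]_(i in finset.setTfor I) F i = \big[op/idx]_i F i.
  by apply: eq_bigl => i; rewrite finset.in_setT.
rewrite !allT in h1; rewrite !allT in h2.
rewrite !big_option/= h1 in h2.
rewrite h2//= => -[i _|_]; first exact: (hE (inr i)).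
apply: sigma_of_bigsetI => j; apply: sub_sigma_algebra2 (hE (inl j)) => F [t tT [U mU ->]].
by exists (t, j) => //; exists U.
Qed.

Hypothesis T0 : 0 < T.

Definition unit_incr (n : nat) (B : R -> Omega -> R) (i : nat) (w : Omega) : R :=
  Num.sqrt (n%:R / T) * (B (grid T n i.+1) w - B (grid T n i) w).

Let unit_incr_preimage n B i U : unit_incr n B i @^-1` U =
  (fun w => B (grid T n i.+1) w - B (grid T n i) w) @^-1`
    ((fun x => Num.sqrt (n%:R / T) * x) @^-1` U).
Proof. by []. Qed.

Let measurable_scale (c : R) U : measurable U -> measurable ((fun x : R => c * x) @^-1` U).
Proof.
move=> mU; rewrite -[X in measurable X]setTI.
have mc : measurable_fun setT (fun x : R => c * x) by exact: measurable_funM.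
exact: mc measurableT U mU.
Qed.

Let gridD n i : (0 < n)%N -> grid T n i < grid T n i.+1.
Proof. by move=> n0; rewrite -subr_gt0 gridS divr_gt0// ltr0n. Qed.

Let grid0 n i : 0 <= grid T n i.
Proof. by rewrite /grid mulr_ge0// divr_ge0// ltW. Qed.

Let gridn n : (0 < n)%N -> grid T n n = T.
Proof. by move=> n0; rewrite /grid mulrC divfK// pnatr_eq0 -lt0n. Qed.

Lemma unit_incr_normal n B i : wiener1 P T B -> (i < n)%N -> normal_rv P (unit_incr n B i) 1.
Proof.
move=> hB iltn; have n0 : (0 < n)%N by exact: leq_ltn_trans iltn.
have nR : (0 : R) < n%:R by rewrite ltr0n.
have /andP[_ gT] := gridP T0 n0 iltn.
have h := wiener1_increment_normal hB (grid0 n i) (gridD i n0) gT.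
rewrite gridS in h; have v0 : 0 <= T / n%:R by rewrite divr_ge0 ?ltW.
have := normal_rv_scale (Num.sqrt (n%:R / T)) v0 h.
rewrite [X in normal_rv _ _ X](_ : _ = 1)//.
rewrite sqr_sqrtr; last by rewrite divr_ge0 ?ltW.
by field; rewrite !gt_eqF.
Qed.

Lemma unit_incr_indep1 n B : (0 < n)%N -> wiener1 P T B ->
  indep_family P (fun i : 'I_n => unit_incr n B i).
Proof.
move=> n0 hB U mU.
(* Indices beyond n receive [setT], since the partition lemma takes a family indexed by [nat]. *)
pose V i := (fun x => Num.sqrt (n%:R / T) * x) @^-1` (if insub i is Some j then U j else setT).
have mV i : measurable (V i).
  by apply: measurable_scale; case: insub => [j|]; [exact: mU|exact: measurableT].
have VE (i : 'I_n) : V i = (fun x => Num.sqrt (n%:R / T) * x) @^-1` U i.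
  by rewrite /V valK.
have gT : grid T n n <= T by rewrite gridn.
have h := wiener1_partition_indep hB (grid0 n 0) (fun i => gridD i n0) gT mV.
rewrite (eq_bigr (fun i : 'I_n =>
  (fun w => B (grid T n i.+1) w - B (grid T n i) w) @^-1` V i)) => [|i _]; last by rewrite VE.
by rewrite h; congr EFin; apply: eq_bigr => i _; rewrite VE.
Qed.

(** For each process, the conditions on its grid increments form one event of its sigma-algebra; the
    product therefore splits over the processes first and over time afterwards. *)
Lemma unit_incr_indep (C : finType) (Z : C -> R -> Omega -> R) n : (0 < n)%N ->
  (forall c, wiener1 P T (Z c)) -> indep_sigma Z ->
  indep_family P (fun ic : 'I_n * C => unit_incr n (Z ic.2) ic.1).
Proof.
move=> n0 hZ ind U mU.
rewrite (eq_bigr (fun p : 'I_n * C => unit_incr n (Z p.2) p.1 @^-1` U (p.1, p.2))) => [|[]//].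
rewrite -(pair_bigA _ (fun (i : 'I_n) (c : C) => unit_incr n (Z c) i @^-1` U (i, c))) exchange_big/=.
rewrite ind => [|c]; last first.
  apply: sigma_of_bigsetI => i; have /andP[_ gT] := gridP T0 n0 (ltn_ord i).
  rewrite unit_incr_preimage; apply: sigma_of_increment => //.
  - exact: ltW (gridD _ _).
  - exact: measurable_scale.
rewrite [in RHS](eq_bigr (fun p : 'I_n * C =>
  fine (P (unit_incr n (Z p.2) p.1 @^-1` U (p.1, p.2))))) => [|[]//].
rewrite -(pair_bigA _ (fun (i : 'I_n) (c : C) => fine (P (unit_incr n (Z c) i @^-1` U (i, c))))).
rewrite exchange_big/=; congr EFin; apply: eq_bigr => c _.
by rewrite (unit_incr_indep1 n0 (hZ c)).
Qed.

End wiener_partition.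

Section primitives.
Context {R : realType}.
Variable T : R.
Hypothesis T0 : 0 < T.
Local Notation mu := (@lebesgue_measure R).

(** A path with continuous derivative, given by its density: the equations provide this form
    directly, and no derivative at the endpoints is involved. *)
Definition c1_primitive (x : R -> R) := exists a x0,
  {within `[0, T], continuous a} /\
  forall t, 0 <= t <= T -> x t = x0 + \int[mu]_(s in `[0, t]) a s.

Let integrable0 (a : R -> R) t : {within `[0, T], continuous a} -> t <= T ->
  mu.-integrable `[0, t] (EFin \o a).
Proof.
move=> ca tT; apply: continuous_compact_integrable; first exact: segment_compact.
apply: continuous_subspaceW ca => u /=; rewrite !in_itv/= => /andP[-> ut].
exact: le_trans tT.
Qed.

Lemma c1_primitiveD x y : c1_primitive x -> c1_primitive y ->
  c1_primitive (fun t => x t + y t).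
Proof.
move=> [a [x0 [ca hx]]] [b [y0 [cb hy]]]; exists (fun s => a s + b s), (x0 + y0); split.
  by move=> s; apply: cvgD; [exact: ca|exact: cb].
move=> t tT; have /andP[_ tT'] := tT.
rewrite hx// hy// RintegralD//; [by rewrite addrACA|exact: integrable0|exact: integrable0].
Qed.

Lemma c1_primitiveZ c x : c1_primitive x -> c1_primitive (fun t => c * x t).
Proof.
move=> [a [x0 [ca hx]]]; exists (fun s => c * a s), (c * x0); split.
  by move=> s; apply: cvgM; [exact: cvg_cst|exact: ca].
move=> t tT; have /andP[_ tT'] := tT.
by rewrite hx// RintegralZl ?mulrDr//; exact: integrable0.
Qed.

Lemma c1_primitive_sum (I : Type) (s : seq I) (x : I -> R -> R) :
  (forall i, c1_primitive (x i)) -> c1_primitive (fun t => \sum_(i <- s) x i t).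
Proof.
move=> hx; elim: s => [|i s ih].
  exists (fun=> 0), 0; split=> [t|t _]; first exact: cvg_cst.
  by rewrite big_nil add0r /Rintegral integral0_eq.
rewrite (_ : (fun t => _) = fun t => x i t + \sum_(j <- s) x j t).
  exact: c1_primitiveD.
by apply/funext => t; rewrite big_cons.
Qed.

Lemma c1_primitive_ext x y : (forall t, 0 <= t <= T -> x t = y t) ->
  c1_primitive x -> c1_primitive y.
Proof.
by move=> xy [a [x0 [ca hx]]]; exists a, x0; split=> // t tT; rewrite -xy// hx.
Qed.

Lemma quadratic_variation_drift (x1 x2 z1 z2 : R -> R) :
  c1_primitive (fun t => x1 t - z1 t) -> c1_primitive (fun t => x2 t - z2 t) ->
  {within `[0, T], continuous z1} -> {within `[0, T], continuous z2} ->
  forall eps : R, 0 < eps -> exists N, forall n, (N <= n)%N ->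
    Num.sqrt n%:R * `|\sum_(i < n) incr T x1 n i * incr T x2 n i -
                      \sum_(i < n) incr T z1 n i * incr T z2 n i| <=
    eps * (1 + \sum_(i < n) incr T z1 n i ^+ 2 + \sum_(i < n) incr T z2 n i ^+ 2).
Proof.
move=> [a1 [x01 [ca1 h1]]] [a2 [x02 [ca2 h2]]] cz1 cz2 eps eps0.
have [K1 _ hK1] := within_bounded T0 cz1; have [K2 _ hK2] := within_bounded T0 cz2.
(* The three sums contribute e, e (1 + sqrt V2) and e (1 + sqrt V1); since sqrt V <= 1 + V, the
   total is at most 5 e + e (V1 + V2). *)
pose e := eps / 5; have e0 : 0 < e by rewrite divr_gt0.
have [K hK] := drift_lipschitz T0 ca2 h2.
have [N1 hN1] := drift_product T0 ca1 h1 hK e0.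
have [N2 hN2] := drift_noise_product T0 ca1 h1 hK2 e0.
have [N3 hN3] := drift_noise_product T0 ca2 h2 hK1 e0.
exists (maxn N1 (maxn N2 N3)) => n; rewrite !geq_max => /and3P[/hN1 i1 /hN2 i2 /hN3 i3].
set V1 := \sum_(i < n) incr T z1 n i ^+ 2; set V2 := \sum_(i < n) incr T z2 n i ^+ 2.
have V10 : 0 <= V1 by apply: sumr_ge0 => i _; exact: sqr_ge0.
have V20 : 0 <= V2 by apply: sumr_ge0 => i _; exact: sqr_ge0.
have sq (v : R) : 0 <= v -> Num.sqrt v <= 1 + v.
  move=> v0; have := sqr_sqrtr v0; have := sqrtr_ge0 v.
  by set q := Num.sqrt v => q0 <-; nra.
rewrite -/V1 -/V2 in i2 i3.
rewrite -sumrB.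
rewrite (_ : \sum_(i < n) _ =
  \sum_(i < n) incr T (fun t => x1 t - z1 t) n i * incr T (fun t => x2 t - z2 t) n i +
  \sum_(i < n) incr T (fun t => x1 t - z1 t) n i * incr T z2 n i +
  \sum_(i < n) incr T (fun t => x2 t - z2 t) n i * incr T z1 n i); last first.
  by rewrite -!big_split/=; apply: eq_bigr => i _; rewrite /incr; ring.
set A := \sum_(i < n) _ in i1 *; set A2 := \sum_(i < n) _ in i2 *.
set A3 := \sum_(i < n) _ in i3 *.
have s0 : 0 <= Num.sqrt (n%:R : R) := sqrtr_ge0 _.
have tri : `|A + A2 + A3| <= `|A| + `|A2| + `|A3|.
  by rewrite (le_trans (ler_normD _ _))// lerD2r ler_normD.
apply: le_trans (ler_wpM2l s0 tri) _; rewrite !mulrDr mulr1.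
have p1 := ler_wpM2l (ltW e0) (sq _ V10); have p2 := ler_wpM2l (ltW e0) (sq _ V20).
have eE : eps = 5 * e by rewrite /e; field.
have n1 := mulr_ge0 (ltW e0) V10; have n2 := mulr_ge0 (ltW e0) V20.
by rewrite eE; move: e0 i1 i2 i3 p1 p2 n1 n2; clear; clearbody e; lra.
Qed.

End primitives.

(** * Stochastic orders of magnitude *)

Section stochastic_order.
Context {R : realType} d (Omega : measurableType d) (P : probability Omega R).
Implicit Types X Y : nat -> Omega -> R.

(* X_n = o_P(1) and X_n = O_P(1).  The exceptional event A is only required to
   contain the set where the bound fails, so X n need not be measurable. *)
Definition oP1 X := forall eps : R, 0 < eps -> exists N, forall n, (N <= n)%N ->
  exists A, [/\ measurable A, (P A <= eps%:E)%E & forall w, ~ A w -> `|X n w| <= eps].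
Definition OP1 X := forall eps : R, 0 < eps -> exists2 L : R, 0 < L &
  exists N, forall n, (N <= n)%N ->
  exists A, [/\ measurable A, (P A <= eps%:E)%E & forall w, ~ A w -> `|X n w| <= L].

Let union_bound A B (e1 e2 : R) : measurable A -> measurable B ->
  (P A <= e1%:E)%E -> (P B <= e2%:E)%E -> (P (A `|` B) <= (e1 + e2)%:E)%E.
Proof.
move=> mA mB PA PB; rewrite EFinD.
exact: le_trans (measureU2 _ mA mB) (leeD PA PB).
Qed.

Lemma oP1_le X Y : oP1 X -> (exists N, forall n w, (N <= n)%N -> `|Y n w| <= `|X n w|) -> oP1 Y.
Proof.
move=> hX [M hM] eps /hX[N hN]; exists (maxn M N) => n; rewrite geq_max => /andP[Mn /hN[A [mA PA hA]]].
by exists A; split=> // w /hA; apply: le_trans; exact: hM.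
Qed.

Lemma OP1_le X Y : OP1 X -> (exists N, forall n w, (N <= n)%N -> `|Y n w| <= `|X n w|) -> OP1 Y.
Proof.
move=> hX [M hM] eps /hX[L L0 [N hN]]; exists L => //.
exists (maxn M N) => n; rewrite geq_max => /andP[Mn /hN[A [mA PA hA]]].
by exists A; split=> // w /hA; apply: le_trans; exact: hM.
Qed.

Lemma oP1D X Y : oP1 X -> oP1 Y -> oP1 (fun n w => X n w + Y n w).
Proof.
move=> hX hY eps eps0; have e2 : 0 < eps / 2 by rewrite divr_gt0.
have [N1 h1] := hX _ e2; have [N2 h2] := hY _ e2.
exists (maxn N1 N2) => n; rewrite geq_max => /andP[/h1[A [mA PA hA]] /h2[B [mB PB hB]]].
exists (A `|` B); split; first exact: measurableU.
  by rewrite [eps]splitr; exact: union_bound.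
move=> w /not_orP[/hA a /hB b]; rewrite (le_trans (ler_normD _ _))// [leRHS]splitr.
exact: lerD.
Qed.

Lemma OP1D X Y : OP1 X -> OP1 Y -> OP1 (fun n w => X n w + Y n w).
Proof.
move=> hX hY eps eps0; have e2 : 0 < eps / 2 by rewrite divr_gt0.
have [L1 L10 [N1 h1]] := hX _ e2; have [L2 L20 [N2 h2]] := hY _ e2.
exists (L1 + L2); first exact: addr_gt0.
exists (maxn N1 N2) => n; rewrite geq_max => /andP[/h1[A [mA PA hA]] /h2[B [mB PB hB]]].
exists (A `|` B); split; first exact: measurableU.
  by rewrite [eps]splitr; exact: union_bound.
by move=> w /not_orP[/hA a /hB b]; rewrite (le_trans (ler_normD _ _))// lerD.
Qed.

Lemma OP1Z (c : R) X : OP1 X -> OP1 (fun n w => c * X n w).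
Proof.
move=> hX eps /hX[L L0 [N hN]]; exists (`|c| * L + 1).
  by rewrite ltr_wpDl// mulr_ge0// ltW.
exists N => n /hN[A [mA PA hA]]; exists A; split=> // w /hA XL.
by rewrite normrM ler_wpDr// ler_wpM2l.
Qed.

Lemma OP1_cst (c : R) : OP1 (fun=> fun=> c).
Proof.
move=> eps eps0; exists (`|c| + 1); first by rewrite ltr_wpDl.
exists 0%N => n _; exists set0; split=> //; first by rewrite measure0 lee_fin ltW.
by move=> w _; rewrite lerDl.
Qed.

Lemma oP1_0 : oP1 (fun=> fun=> 0).
Proof.
move=> eps eps0; exists 0%N => n _; exists set0; split=> //.
  by rewrite measure0 lee_fin ltW.
by move=> w _; rewrite normr0 ltW.
Qed.

Lemma oP1_sum (I : Type) (s : seq I) (X : I -> nat -> Omega -> R) :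
  (forall i, oP1 (X i)) -> oP1 (fun n w => \sum_(i <- s) X i n w).
Proof.
move=> hX; elim: s => [|i s ih].
  by apply: oP1_le oP1_0 _; exists 0%N => n w _; rewrite big_nil.
apply: oP1_le (oP1D (hX i) ih) _; exists 0%N => n w _; by rewrite big_cons.
Qed.

Lemma OP1_sum (I : Type) (s : seq I) (X : I -> nat -> Omega -> R) :
  (forall i, OP1 (X i)) -> OP1 (fun n w => \sum_(i <- s) X i n w).
Proof.
move=> hX; elim: s => [|i s ih].
  by apply: OP1_le (OP1_cst 0) _; exists 0%N => n w _; rewrite big_nil.
apply: OP1_le (OP1D (hX i) ih) _; exists 0%N => n w _; by rewrite big_cons.
Qed.

Lemma oP1_OP1 X : oP1 X -> OP1 X.
Proof.
move=> hX eps eps0; exists eps => //; have [N hN] := hX _ eps0.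
by exists N.
Qed.

Lemma oP1M X Y : oP1 X -> OP1 Y -> oP1 (fun n w => X n w * Y n w).
Proof.
move=> hX hY eps eps0; have e2 : 0 < eps / 2 by rewrite divr_gt0.
have [L L0 [N1 h1]] := hY _ e2.
pose e := Num.min (eps / 2) (eps / L).
have e0 : 0 < e by rewrite lt_min e2 divr_gt0.
have [N2 h2] := hX _ e0.
exists (maxn N1 N2) => n; rewrite geq_max => /andP[/h1[A [mA PA hA]] /h2[B [mB PB hB]]].
exists (A `|` B); split; first exact: measurableU.
  rewrite [eps]splitr; apply: union_bound => //.
  by rewrite (le_trans PB)// lee_fin ge_min lexx.
move=> w /not_orP[/hA a /hB b]; rewrite normrM.
apply: (@le_trans _ _ (eps / L * L)); last by rewrite divfK// gt_eqF.
by apply: ler_pM => //; rewrite (le_trans b)// ge_min lexx orbT.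
Qed.

Lemma oP1_cvg (u : nat -> R) : u @ \oo --> (0 : R) -> oP1 (fun n _ => u n).
Proof.
move=> /cvgrPdist_le hu eps eps0; have [N _ hN] := hu _ eps0.
exists N => n Nn; exists set0; split=> //; first by rewrite measure0 lee_fin ltW.
by move=> w _; have := hN n Nn; rewrite /= sub0r normrN.
Qed.

Lemma measurable_gt (Y : Omega -> R) (c : R) : measurable_fun setT Y ->
  measurable [set w | c < Y w].
Proof.
move=> mY; rewrite (_ : [set w | _] = setT `&` Y @^-1` `]c, +oo[%classic).
  exact: mY.
by rewrite setTI; apply/seteqP; split=> w /=; rewrite in_itv/= andbT.
Qed.

Lemma markov_mean (Y : Omega -> R) (v c : R) : (forall w, 0 <= Y w) -> 0 < c ->
  mean_is P Y v -> (P [set w | (c < Y w)%R] <= (v / c)%:E)%E.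
Proof.
move=> Y0 c0 hY.
have mA := measurable_gt c (mean_is_measurable hY).
rewrite -[P _]fineK ?fin_num_measure// lee_fin ler_pdivlMr// mulrC.
apply: mean_is_le (mean_isZ c (mean_is_indic P mA)) hY => w; rewrite indicE.
by have [/set_mem/= /ltW|_] := boolP (w \in _); rewrite ?mulr1 ?mulr0.
Qed.

Lemma OP1_mean_sqr X (v : R) :
  (exists N, forall n, (N <= n)%N -> mean_is P (fun w => X n w ^+ 2) v) -> OP1 X.
Proof.
move=> [N hN] eps eps0.
have v0 : 0 <= v.
  by apply: mean_is_le (mean_is_cst P 0) (hN _ (leqnn N)) => w; exact: sqr_ge0.
(* Markov's inequality asks for L^2 >= v / eps. *)
pose L := 1 + v / eps; have L0 : 0 < L by rewrite ltr_pwDl// divr_ge0// ltW.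
exists L => //; exists N => n /hN h.
exists [set w | L ^+ 2 < X n w ^+ 2]; split.
- exact: measurable_gt (mean_is_measurable h).
- apply: le_trans (markov_mean (fun w => sqr_ge0 _) (exprn_gt0 2 L0) h) _.
  rewrite lee_fin ler_pdivrMr ?exprn_gt0//.
  have -> : v = eps * (v / eps) by field; rewrite gt_eqF.
  rewrite ler_wpM2l ?(ltW eps0)//.
  have : 0 <= v / eps by rewrite divr_ge0// ltW.
  by rewrite /L; move: (v / eps) => q q0; nra.
- move=> w /= /negP; rewrite -leNgt -[X n w ^+ 2]real_normK ?num_real//.
  by rewrite ler_pXn2r ?nnegrE// ltW.
Qed.

(** The threshold N depends on w. Egorov's theorem, applied to |X n| / Y n, makes it uniform outside
    an event of small probability; the tight factor [Y] is then multiplied back. *)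
Lemma oP1_ae_dominated X Y : (forall n, measurable_fun setT (X n)) ->
  (forall n, measurable_fun setT (Y n)) -> (forall n w, 1 <= Y n w) -> OP1 Y ->
  {ae P, forall w, forall eps : R, 0 < eps -> exists N, forall n, (N <= n)%N ->
    `|X n w| <= eps * Y n w} -> oP1 X.
Proof.
move=> mX mY Y1 tY XY.
(* A continuous function on the whole line that agrees with 1 / x for x >= 1, which makes the
   quotient measurable. *)
pose ic (x : R) := (Num.max 1 x)^-1.
have m1 (x : R) : 0 < Num.max 1 x by rewrite lt_max ltr01.
have cic : continuous ic.
  move=> x; apply: continuous_comp; last by apply: inv_continuous; rewrite gt_eqF.
  by apply: continuous_max; [exact: cst_continuous|exact: cvg_id].
pose D n w := `|X n w| * ic (Y n w).
have icE n w : ic (Y n w) = (Y n w)^-1 by rewrite /ic max_r.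
have Yp n w : 0 < Y n w by exact: lt_le_trans (Y1 n w).
have mD n : measurable_fun setT (D n).
  apply: measurable_funM; first exact: measurableT_comp.
  by apply: measurableT_comp => //; exact: continuous_measurable_fun.
suff hD : oP1 D.
  apply: oP1_le (oP1M hD tY) _; exists 0%N => n w _.
  by rewrite /D icE divfK ?gt_eqF// normr_id.
move=> eps eps0.
have aeD : {ae P, forall w, setT w -> D ^~ w @ \oo --> (0 : R)}.
  apply: filterS XY => w h _; apply/cvgrPdist_le => e /h[N hN].
  exists N => // n /= /hN; rewrite sub0r normrN /D icE normrM normr_id.
  by rewrite (gtr0_norm (x := (Y n w)^-1)) ?invr_gt0// ler_pdivrMr.
have finP : (P setT < +oo)%E by rewrite probability_setT ltry.
have [B [mB PB uB]] := ae_pointwise_almost_uniform mD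
  (@measurable_cst _ _ _ _ setT (0 : R)) measurableT finP aeD eps0.
have : \forall n \near \oo, forall w, (setT `\` B) w -> `|D n w| <= eps.
  apply: (uB [set h | forall w, (setT `\` B) w -> `|h w| <= eps]).
  apply/uniform_nbhs; exists [set xy | ball xy.1 eps xy.2]; split.
    exact: (entourage_ball _ (PosNum eps0)).
  move=> h /= hh w Bw; have := hh w Bw.
  by rewrite -ball_normE/= sub0r normrN => /ltW.
move=> [N _ hN]; exists N => n Nn; exists B; split=> //; first exact: ltW.
by move=> w Bw; apply: hN.
Qed.

End stochastic_order.

(** * The fluctuations of the realized covariation *)

Section expansion.
Context (R : realType) (k p r : nat) (hkp : (k <= p)%N).
Context (theta0 : 'cV[R]_(qdim p k)) (S0 : 'M[R]_(k, r)) (T : R).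
Hypothesis T0 : 0 < T.
Context d (Omega : measurableType d) (P : probability Omega R).
Context (W : R -> Omega -> 'cV[R]_r) (B : 'I_p -> R -> Omega -> R).
Hypotheses (hW : wiener P T W) (hB : forall i, wiener1 P T (B i)).
Hypothesis hWB : wiener_indep P T W B.
Context (c1 : 'cV[R]_k) (c2 : 'cV[R]_p).
Context (b0 : 'cV[R]_k -> 'cV[R]_k) (B0 : 'I_p -> R -> R).
Context (f : R -> Omega -> 'cV[R]_k) (e : R -> Omega -> 'cV[R]_p).
Hypothesis hf : forall j, solves_sde P T (c1 j 0) (fun t w => b0 (f t w) j 0)
  (fun t w => (S0 *m W t w) j 0) (fun t w => f t w j 0).
Hypothesis he : forall i, solves_sde P T (c2 i 0) (fun t w => B0 i (e t w i 0))
  (fun t w => par_sigma theta0 i * B i t w) (fun t w => e t w i 0).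
Context (X : R -> Omega -> 'cV[R]_p).
Hypothesis hX : forall t w, 0 <= t <= T ->
  X t w = loading hkp theta0 *m f t w + e t w.
Hypothesis cb0 : forall j, continuous (fun x => b0 x j 0).
Hypothesis cB0 : forall i, continuous (B0 i).

Definition source (c : 'I_r + 'I_p) : R -> Omega -> R :=
  match c with inl j => fun t w => W t w j 0 | inr i => B i end.

Definition coef (l : 'I_p) (c : 'I_r + 'I_p) : R := noise_mx hkp S0 theta0 l (fintype.unsplit c).

Definition noise (l : 'I_p) (t : R) (w : Omega) : R := \sum_c coef l c * source c t w.

Let noiseE l t w : noise l t w =
  (loading hkp theta0 *m (S0 *m W t w)) l 0 + par_sigma theta0 l * B l t w.
Proof.
rewrite /noise big_sumType/=; congr (_ + _).
  rewrite mulmxA mxE; apply: eq_bigr => j _.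
  by rewrite /coef /= row_mxEl.
rewrite (bigD1 l)//= big1 ?addr0 => [|i il]; rewrite /coef /= row_mxEr !mxE.
  by rewrite eqxx.
by rewrite eq_sym (negbTE il) mul0r.
Qed.

Lemma within_continuous_sum (I : Type) (s : seq I) (x : I -> R -> R) (c : I -> R) :
  (forall i, {within `[0, T], continuous (x i)}) ->
  {within `[0, T], continuous (fun t => \sum_(i <- s) c i * x i t)}.
Proof.
move=> cx; elim: s => [|i s ih].
  rewrite (_ : (fun t => _) = fun=> 0) => [t|]; first exact: cvg_cst.
  by apply/funext => t; rewrite big_nil.
rewrite (_ : (fun t => _) = fun t => c i * x i t + \sum_(j <- s) c j * x j t) => [t|].
  by apply: cvgD; [apply: cvgM; [exact: cvg_cst|exact: cx]|exact: ih].
by apply/funext => t; rewrite big_cons.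
Qed.

(** X - noise is Lambda (f - S0 W) + (e - sigma B). On almost every path each bracket is an initial
    value plus the integral of a drift evaluated along a continuous path. *)
Lemma drift_ae : {ae P, forall w, forall l,
  c1_primitive T (fun t => X t w l 0 - noise l t w) /\
  {within `[0, T], continuous (fun t => noise l t w)}}.
Proof.
have aeZ : {ae P, forall w, forall c, {within `[0, T], continuous (fun t => source c t w)}}.
  apply: filter_forall => -[j|i]; first by have [_ _ h _] := hW.1 j.
  by have [_ _ h _] := hB i.
have aef := filter_forall (ae_filter_ringOfSetsType P) (fun j => (hf j).2).
have aee := filter_forall (ae_filter_ringOfSetsType P) (fun i => (he i).2).
near=> w.
have cZ : forall c, {within `[0, T], continuous (fun t => source c t w)} by near: w.
have sf : forall j, {within `[0, T], continuous (fun t => f t w j 0)} /\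
    forall t, 0 <= t <= T -> f t w j 0 = c1 j 0 +
      \int[lebesgue_measure]_(s in `[0, t]) b0 (f s w) j 0 + (S0 *m W t w) j 0 by near: w.
have se : forall i, {within `[0, T], continuous (fun t => e t w i 0)} /\
    forall t, 0 <= t <= T -> e t w i 0 = c2 i 0 +
      \int[lebesgue_measure]_(s in `[0, t]) B0 i (e s w i 0) +
      par_sigma theta0 i * B i t w by near: w.
move=> l; split; last exact: within_continuous_sum.
have cf : {within `[0, T], continuous (fun t => f t w)}.
  move=> t; apply: continuous_mx => i j; rewrite (ord1 j); exact: (sf i).1.
have pf j : c1_primitive T (fun t => f t w j 0 - (S0 *m W t w) j 0).
  exists (fun t => b0 (f t w) j 0), (c1 j 0); split=> [t|t tT].
    exact: (continuous_comp (cf t) (cb0 (x := _))).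
  by rewrite (sf j).2// addrK.
have pe : c1_primitive T (fun t => e t w l 0 - par_sigma theta0 l * B l t w).
  exists (fun t => B0 l (e t w l 0)), (c2 l 0); split=> [t|t tT].
    exact: (continuous_comp ((se l).1 t) (cB0 (x := _))).
  by rewrite (se l).2// addrK.
have := c1_primitiveD (c1_primitive_sum (index_enum 'I_k)
  (fun j => c1_primitiveZ (loading hkp theta0 l j) (pf j))) pe.
apply: c1_primitive_ext => // t tT.
rewrite hX// noiseE mxE opprD addrACA; congr (_ + _).
by rewrite !mxE -sumrB; apply: eq_bigr => j _; rewrite mulrBr.
Unshelve. all: by end_near. Qed.

Definition std_incr (n : nat) (ic : 'I_n * ('I_r + 'I_p)) (w : Omega) : R :=
  unit_incr T n (source ic.2) ic.1 w.

(* sqrt n times the entry (l, m) of Q~ - Sigma_0, where Q~ is the realized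
   covariation of the driftless part of X. *)
Definition fluct (n : nat) (l m : 'I_p) (w : Omega) : R :=
  (Num.sqrt n%:R)^-1 * \sum_(i < n)
    (row_form (@std_incr n) coef i l w * row_form (@std_incr n) coef i m w - gram coef l m).

Let source_wiener c : wiener1 P T (source c).
Proof. by case: c => [j|i]; [exact: hW.1|exact: hB]. Qed.

Let source_indep : indep_sigma P T source.
Proof. exact: wiener_indep_sigma. Qed.

Lemma std_incr_normal n ic : normal_rv P (@std_incr n ic) 1.
Proof. exact: (unit_incr_normal T0 (source_wiener ic.2) (ltn_ord ic.1)). Qed.

Lemma std_incr_indep n : (0 < n)%N -> indep_family P (@std_incr n).
Proof. by move=> n0; exact: (unit_incr_indep T0 n0 source_wiener source_indep). Qed.

Lemma gram_coef l m : gram coef l m = (noise_mx hkp S0 theta0 *m (noise_mx hkp S0 theta0)^T) l m.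
Proof.
rewrite mxE /gram (reindex (@fintype.unsplit r p)); last first.
  by apply: onW_bij; exists (@fintype.split r p); [exact: unsplitK|exact: splitK].
by apply: eq_bigr => c _; congr (_ * _); rewrite [RHS]mxE.
Qed.

Lemma incr_noise n (i : 'I_n) l w : (0 < n)%N ->
  incr T (fun t => noise l t w) n i = Num.sqrt (T / n%:R) * row_form (@std_incr n) coef i l w.
Proof.
move=> n0; have nR : (0 : R) < n%:R by rewrite ltr0n.
have s1 : Num.sqrt (T / n%:R) * Num.sqrt (n%:R / T) = 1.
  rewrite -sqrtrM ?divr_ge0 ?ltW// (_ : T / n%:R * (n%:R / T) = 1) ?sqrtr1//.
  by field; rewrite !gt_eqF.
rewrite row_formE /incr /noise -sumrB mulr_sumr; apply: eq_bigr => c _.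
by rewrite /std_incr /unit_incr /= -mulrBr -[LHS]mul1r -[X in X * _ = _]s1; ring.
Qed.

Lemma sum_incr_noise n l m w : (0 < n)%N ->
  \sum_(i < n) incr T (fun t => noise l t w) n i * incr T (fun t => noise m t w) n i =
  T * (gram coef l m + (Num.sqrt n%:R)^-1 * fluct n l m w).
Proof.
move=> n0; have nR : (0 : R) < n%:R by rewrite ltr0n.
have q0 : 0 < Num.sqrt (n%:R : R) by rewrite sqrtr_gt0.
have q2 : Num.sqrt (n%:R : R) ^+ 2 = n%:R by rewrite sqr_sqrtr// ltW.
rewrite /fluct sumrB sumr_const card_ord -[gram coef l m *+ n]mulr_natr.
under eq_bigr => i _ do rewrite !incr_noise// mulrACA -expr2 sqr_sqrtr ?divr_ge0 ?ltW//.
rewrite -mulr_sumr; move: q0 q2; set q := Num.sqrt n%:R => q0 <-.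
by field; rewrite gt_eqF.
Qed.

Lemma OP1_fluct l m : OP1 P (fun n => fluct n l m).
Proof.
(* Any of the [B i] can serve as the reference Wiener process of the Gaussian lemmas. A single
   product is involved, hence the index type [unit]. *)
have i0 : 'I_p := l.
apply: (@OP1_mean_sqr _ _ _ _ _ (quad_var coef (fun _ : unit => (l, m)) (fun _ => 1))).
exists 1%N => n n0.
apply: mean_is_ext (quad_form_variance T0 (hB i0) (@std_incr_normal n) (std_incr_indep n0)
  coef (fun _ : unit => (l, m)) (fun _ => 1) n0) => w.
rewrite /fluct; congr ((_ * _) ^+ 2); apply: eq_bigr => i _.
by rewrite /quad_form (bigD1 tt)//= big1 ?addr0 ?mul1r// => -[].
Qed.

Let meas_state t l : 0 <= t <= T -> measurable_fun setT (fun w => X t w l 0).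
Proof.
move=> tT; rewrite (_ : (fun w => _) = fun w =>
    \sum_j loading hkp theta0 l j * f t w j 0 + e t w l 0).
  apply: measurable_funD; last exact: (he l).1.
  by apply: measurable_sum => j; apply: measurable_funM => //; exact: (hf j).1.
by apply/funext => w; rewrite hX// !mxE.
Qed.

Let meas_noise t l : 0 <= t <= T -> measurable_fun setT (noise l t).
Proof.
move=> tT; apply: measurable_sum => c; apply: measurable_funM => //.
by have [h _ _ _] := source_wiener c; exact: h.
Qed.

Let meas_incr (x : R -> Omega -> R) n (i : 'I_n) :
  (forall t, 0 <= t <= T -> measurable_fun setT (x t)) ->
  measurable_fun setT (fun w => incr T (fun t => x t w) n i).
Proof.
move=> mx; have n0 : (0 < n)%N by exact: leq_ltn_trans (ltn_ord i).
by apply: measurable_funB; apply: mx; apply: gridP => //; exact: ltnW.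
Qed.

Let energy n l w := \sum_(i < n) incr T (fun t => noise l t w) n i ^+ 2.

Let energy_ge0 n l w : 0 <= energy n l w.
Proof. by apply: sumr_ge0 => i _; exact: sqr_ge0. Qed.

Let OP1_energy l : OP1 P (fun n => energy n l).
Proof.
have nrm (Y : nat -> Omega -> R) : OP1 P Y -> OP1 P (fun n w => `|Y n w|).
  by move=> hY; apply: OP1_le hY _; exists 0%N => n w _; rewrite normr_id.
have h := OP1D (nrm _ (OP1_cst P (T * gram coef l l))) (nrm _ (OP1Z T (OP1_fluct l l))).
apply: OP1_le h _; exists 1%N => n w n0.
rewrite [leRHS]ger0_norm ?addr_ge0// /energy (eq_bigr _ (fun i _ => expr2 _)).
rewrite sum_incr_noise// mulrDr (le_trans (ler_normD _ _))// lerD2l.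
rewrite mulrCA normrM ler_piMl// ger0_norm ?invr_ge0 ?sqrtr_ge0//.
by rewrite invf_le1 ?sqrtr_gt0 ?ltr0n// -[leLHS]sqrtr1 ler_wsqrtr// ler1n.
Qed.

Let remainder n l m w := Num.sqrt n%:R *
  (\sum_(i < n) incr T (fun t => X t w l 0) n i * incr T (fun t => X t w m 0) n i -
   \sum_(i < n) incr T (fun t => noise l t w) n i * incr T (fun t => noise m t w) n i).

(** Along almost every path the remainder is o(1) times 1 plus the two energies, and the energies
    are tight. *)
Let oP1_remainder l m : oP1 P (fun n => remainder n l m).
Proof.
apply: (@oP1_ae_dominated _ _ _ _ _ (fun n w => 1 + energy n l w + energy n m w)).
- move=> n; apply: measurable_funM => //; apply: measurable_funB.
    by apply: measurable_sum => i; apply: measurable_funM; apply: meas_incr => t tT; exact: meas_state.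
  by apply: measurable_sum => i; apply: measurable_funM; apply: meas_incr => t tT; exact: meas_noise.
- move=> n; apply: measurable_funD; first apply: measurable_funD => //.
    by apply: measurable_sum => i; apply: measurable_funX; apply: meas_incr => t tT; exact: meas_noise.
  by apply: measurable_sum => i; apply: measurable_funX; apply: meas_incr => t tT; exact: meas_noise.
- by move=> n w; rewrite -addrA lerDl addr_ge0.
- by apply: OP1D => //; apply: OP1D => //; exact: OP1_cst.
- apply: filterS drift_ae => w h eps eps0.
  have [N hN] := quadratic_variation_drift T0 (h l).1 (h m).1 (h l).2 (h m).2 eps0.
  by exists N => n /hN; rewrite /remainder normrM (ger0_norm (sqrtr_ge0 _)).
Qed.

Lemma QXX_entry n w l m : QXX T n (fun t => X t w) l m =
  T^-1 * \sum_(i < n) incr T (fun t => X t w l 0) n i * incr T (fun t => X t w m 0) n i.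
Proof.
rewrite /QXX mxE big_add1 /= big_mkord summxE; congr (_ * _); apply: eq_bigr => i _.
by rewrite mxE big_ord1 !mxE.
Qed.

Hypothesis hS0 : par_Sff theta0 = S0 *m S0^T.
Hypothesis hsigma : forall i, 0 < par_sigma theta0 i.

Lemma QXX_expansion l m : oP1 P (fun n w =>
  Num.sqrt n%:R * (QXX T n (fun t => X t w) l m - Sigma hkp theta0 l m) - fluct n l m w).
Proof.
have h := oP1M (oP1_remainder l m) (OP1_cst P T^-1).
apply: oP1_le h _; exists 1%N => n w n0; rewrite le_eqVlt; apply/orP; left; apply/eqP.
congr `|_|; rewrite QXX_entry -(noise_mx_sqr hkp hS0 hsigma) -gram_coef /remainder.
rewrite sum_incr_noise//; have nR : (0 : R) < n%:R by rewrite ltr0n.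
have q0 : 0 < Num.sqrt (n%:R : R) by rewrite sqrtr_gt0.
by field; rewrite !gt_eqF.
Qed.

End expansion.

(** * Passage to the normal limit *)

Section normal_limit.
Context {R : realType} d (Omega : measurableType d) (P : probability Omega R).
Context {q : nat}.

Lemma nrm1_cV (x : 'cV[R]_q) : nrm1 x = \sum_i `|x i 0|.
Proof. by apply: eq_bigr => i _; rewrite big_ord1. Qed.

Lemma inner_le (a x : 'cV[R]_q) : `|inner a x| <= nrm1 a * nrm1 x.
Proof.
by rewrite /inner (le_trans (entry_nrm1_le _ _ _))// (le_trans (nrm1M _ _))// nrm1_tr.
Qed.

Lemma oP1_nrm1 (x : nat -> Omega -> 'cV[R]_q) :
  (forall i, oP1 P (fun n w => x n w i 0)) -> oP1 P (fun n w => nrm1 (x n w)).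
Proof.
move=> hx; have ha i : oP1 P (fun n w => `|x n w i 0|).
  by apply: oP1_le (hx i) _; exists 0%N => n w _; rewrite normr_id.
apply: oP1_le (oP1_sum (index_enum 'I_q) ha) _.
by exists 0%N => n w _; rewrite nrm1_cV.
Qed.

Lemma OP1_nrm1 (x : nat -> Omega -> 'cV[R]_q) :
  (forall i, OP1 P (fun n w => x n w i 0)) -> OP1 P (fun n w => nrm1 (x n w)).
Proof.
move=> hx; have ha i : OP1 P (fun n w => `|x n w i 0|).
  by apply: OP1_le (hx i) _; exists 0%N => n w _; rewrite normr_id.
apply: OP1_le (OP1_sum (index_enum 'I_q) ha) _.
by exists 0%N => n w _; rewrite nrm1_cV.
Qed.

Lemma multinormal_inner (V : 'M[R]_q) (Z : Omega -> 'cV[R]_q) a :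
  multinormal P 0 V Z -> normal_rv P (fun w => inner a (Z w)) (quad V a a).
Proof.
move=> [mZ hZ]; split; first exact: inner_measurable.
by move=> U mU; have := hZ a U mU; rewrite mulmx0 mxE.
Qed.

Lemma multinormal_lin (N : nat) (T : R) (B : R -> Omega -> R) (M : 'M[R]_(q, N))
    (xi : 'I_N -> Omega -> R) : 0 < T -> wiener1 P T B ->
  (forall i, normal_rv P (xi i) 1) -> indep_family P xi ->
  multinormal P 0 (M *m M^T) (fun w => M *m \col_i xi i w).
Proof.
move=> T0 hB hxi ind; split=> [j|a U mU].
  rewrite (_ : (fun w => _) = fun w => \sum_i M j i * xi i w).
    by apply: measurable_sum => i; apply: measurable_funM => //; exact: (hxi i).1.
  by apply/funext => w; rewrite mxE; apply: eq_bigr => i _; rewrite mxE.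
have [_ /(_ U mU)] := lin_normal T0 hB hxi ind (fun i => (a^T *m M) 0 i).
rewrite mulmx0 mxE.
have -> : dot (fun i => (a^T *m M) 0 i) (fun i => (a^T *m M) 0 i) =
    (a^T *m (M *m M^T) *m a) 0 0.
  rewrite mulmxA -(mulmxA _ M^T) (_ : M^T *m a = (a^T *m M)^T); last by rewrite trmx_mul trmxK.
  by rewrite [RHS]mxE; apply: eq_bigr => i _; congr (_ * _); rewrite [RHS]mxE.
move=> <-; congr (P _); apply/funext => w; congr U.
by rewrite /lin mulmxA mxE; apply: eq_bigr => i _; congr (_ * _); rewrite mxE.
Qed.

Let bounded_mean (X : Omega -> R) : measurable_fun setT X -> (forall w, `|X w| <= 1) ->
  mean_is P X (\int[P]_w X w).
Proof. by move=> mX X1; apply: mean_isP; apply: (@integrable_bounded _ _ _ _ _ 1). Qed.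

(** Slutsky's argument for one function: off an exceptional event [h] moves by at most the distance
    between [Y] and [U], and on it by at most 2. The sequence is shifted by one since [Y n] is known
    to be measurable for n > 0 only. *)
Let trig_limit (h : R -> R) (Y U : nat -> Omega -> R) (u : nat -> R) (l : R) :
  (forall x y, `|h x - h y| <= `|x - y|) -> (forall x, `|h x| <= 1) -> continuous h ->
  (forall n, (0 < n)%N -> measurable_fun setT (Y n)) ->
  oP1 P (fun n w => Y n w - U n w) ->
  (forall n, (0 < n)%N -> mean_is P (fun w => h (U n w)) (u n)) -> u @ \oo --> l ->
  \int[P]_w h (Y n.+1 w) @[n --> \oo] --> l.
Proof.
move=> hL h1 ch mY YU hU ul.
suff : \int[P]_w h (Y n w) @[n --> \oo] --> l by rewrite -cvg_shiftS.
apply/cvgrPdist_le => eps eps0; have e4 : 0 < eps / 4 by rewrite divr_gt0.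
have [N hN] := YU _ e4.
move/cvgrPdist_le: ul => /(_ _ e4)[N' _ hN'].
exists (maxn 1 (maxn N N')) => // n /=; rewrite !geq_max => /and3P[n0 /hN[A [mA PA hA]] /hN' hu].
have mh : measurable_fun setT (fun w => h (Y n w)).
  by apply: measurableT_comp; [exact: continuous_measurable_fun|exact: mY].
have := mean_is_norm_le _ (mean_isB (bounded_mean mh (fun w => h1 _)) (hU n n0))
  (mean_isD (mean_is_cst P (eps / 4)) (mean_isZ 2 (mean_is_indic P mA))).
have bd w : `|h (Y n w) - h (U n w)| <= eps / 4 + 2 * \1_A w.
  have [Aw|Aw] := pselect (A w).
    rewrite indicE mem_set// mulr1 ler_wpDl ?(ltW e4)//.
    by rewrite (le_trans (ler_normB _ _))//; have := h1 (Y n w); have := h1 (U n w); lra.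
  by rewrite indicE memNset// mulr0 addr0 (le_trans (hL _ _))// hA.
move=> /(_ bd) hd.
have PA' : fine (P A) <= eps / 4 by rewrite -lee_fin fineK// fin_num_measure.
rewrite /= in hu.
rewrite (_ : l - _ = (l - u n) - (\int[P]_w h (Y n w) - u n)); last by rewrite opprB addrA subrK.
rewrite (le_trans (ler_normB _ _))//; lra.
Qed.

(** Each inner a (Y n) is replaced by an asymptotically equivalent variable whose cosine and sine
    means converge to those of inner a Z. The tightness of [Z] itself comes from its second
    moments. *)
Lemma weak_cvg_normal (T : R) (B : R -> Omega -> R) (V : 'M[R]_q) (Z : Omega -> 'cV[R]_q)
    (Y : nat -> Omega -> 'cV[R]_q) : 0 < T -> wiener1 P T B ->
  (forall a, 0 <= quad V a a) -> multinormal P 0 V Z ->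
  (forall n, (0 < n)%N -> random_vector (Y n)) ->
  OP1 P (fun n w => nrm1 (Y n w)) ->
  (forall a, exists U c s, [/\ oP1 P (fun n w => inner a (Y n w) - U n w),
    forall n, (0 < n)%N -> mean_is P (fun w => cos (U n w)) (c n),
    forall n, (0 < n)%N -> mean_is P (fun w => sin (U n w)) (s n),
    c @ \oo --> expR (- (quad V a a / 2)) & s @ \oo --> (0 : R)]) ->
  forall g : 'cV[R]_q -> R, continuous g -> (exists M, forall x, `|g x| <= M) ->
    ('E_P[fun w => g (Y n w)] @[n --> \oo] --> 'E_P[fun w => g (Z w)])%E.
Proof.
move=> T0 hB V0 hZ mY tY hY g cg bg.
suff : ('E_P[fun w => g (Y n.+1 w)] @[n --> \oo] --> 'E_P[fun w => g (Z w)])%E.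
  by rewrite -(cvg_shiftS (fun n => 'E_P[fun w => g (Y n w)]%E)).
have mZ : random_vector Z := hZ.1.
apply: (weak_cvg_trig (Y := fun n => Y n.+1)) => //.
- by move=> n; exact: mY.
- move=> a; have [[_ ->] _] := normal_rv_trig T0 hB (V0 a) (multinormal_inner a hZ).
  have [U [c [s [h1 h2 _ h3 _]]]] := hY a.
  apply: (trig_limit (Y := fun n w => inner a (Y n w)) _ _ _ _ h1 h2 h3).
  + exact: cos_lipschitz.
  + exact: cos_max.
  + exact: continuous_cos.
  + by move=> n n0; apply: inner_measurable; exact: mY.
- move=> a; have [_ [_ ->]] := normal_rv_trig T0 hB (V0 a) (multinormal_inner a hZ).
  have [U [c [s [h1 _ h2 _ h3]]]] := hY a.
  apply: (trig_limit (Y := fun n w => inner a (Y n w)) _ _ _ _ h1 h2 h3).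
  + exact: sin_lipschitz.
  + exact: sin_max.
  + exact: continuous_sin.
  + by move=> n n0; apply: inner_measurable; exact: mY.
- move=> eps eps0; have [L1 L10 [N1 h1]] := tY _ eps0.
  have tZ : OP1 P (fun _ w => nrm1 (Z w)).
    apply: OP1_nrm1 => i; pose a : 'cV[R]_q := delta_mx i 0.
    apply: (@OP1_mean_sqr _ _ _ _ _ (quad V a a)); exists 0%N => n _.
    have [h _ _] := normal_rv_moments (V0 a) (multinormal_inner a hZ).
    apply: mean_is_ext h => w; congr (_ ^+ 2).
    rewrite innerE (bigD1 i)//= big1 ?addr0 => [|j /negbTE ji].
      by rewrite /a mxE !eqxx mul1r.
    by rewrite /a mxE ji mul0r.
  have [L2 L20 [N2 h2]] := tZ _ eps0.
  have out (y : Omega -> 'cV[R]_q) L A : random_vector y -> L <= Num.max L1 L2 -> measurable A ->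
      (P A <= eps%:E)%E -> (forall w, ~ A w -> `|nrm1 (y w)| <= L) ->
      fine (P (outside y (Num.max L1 L2))) <= eps.
    move=> my LL mA PA hA; have mo := measurable_outside my (Num.max L1 L2).
    rewrite -lee_fin fineK ?fin_num_measure// (le_trans _ PA)//.
    apply: le_measure; rewrite ?inE// => w /= [j yj]; apply: contrapT => /hA yL.
    have := entry_nrm1_le (y w) j 0; have := ler_norm (nrm1 (y w)).
    by move=> u1 u2; move: yj; rewrite ltNge => /negP; apply; lra.
  exists (Num.max L1 L2); first by rewrite lt_max L10.
  split; last first.
    have [A [mA PA hA]] := h2 _ (leqnn N2).
    by apply: out mA PA hA; rewrite // le_max lexx orbT.
  exists N1 => // n /= nN; have [A [mA PA hA]] := h1 n.+1 (leqW nN).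
  by apply: out mA PA hA; [exact: mY|rewrite le_max lexx].
Qed.

End normal_limit.

Lemma invsqrt_cvg0 (R : realType) : (fun n => (Num.sqrt (n%:R : R))^-1) @ \oo --> (0 : R).
Proof.
apply/cvgrPdist_le => eps eps0; exists (Num.bound (eps^-1 ^+ 2)) => // n /= Nn.
have e2 : eps^-1 ^+ 2 <= n%:R.
  by rewrite (le_trans (ltW (archi_boundP (sqr_ge0 _))))// ler_nat.
have s : eps^-1 <= Num.sqrt n%:R.
  have ei : 0 <= eps^-1 by rewrite invr_ge0 ltW.
  by rewrite -(ger0_norm ei) -sqrtr_sqr ler_wsqrtr.
have s0 : 0 < Num.sqrt (n%:R : R) by rewrite (lt_le_trans _ s)// invr_gt0.
by rewrite sub0r normrN gtr0_norm ?invr_gt0// invf_ple.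
Qed.

Lemma mc_lin_cov (R : realType) (q m : nat) (th0 : 'cV[R]_q) (W : 'cV[R]_q -> 'M[R]_m)
    (D : 'M[R]_(m, q)) : posdef (W th0) -> (forall t : 'cV_q, D *m t = 0 -> t = 0) ->
  mc_lin th0 W D *m W th0 *m (mc_lin th0 W D)^T = invmx (D^T *m invmx (W th0) *m D).
Proof.
move=> Wp D_inj; have [Vs V0] := posdef_inv Wp.
set V := invmx (W th0) in Vs V0 *; pose H := D^T *m V *m D.
have Hs : H^T = H by rewrite /H !trmx_mul trmxK Vs mulmxA.
have Hu : H \in unitmx.
  apply: posdef_unit; split=> // t t0.
  have -> : quad H t t = quad V (D *m t) (D *m t) by rewrite /quad /H trmx_mul !mulmxA.
  by apply: V0; apply: contra_neq t0; exact: D_inj.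
have L1 : mc_lin th0 W D *m W th0 = invmx H *m D^T.
  by rewrite /mc_lin -/V -/H mulmxKV// posdef_unit.
have L2 : (mc_lin th0 W D)^T = V *m D *m invmx H.
  by rewrite /mc_lin -/V -/H !trmx_mul trmxK Vs trmx_inv Hs mulmxA.
rewrite L1 L2 -/H.
have -> : invmx H *m D^T *m (V *m D *m invmx H) = invmx H *m (H *m invmx H).
  by rewrite /H !mulmxA.
by rewrite mulmxV// mulmx1.
Qed.

Lemma enorm_le_nrm1 (R : realType) (n : nat) (x : 'cV[R]_n) : enorm x <= nrm1 x.
Proof.
rewrite -[leRHS]ger0_norm ?nrm1_ge0// -sqrtr_sqr ler_wsqrtr// nrm1_cV expr2 mulr_sumr.
apply: ler_sum => i _; rewrite -real_normK ?num_real// expr2 ler_wpM2r//.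
by rewrite (bigD1 i)//= lerDl sumr_ge0.
Qed.

Lemma oP1_cvg_in_prob (R : realType) d (Omega : measurableType d) (P : probability Omega R)
    (n : nat) (X : nat -> Omega -> 'cV[R]_n) (x : 'cV[R]_n) :
  (forall m, (0 < m)%N -> random_vector (X m)) ->
  oP1 P (fun m w => nrm1 (X m w - x)) -> cvg_in_prob P X x.
Proof.
move=> mX hX eps eps0.
have mE m : (0 < m)%N -> measurable [set w | eps < enorm (X m w - x)].
  move=> m0; apply: measurable_gt; apply: measurableT_comp.
    by apply: continuous_measurable_fun; exact: sqrt_continuous.
  apply: measurable_sum => i; apply: measurable_funX.
  rewrite (_ : (fun w => _) = fun w => X m w i 0 - x i 0).
    by apply: measurable_funB => //; exact: mX.
  by apply/funext => w; rewrite !mxE.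
apply/fine_cvgP; split.
  by exists 1%N => // m /= m0; rewrite fin_num_measure//; exact: mE.
(* With the minimum, one exceptional event bounds the probability by [e] and the deviation by
   [eps]. *)
apply/cvgrPdist_le => e e0; have ee0 : 0 < Num.min e eps by rewrite lt_min e0.
have [N hN] := hX _ ee0.
exists (maxn 1 N) => // m /=; rewrite geq_max => /andP[m0 /hN[A [mA PA hA]]].
rewrite sub0r normrN ger0_norm ?fine_ge0// -lee_fin fineK; last first.
  by rewrite fin_num_measure//; exact: mE.
apply: (@le_trans _ _ (P A)).
  apply: le_measure; rewrite ?inE//; first exact: mE.
  move=> w /= h; apply: contrapT => /hA; rewrite ger0_norm ?nrm1_ge0// => h'.
  have := le_trans (enorm_le_nrm1 (X m w - x)) h'.
  by rewrite le_min => /andP[_]; rewrite leNgt h.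
by rewrite (le_trans PA)// lee_fin ge_min lexx.
Qed.

Section fluctuations.
Context (R : realType) (k p r : nat) (hkp : (k <= p)%N).
Context (theta0 : 'cV[R]_(qdim p k)) (S0 : 'M[R]_(k, r)) (T : R).
Hypothesis T0 : 0 < T.
Context d (Omega : measurableType d) (P : probability Omega R).
Context (W : R -> Omega -> 'cV[R]_r) (B : 'I_p -> R -> Omega -> R).
Hypotheses (hW : wiener P T W) (hB : forall i, wiener1 P T (B i)).
Hypothesis hWB : wiener_indep P T W B.
Hypothesis hS0 : par_Sff theta0 = S0 *m S0^T.
Hypothesis hsigma : forall i, 0 < par_sigma theta0 i.
Local Notation pos := (tnth (lower_pos p)).

Definition vech_fluct (n : nat) (w : Omega) : 'cV[R]_(hdim p) :=
  \col_l fluct hkp theta0 S0 T W B n (pos l).1 (pos l).2 w.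

(** A linear functional of the fluctuations is a normalised sum of quadratic forms, whose pairs of
    linear forms are the lower-triangular positions. Its variance [quad_var] is the quadratic form
    of [Wmat], by [avarE] and because the Gram matrix of [coef] is [Sigma] at [theta0]. *)
Lemma vech_fluct_trig (i0 : 'I_p) (al : 'cV[R]_(hdim p)) : exists c s : nat -> R,
  [/\ forall n, (0 < n)%N -> mean_is P (fun w => cos (inner al (vech_fluct n w))) (c n),
      forall n, (0 < n)%N -> mean_is P (fun w => sin (inner al (vech_fluct n w))) (s n),
      c @ \oo --> expR (- (quad (Wmat hkp theta0) al al / 2)) & s @ \oo --> (0 : R)].
Proof.
set g := coef hkp theta0 S0.
pose b l := al l 0.
have innE n w : inner al (vech_fluct n w) = (Num.sqrt n%:R)^-1 *
    \sum_(i < n) quad_form (@std_incr _ _ _ T _ _ W B n) g pos b i w.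
  rewrite innerE exchange_big/= mulr_sumr; apply: eq_bigr => l _.
  by rewrite mxE /fluct mulrCA -mulr_sumr.
have vE : quad_var g pos b = quad (Wmat hkp theta0) al al.
  rewrite /quad_var /quad mxE exchange_big /=; apply: eq_bigr => m _.
  rewrite mxE mulr_suml; apply: eq_bigr => l _.
  by rewrite mxE WmatE avarE -(noise_mx_sqr hkp hS0 hsigma) -!gram_coef /b -/g; ring.
set C := 2 * quad_bound g pos b + quad_var g pos b + quad_var g pos b ^+ 2.
have clt n (n0 : (0 < n)%N) := quad_form_clt T0 (hB i0)
  (std_incr_normal T0 hW hB (n := n)) (std_incr_indep T0 hW hB hWB n0) g pos b n0.
exists (fun n => \int[P]_w cos (inner al (vech_fluct n w))).
exists (fun n => \int[P]_w sin (inner al (vech_fluct n w))).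
have lim (u : nat -> R) l : (forall n, (0 < n)%N -> `|u n - l| <= (Num.sqrt n%:R)^-1 * C) ->
    u @ \oo --> l.
  move=> hu; apply/cvgrPdist_le => eps eps0.
  have C1 : 0 < `|C| + 1 by rewrite ltr_wpDl.
  have /cvgrPdist_le/(_ _ (divr_gt0 eps0 C1))[N _ hN] := @invsqrt_cvg0 R.
  exists (maxn 1 N) => // n /=; rewrite geq_max => /andP[n0 /hN /=].
  rewrite sub0r normrN ger0_norm ?invr_ge0 ?sqrtr_ge0// => h.
  rewrite distrC (le_trans (hu n n0))//.
  apply: (@le_trans _ _ (eps / (`|C| + 1) * (`|C| + 1))); last by rewrite divfK// gt_eqF.
  apply: (@le_trans _ _ ((Num.sqrt n%:R)^-1 * (`|C| + 1))); last by rewrite ler_wpM2r// ltW.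
  by rewrite ler_wpM2l ?invr_ge0 ?sqrtr_ge0// ler_wpDr// ler_norm.
have trigE n (h : R -> R) : (fun w => h (inner al (vech_fluct n w))) = fun w => h ((Num.sqrt n%:R)^-1 *
    \sum_(i < n) quad_form (@std_incr _ _ _ T _ _ W B n) g pos b i w).
  by apply/funext => w; rewrite innE.
split=> [n n0|n n0||].
- by rewrite trigE; have [c [s [hc _ _ _]]] := clt n n0; have [_ e] := hc; rewrite e.
- by rewrite trigE; have [c [s [_ hs _ _]]] := clt n n0; have [_ e] := hs; rewrite e.
- apply: lim => n n0; rewrite trigE; have [c [s [[_ ->] _ + _]]] := clt n n0.
  by rewrite -vE.
- by apply: lim => n n0; rewrite trigE subr0; have [c [s [_ [_ ->] _]]] := clt n n0.
Qed.

End fluctuations.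

Theorem theorem6 (R : realType) (k p r : nat)
  (hk : (1 <= k)%N) (hkp : (k < p)%N) (hr : (1 <= r)%N)
  (* parameter space and true parameter *)
  (Theta : set 'cV[R]_(qdim p k)) (theta0 : 'cV[R]_(qdim p k))
  (hTheta_convex : convex_set Theta) (hTheta_compact : compact Theta)
  (hTheta_Sff : forall theta, Theta theta ->
     exists S : 'M[R]_(k, r), par_Sff theta = S *m S^T)
  (htheta0 : (Theta°) theta0)
  (S0 : 'M[R]_(k, r)) (hS0 : par_Sff theta0 = S0 *m S0^T)
  (* observed process *)
  (T : R) (hT : 0 < T)
  (d : measure_display) (Omega : measurableType d) (P : probability Omega R)
  (W : R -> Omega -> 'cV[R]_r) (B : 'I_p -> R -> Omega -> R)
  (hW : wiener P T W) (hB : forall i, wiener1 P T (B i))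
  (hWB : wiener_indep P T W B)
  (c1 : 'cV[R]_k) (c2 : 'cV[R]_p)
  (b0 : 'cV[R]_k -> 'cV[R]_k) (B0 : 'I_p -> R -> R)
  (f : R -> Omega -> 'cV[R]_k) (e : R -> Omega -> 'cV[R]_p)
  (hf : forall j, solves_sde P T (c1 j 0) (fun t w => b0 (f t w) j 0)
          (fun t w => (S0 *m W t w) j 0) (fun t w => f t w j 0))
  (he : forall i, solves_sde P T (c2 i 0) (fun t w => B0 i (e t w i 0))
          (fun t w => par_sigma theta0 i * B i t w) (fun t w => e t w i 0))
  (X : R -> Omega -> 'cV[R]_p)
  (hX : forall t w, 0 <= t <= T ->
     X t w = loading (ltnW hkp) theta0 *m f t w + e t w)
  (* (i) *)
  (hb_lip : exists2 C : R, 0 < C &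
     forall x y, enorm (b0 x - b0 y) <= C * enorm (x - y))
  (hf_mom : bounded_moments P T f)
  (hb_C4 : forall j, C4up (fun x => b0 x j 0))
  (* (ii) *)
  (hB0_lip : exists2 C : R, 0 < C &
     forall i x y, `|B0 i x - B0 i y| <= C * `|x - y|)
  (he_mom : bounded_moments P T e)
  (hB0_C4 : forall i, C4up1 (B0 i))
  (* (iii) *)
  (hsigma : forall theta, Theta theta -> forall i, 0 < par_sigma theta i)
  (* (iv) *)
  (hident : forall theta, Theta theta ->
     Sigma (ltnW hkp) theta = Sigma (ltnW hkp) theta0 -> theta = theta0)
  (* (v) *)
  (hrank : \rank (Delta (ltnW hkp) theta0) = qdim p k)
  (* minimum contrast estimator *)
  (thetahat : nat -> Omega -> 'cV[R]_(qdim p k))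
  (hhat_meas : forall n, (0 < n)%N -> random_vector (thetahat n))
  (hhat_min : forall n w, (0 < n)%N ->
     Theta (thetahat n w) /\
     forall theta, Theta theta ->
       contrast (ltnW hkp) (QXX T n (fun t => X t w)) (thetahat n w)
       <= contrast (ltnW hkp) (QXX T n (fun t => X t w)) theta) :
  cvg_in_prob P thetahat theta0 /\
  cvg_in_dist_normal P
    (fun n w => Num.sqrt n%:R *: (thetahat n w - theta0))
    0
    (invmx ((Delta (ltnW hkp) theta0)^T *m invmx (Wmat (ltnW hkp) theta0)
            *m Delta (ltnW hkp) theta0)).

Proof.
pose hkp' := ltnW hkp.
pose s (t : 'cV[R]_(qdim p k)) := vech (Sigma hkp' t).
pose D := Delta hkp' theta0; pose Wm (t : 'cV[R]_(qdim p k)) := Wmat hkp' t.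
pose Lc := mc_lin theta0 Wm D.
have Th0 : Theta theta0 := interior_subset htheta0.
have i0 : 'I_p := Ordinal (leq_ltn_trans (leq0n k) hkp).
have Wp t : Theta t -> posdef (Wm t).
  by move=> Tt; have [S hS] := hTheta_Sff t Tt; exact: Wmat_posdef hS (hsigma t Tt).
have Ssym t : Theta t -> (Sigma hkp' t)^T = Sigma hkp' t.
  by move=> Tt; apply: Sigma_sym; have [S hS] := hTheta_Sff t Tt; exists r, S.
have ident t : Theta t -> s t = s theta0 -> t = theta0.
  move=> Tt st; apply: hident => //.
  by rewrite -(vechK (Ssym t Tt)) -(vechK (Ssym _ Th0)); congr unvech.
have D_inj := Delta_inj hrank.
have s_cont i : continuous (fun t => s t i 0).
  rewrite (_ : (fun t => _) = fun t =>
    Sigma hkp' t (tnth (lower_pos p) i).1 (tnth (lower_pos p) i).2).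
    exact: continuous_Sigma.
  by apply/funext => t; rewrite mxE.
have linear := minimum_contrast_linear hTheta_compact htheta0 s_cont
  (@continuous_Wmat _ _ _ hkp') (@Delta_expansion _ _ _ hkp' theta0) Wp ident D_inj.
have cb0 j : continuous (fun x => b0 x j 0) by exact: ((hb_C4 j).2 [::] isT).1.
have cB0 i : continuous (B0 i) by exact: ((hB0_C4 i).2 0%N isT).1.
pose v n w := vech (QXX T n (fun t => X t w)) - s theta0.
pose U n w := Num.sqrt (n%:R : R) *: v n w.
pose Y n w := Num.sqrt (n%:R : R) *: (thetahat n w - theta0).
pose Fl := vech_fluct hkp' theta0 S0 T W B.
have rho l : oP1 P (fun n w => (U n w - Fl n w) l 0).
  apply: oP1_le (QXX_expansion hT hW hB hWB hf he hX cb0 cB0 hS0 (hsigma _ Th0)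
    (tnth (lower_pos p) l).1 (tnth (lower_pos p) l).2) _.
  by exists 0%N => n w _; rewrite !mxE.
have tU : OP1 P (fun n w => nrm1 (U n w)).
  apply: OP1_nrm1 => l.
  apply: OP1_le (OP1D (oP1_OP1 (rho l)) (OP1_fluct hkp' theta0 S0 hT hW hB hWB
    (tnth (lower_pos p) l).1 (tnth (lower_pos p) l).2)) _.
  by exists 0%N => n w _; rewrite !mxE subrK.
(* [v] is U / sqrt n with [U] tight, so it eventually falls within [delta] with high probability;
   the error eps / M times nrm1 v, rescaled by sqrt n, is at most eps when nrm1 U <= M. *)
have lin_error : oP1 P (fun n w => nrm1 (Y n w - Lc *m U n w)).
  move=> eps eps0; have [M M0 [N1 h1]] := tU _ eps0.
  have [delta delta0 hd] := linear _ (divr_gt0 eps0 M0).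
  have /cvgrPdist_le/(_ _ (divr_gt0 delta0 M0))[N2 _ h2] := @invsqrt_cvg0 R.
  exists (maxn 1 (maxn N1 N2)) => n; rewrite !geq_max => /and3P[n0 /h1[A [mA PA hA]] /h2 /=].
  have q0 : 0 < Num.sqrt (n%:R : R) by rewrite sqrtr_gt0 ltr0n.
  rewrite sub0r normrN gtr0_norm ?invr_gt0// => hq.
  exists A; split=> // w /hA; rewrite !ger0_norm ?nrm1_ge0// => UM.
  have vU : nrm1 (v n w) = (Num.sqrt n%:R)^-1 * nrm1 (U n w).
    by rewrite nrm1Z gtr0_norm// mulKf// gt_eqF.
  have vd : nrm1 (v n w) <= delta.
    rewrite vU (@le_trans _ _ (delta / M * M))//; last by rewrite divfK// gt_eqF.
    by rewrite ler_pM ?invr_ge0 ?sqrtr_ge0 ?nrm1_ge0.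
  have [Tn hmin] := hhat_min n w n0.
  have := hd (v n w) (thetahat n w) vd Tn; rewrite /mc_contrast /v addrCA subrr addr0.
  move=> /(_ hmin) hlin.
  rewrite (_ : Y n w - Lc *m U n w =
    Num.sqrt n%:R *: (thetahat n w - theta0 - Lc *m v n w)); last first.
    by rewrite scalerBr -scalemxAr.
  rewrite nrm1Z gtr0_norm//.
  apply: (@le_trans _ _ (Num.sqrt n%:R * (eps / M * nrm1 (v n w)))).
    by apply: ler_wpM2l; [exact: ltW|exact: hlin].
  rewrite vU mulrCA mulVKf ?gt_eqF//.
  apply: (@le_trans _ _ (eps / M * M)); last by rewrite divfK// gt_eqF.
  by apply: ler_wpM2l => //; exact: ltW (divr_gt0 eps0 M0).
have tY : OP1 P (fun n w => nrm1 (Y n w)).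
  apply: OP1_le (OP1D (oP1_OP1 lin_error) (OP1Z (nrm1 Lc) tU)) _.
  exists 0%N => n w _; rewrite !ger0_norm ?addr_ge0 ?mulr_ge0 ?nrm1_ge0//.
  rewrite -{1}(subrK (Lc *m U n w) (Y n w)) (le_trans (nrm1D _ _))// lerD2l.
  exact: nrm1M.
split.
  (* The estimation error is [Y] divided by sqrt n, with [Y] tight. *)
  apply: oP1_cvg_in_prob => //; apply: oP1_le (oP1M (oP1_cvg P (@invsqrt_cvg0 R)) tY) _.
  exists 1%N => n w n0; have q0 : 0 < Num.sqrt (n%:R : R) by rewrite sqrtr_gt0 ltr0n.
  by rewrite /Y nrm1Z (gtr0_norm q0) mulKf ?gt_eqF.
(* The limit vector lives on the same space: it is a linear image of (r + p)^2 independent standard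
   normal variables, the normalised increments of the single process [B i0]. *)
exists d, Omega, P.
pose G := noise_mx hkp' S0 theta0.
(* A square root of L W L^T: by [avar_sqr], W = 2 M M^T with M the product of [half_sel] and
   [tensmx G G], whence the factor sqrt 2. *)
pose K := Num.sqrt (2 : R) *: (Lc *m (half_sel *m tensmx G G)).
pose xi (i : 'I_((r + p) * (r + p))) := unit_incr T ((r + p) * (r + p)) (B i0) i.
have N0 : (0 < (r + p) * (r + p))%N by rewrite muln_gt0 !addn_gt0 hr.
have KK : K *m K^T = invmx (D^T *m invmx (Wm theta0) *m D).
  rewrite -mc_lin_cov//; last exact: Wp.
  rewrite /K linearZ/= -scalemxAr -scalemxAl scalerA -expr2 sqr_sqrtr//.
  rewrite /Wm WmatE -(noise_mx_sqr hkp' hS0 (hsigma _ Th0)) avar_sqr -scalemxAr -scalemxAl.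
  by rewrite trmx_mul !mulmxA.
pose Z w := K *m \col_i xi i w.
have hZ : multinormal P 0 (K *m K^T) Z.
  apply: (multinormal_lin K hT (hB i0)).
    by move=> i; exact: (unit_incr_normal hT (hB i0) (ltn_ord i)).
  exact: (unit_incr_indep1 hT N0 (hB i0)).
exists Z; split; first by rewrite -KK.
have Vq a : quad (K *m K^T) a a = quad (Wm theta0) (Lc^T *m a) (Lc^T *m a).
  by rewrite KK -mc_lin_cov//; [rewrite /quad (trmx_mul Lc^T a) trmxK !mulmxA|exact: Wp].
apply: (weak_cvg_normal hT (hB i0) _ hZ) => [a|n n0 i|//|a].
- by rewrite Vq; apply: posdef_ge0; exact: Wp.
- rewrite (_ : (fun w => _) = fun w => Num.sqrt n%:R * (thetahat n w i 0 - theta0 i 0)).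
    by apply: measurable_funM => //; apply: measurable_funB => //; exact: hhat_meas.
  by apply/funext => w; rewrite !mxE.
have [c [s' [h1 h2 h3 h4]]] := vech_fluct_trig hkp' hT hW hB hWB hS0 (hsigma _ Th0) i0 (Lc^T *m a).
exists (fun n w => inner (Lc^T *m a) (Fl n w)), c, s'; split=> //; last by rewrite Vq.
have err1 := oP1M lin_error (OP1_cst P (nrm1 a)).
have err2 := oP1M (oP1_nrm1 rho) (OP1_cst P (nrm1 (Lc^T *m a))).
apply: oP1_le (oP1D err1 err2) _; exists 0%N => n w _.
have innB (m : nat) (b x y : 'cV[R]_m) : inner b x - inner b y = inner b (x - y).
  by rewrite /inner mulmxBr !mxE.
have innL x : inner (Lc^T *m a) x = inner a (Lc *m x).
  by rewrite /inner (trmx_mul Lc^T a) trmxK !mulmxA.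
rewrite [leRHS]ger0_norm ?addr_ge0 ?mulr_ge0 ?nrm1_ge0//.
(* Two errors: the linearisation of the estimator, and the effect of the drift on the realized
   covariation. *)
rewrite (_ : inner a (Y n w) - _ = inner a (Y n w - Lc *m U n w) +
  inner (Lc^T *m a) (U n w - Fl n w)); last first.
  by rewrite -!innB [X in _ = _ + (X - _)]innL; ring.
rewrite (le_trans (ler_normD _ _))// lerD// mulrC; exact: inner_le.
Qed.
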